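(* The stochastic process $Z=(X,\tau,I)$, with state space $K$, is strong Markov.
   Context: Data. $E=\{1,\dots,N\}$ is a finite set, $\mathbb{R}_+=[0,\infty)$. For each $i\in E$: $F^i$ is a smooth, forward-complete vector field on $\mathbb{R}^d$, i.e. for every $x$ the maximal solution $t\mapsto\varphi^i_t(x)$ of $\dot x=F^i(x)$ started at $x$ is defined on an interval $(-s^i(x),\infty)$ with $s^i(x)\in(0,\infty]$; $\mu^i$ is a Borel probability measure on $\mathbb{R}_+$ with $\mu^i(\{0\})=0$, $G^i(t):=\mu^i((t,\infty))$, $\bar t^i:=\inf\{t\ge0:G^i(t)=0\}$ ($\inf\emptyset=+\infty$); $\lambda^i:\mathbb{R}^d\to\mathbb{R}_+$ is continuous, with $0<\inf_{x,i}\lambda^i(x)\le\sup_{x,i}\lambda^i(x)<\infty$. The map $x\mapsto Q(x)=(q_{i,j}(x))_{i,j\in E}$ is continuous and each $Q(x)$ is an irreducible stochastic matrix with zeros on the diagonal. State space. $K=\{(x,s,i)\in\mathbb{R}^d\times\mathbb{R}_+\times E: s<s^i(x),\ \int_{-s}^0\lambda^i(\varphi^i_r(x))\,dr<\bar t^i\}$. For $z=(x,s,i)\in K$ and $t\ge0$, $G_z(t)=G^i\big(\int_{-s}^t\lambda^i(\varphi^i_r(x))\,dr\big)/G^i\big(\int_{-s}^0\lambda^i(\varphi^i_r(x))\,dr\big)$. Process. Let $(U_k)_{k\ge1}$, $(V_k)_{k\ge1}$ be independent i.i.d. sequences of uniform variables on $(0,1]$ and $\psi_z(u)=\inf\{r\ge0:G_z(r)\le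 u\}$. For a starting point $z=(x,s,i)\in K$ put $T_0=0$, $\mathbf{Z}_0=(\mathbf{X}_0,\boldsymbol{\tau}_0,\mathbf{I}_0)=z$, and for $k\ge1$: $S_k=\psi_{\mathbf{Z}_{k-1}}(U_k)$, $T_k=T_{k-1}+S_k$, $\mathbf{X}_k=\varphi^{\mathbf{I}_{k-1}}_{S_k}(\mathbf{X}_{k-1})$, $\boldsymbol{\tau}_k=0$, $\mathbf{I}_k=j$ if $\sum_{l<j}q_{\mathbf{I}_{k-1},l}(\mathbf{X}_k)<V_k\le\sum_{l\le j}q_{\mathbf{I}_{k-1},l}(\mathbf{X}_k)$, $\mathbf{Z}_k=(\mathbf{X}_k,\boldsymbol{\tau}_k,\mathbf{I}_k)$. For $T_k\le t<T_{k+1}$, $Z_t=(X_t,\tau_t,I_t)=(\varphi^{\mathbf{I}_k}_{t-T_k}(\mathbf{X}_k),\boldsymbol{\tau}_k+t-T_k,\mathbf{I}_k)$. Almost surely $T_k\to\infty$ and $Z_t\in K$ for all $t\ge0$. *)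

(* Defs.v *)
From HB Require Import structures.
From mathcomp Require Import all_boot all_order all_algebra.
From mathcomp Require Import all_classical all_reals all_analysis.
From mathcomp Require Import measurable_realfun.

Set Implicit Arguments.
Unset Strict Implicit.
Unset Printing Implicit Defensive.

Import Order.TTheory GRing.Theory Num.Theory.
Import numFieldNormedType.Exports.

Local Open Scope classical_set_scope.
Local Open Scope ring_scope.

(* Matrix spaces carry their Borel sigma-algebra. *)
HB.instance Definition _ (R : realType) (m n : nat) :=
  Measurable.copy 'M[R]_(m, n) (g_sigma_algebraType (@open 'M[R]_(m, n))).

(* A nonempty index set 'I_n.+1 carries the discrete sigma-algebra. *)
HB.instance Definition _ (n : nat) := isPointed.Build 'I_n.+1 ord0.
HB.instance Definition _ (n : nat) :=
  @isMeasurable.Build default_measure_display 'I_n.+1 discrete_measurable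
    discrete_measurable0 discrete_measurableC discrete_measurableU.

(* For each direction v, 'D_v f is again of class C^(k-1). *)
Fixpoint Ck (R : realType) (d k : nat) (f : 'rV[R]_d -> 'rV[R]_d) : Prop :=
  continuous f /\
  match k with
  | 0 => True
  | k'.+1 => forall v : 'rV[R]_d,
      (forall x, derivable f x v) /\ Ck k' (fun x => 'D_v f x)
  end.

Definition smooth (R : realType) (d : nat) (f : 'rV[R]_d -> 'rV[R]_d) : Prop :=
  forall k, Ck k f.

Definition solves (R : realType) (d : nat) (F : 'rV[R]_d -> 'rV[R]_d)
    (J : set R) (y : R -> 'rV[R]_d) : Prop :=
  [/\ open J, is_interval J & forall t, J t -> is_derive t 1 y (F (y t))].

Definition maximal_solution (R : realType) (d : nat)
    (F : 'rV[R]_d -> 'rV[R]_d) (x : 'rV[R]_d) (J : set R)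
    (y : R -> 'rV[R]_d) : Prop :=
  [/\ J 0, y 0 = x, solves F J y &
      forall (J' : set R) (y' : R -> 'rV[R]_d),
        J `<=` J' -> (forall t, J t -> y' t = y t) -> solves F J' y' ->
        J' `<=` J].

Definition stochastic (R : realType) (n : nat) (A : 'M[R]_n) : Prop :=
  (forall i j, 0 <= A i j) /\ (forall i, \sum_j A i j = 1).

Definition irreducible (R : realType) (n : nat) (A : 'M[R]_n) : Prop :=
  forall i j, exists k : nat, (0 < k)%N /\ 0 < (A ^+ k) i j.

(* The finite set of modes {1, ..., N} is 'I_n.+1 with N = n + 1. *)
Record switching_data (R : realType) (d n : nat) := SwitchingData {
  vfield : 'I_n.+1 -> 'rV[R]_d -> 'rV[R]_d ;
  (* flow i t x is meaningful only for t in ]- esc i x, +oo[ *)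
  flow : 'I_n.+1 -> R -> 'rV[R]_d -> 'rV[R]_d ;
  esc : 'I_n.+1 -> 'rV[R]_d -> \bar R ;
  clock : 'I_n.+1 -> probability (measurableTypeR R) R ;
  rate : 'I_n.+1 -> 'rV[R]_d -> R ;
  trans : 'rV[R]_d -> 'M[R]_n.+1
}.

Record standing_assumptions (R : realType) (d n : nat)
    (D : switching_data R d n) : Prop := StandingAssumptions {
  vfield_smooth : forall i, smooth (vfield D i) ;
  esc_gt0 : forall i x, (0 < esc D i x)%E ;
  flow_maximal : forall i x,
    maximal_solution (vfield D i) x [set t | (- esc D i x < t%:E)%E]
      (fun t => flow D i t x) ;
  clock_supp : forall i, clock D i `[0, +oo[%classic = 1%E ;
  clock_0 : forall i, clock D i [set 0] = 0%E ;
  rate_ge0 : forall i x, 0 <= rate D i x ;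
  rate_continuous : forall i, continuous (rate D i) ;
  rate_inf : (0 < ereal_inf
    (range (fun p : 'rV[R]_d * 'I_n.+1 => (rate D p.2 p.1)%:E)))%E ;
  rate_sup : (ereal_sup
    (range (fun p : 'rV[R]_d * 'I_n.+1 => (rate D p.2 p.1)%:E)) < +oo)%E ;
  trans_continuous : continuous (trans D) ;
  trans_stochastic : forall x, stochastic (trans D x) ;
  trans_irreducible : forall x, irreducible (trans D x) ;
  trans_diag : forall x i, trans D x i i = 0
}.

(* The state (x, s, i): position, age and mode. *)
Notation state R d n := (('rV[R]_d * R) * 'I_n.+1)%type.

Definition pos (R : realType) (d n : nat) (z : state R d n) : 'rV[R]_d := z.1.1.
Definition age (R : realType) (d n : nat) (z : state R d n) : R := z.1.2.
Definition mode (R : realType) (d n : nat) (z : state R d n) : 'I_n.+1 := z.2.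

Section construction.
Context (R : realType) (d n : nat) (D : switching_data R d n).
Implicit Types (z : state R d n) (i j : 'I_n.+1).

Definition tail i (t : R) : R := fine (clock D i `]t, +oo[%classic).

(* ereal_inf set0 = +oo *)
Definition tbar i : \bar R :=
  ereal_inf [set t%:E | t in [set t : R | 0 <= t /\ tail i t = 0]].

Definition hazard z (t : R) : R :=
  \int[@lebesgue_measure R]_(r in `[- age z, t])
    rate D (mode z) (flow D (mode z) r (pos z)).

Definition state_space : set (state R d n) :=
  [set z | [/\ 0 <= age z, ((age z)%:E < esc D (mode z) (pos z))%E &
              ((hazard z 0)%:E < tbar (mode z))%E]].

Definition survival z (t : R) : R :=
  tail (mode z) (hazard z t) / tail (mode z) (hazard z 0).

Definition waiting z (u : R) : R :=
  inf [set r : R | 0 <= r /\ survival z r <= u].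

(* The default value i is never used when the row i of trans D x sums to 1
   and v lies in ]0, 1]. *)
Definition next_mode i (x : 'rV[R]_d) (v : R) : 'I_n.+1 :=
  odflt i [pick j : 'I_n.+1 |
    \sum_(l < n.+1 | (l < j)%N) trans D x i l < v
      <= \sum_(l < n.+1 | (l <= j)%N) trans D x i l].

Definition drift z (t : R) : state R d n :=
  (flow D (mode z) t (pos z), age z + t, mode z).

Definition jump z (u v : R) : state R d n :=
  let x := flow D (mode z) (waiting z u) (pos z) in
  (x, 0, next_mode (mode z) x v).

(* Sequences are indexed from 0: u k and v k are the (k+1)-st variables. *)
Fixpoint skeleton z (u v : nat -> R) (k : nat) : state R d n :=
  if k is k'.+1 then jump (skeleton z u v k') (u k') (v k') else z.

Fixpoint jump_time z (u v : nat -> R) (k : nat) : R :=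
  if k is k'.+1
  then jump_time z u v k' + waiting (skeleton z u v k') (u k') else 0.

Definition between_jumps z (u v : nat -> R) (t : R) : set nat :=
  [set k | jump_time z u v k <= t < jump_time z u v k.+1].

(* After a possible explosion, i.e. for t >= lim_k T_k (an event of
   probability 0), the path is set to its starting point z. *)
Definition path_of z (u v : nat -> R) (t : R) : state R d n :=
  if pselect (between_jumps z u v t !=set0) is left _ then
    let k := xget 0%N (between_jumps z u v t) in
    drift (skeleton z u v k) (t - jump_time z u v k)
  else z.

Definition process (Omega : Type) (U V : nat -> Omega -> R) z (t : R)
    (w : Omega) : state R d n :=
  path_of z (fun k => U k w) (fun k => V k w) t.

End construction.

Section probability_notions.
Context (R : realType) (dO : measure_display) (Omega : measurableType dO)
  (P : probability Omega R).

Definition mutually_independent (I : eqType) (X : I -> Omega -> R) : Prop :=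
  forall (s : seq I) (B : I -> set R), uniq s ->
    (forall i, measurable (B i)) ->
    fine (P (\bigcap_(i in [set` s]) (X i @^-1` B i))) =
    \prod_(i <- s) fine (P (X i @^-1` B i)).

Definition uniform01 (X : Omega -> R) : Prop :=
  [/\ measurable_fun setT X, forall w, X w \in `]0, 1] &
      forall A : set R, measurable A ->
        P (X @^-1` A) = uniform_prob (@ltr01 R) A].

Definition independent_uniforms (U V : nat -> Omega -> R) : Prop :=
  [/\ forall k, uniform01 (U k), forall k, uniform01 (V k) &
      mutually_independent (fun k : nat + nat =>
        match k with inl k => U k | inr k => V k end)].

Section markov.
Context (dS : measure_display) (S : measurableType dS).

(* The raw filtration sigma(X_r : 0 <= r <= t), neither completed nor made
   right-continuous. *)
Definition natural_filtration (X : R -> Omega -> S) (t : R) :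
    set (set Omega) :=
  <<s \bigcup_(r in `[0, t]) preimage_set_system setT (X r) measurable >>.

Definition stopping_time (F : R -> set (set Omega)) (T : Omega -> \bar R) :
    Prop :=
  (forall w, (0 <= T w)%E) /\
  (forall t : R, 0 <= t -> F t [set w | (T w <= t%:E)%E]).

Definition stopped_sigma_algebra (F : R -> set (set Omega))
    (T : Omega -> \bar R) : set (set Omega) :=
  [set A | measurable A /\
     forall t : R, 0 <= t -> F t (A `&` [set w | (T w <= t%:E)%E])].

(* Y is a version of E[X | G]. *)
Definition conditional_expectation (G : set (set Omega)) (X Y : Omega -> R) :
    Prop :=
  [/\ P.-integrable setT (EFin \o X), P.-integrable setT (EFin \o Y),
      (forall B : set R, measurable B -> G (Y @^-1` B)) &
      forall A, G A ->
        (\int[P]_(w in A) (Y w)%:E = \int[P]_(w in A) (X w)%:E)%E].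

(* Z z is the process started at z; its semigroup is
   (P_t f)(z) = E[f (Z z t)]. *)
Definition semigroup (Z : S -> R -> Omega -> S) (t : R) (f : S -> R) (z : S) :
    R :=
  \int[P]_w f (Z z t w).

Record strong_markov (K : set S) (Z : S -> R -> Omega -> S) : Prop :=
    StrongMarkov {
  sm_state_space : measurable K ;
  sm_measurable : forall (z : S) (t : R), K z -> 0 <= t -> measurable_fun setT (Z z t) ;
  sm_valued : forall (z : S) (t : R) (w : Omega), K z -> 0 <= t -> K (Z z t w) ;
  sm_start : forall z, K z -> {ae P, forall w, Z z 0 w = z} ;
  sm_kernel : forall (t : R) (A : set S), 0 <= t -> measurable A ->
    measurable_fun K (fun z => P (Z z t @^-1` A)) ;
  sm_property : forall (z : S) (T : Omega -> \bar R) (t : R) (f : S -> R),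
    K z -> 0 <= t ->
    stopping_time (natural_filtration (Z z)) T ->
    measurable_fun K f -> (exists M : R, forall y, K y -> `|f y| <= M) ->
    conditional_expectation
      (stopped_sigma_algebra (natural_filtration (Z z)) T)
      (fun w => if T w is r%:E then f (Z z (r + t) w) else 0)
      (fun w => if T w is r%:E then semigroup Z t f (Z z r w) else 0)
}.

End markov.
End probability_notions.

(* Main.v *)
Require Import Defs.
From HB Require Import structures.
From mathcomp Require Import all_boot all_order all_algebra.
From mathcomp Require Import all_classical all_reals all_analysis.
From mathcomp Require Import measurable_realfun.
From mathcomp Require Import ring lra.

Set Implicit Arguments.
Unset Strict Implicit.
Unset Printing Implicit Defensive.

Import Order.TTheory GRing.Theory Num.Theory.
Import numFieldNormedType.Exports.

Local Open Scope classical_set_scope.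
Local Open Scope ring_scope.

(** The path from z is a deterministic measurable function of the time t and of
    one driving sequence of uniform pairs (u, v). Two facts carry the proof.

    The first is a pathwise restart, [trajectory_markov]. Let s lie between the
    k-th jump and the next one, let zeta be the state just after the k-th jump
    and r the time elapsed since. Waiting longer than r from zeta amounts to
    u < g, where u is the waiting variable in force and g is the survival
    probability of zeta at r; and dividing u by g gives the wait that remains from
    the current state. So the future after s is a path started from the current
    state, driven by the sequence without its first k pairs and with u replaced
    by u / g. The law of this sequence is known: the pairs after the k-th are
    independent of the first k and distributed as the whole sequence
    ([splice_law]), and u / g is uniform given u < g ([stretch_law]).

    The second concerns stopping times of the raw filtration. Before the
    (k+1)-st jump the path has revealed only the first k pairs. Hence a stopping
    time T agrees, on the event T < T_(k+1), with a function sigma of these pairs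
    ([stopping_time_local]). When they are held fixed, sigma is a constant, and
    on the event that T falls between the k-th jump and the next the strong Markov
    identity becomes a computation at a fixed time ([markov_piece]): both sides
    equal g times the expectation started from the current state. Summing over k
    exhausts the event that T is finite up to a null set, because jump times tend
    to infinity almost surely: a wait that starts at age zero with u < 1/2 lasts at
    least a fixed delta > 0, and u < 1/2 happens infinitely often. An event A of
    the stopped sigma-algebra is absorbed by replacing T with +oo outside A.

    The rest is measurability. The state at T is known at time T because paths are
    right-continuous ([stopped_state_adapted]). Waiting times depend on the past
    of the flow, through the hazard accumulated since the last jump. The forward
    flow is continuous by Gronwall's inequality. For the backward flow, the set of
    pairs (s, x) such that x can be followed back during s, like the preimage of a
    closed set by this motion, is the image of a closed set under the continuous
    map (s, y) |-> (s, flow s y), hence a countable union of compact sets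
    ([backward_image_measurable]).

    These arguments are carried out for abstract dynamics satisfying
    [renewal_dynamics], which [switching_dynamics] establishes for the switching
    system. *)

(** * Preliminaries on measures *)

(** The measure structure depends on the measurability of f, a proof that
    inference cannot find, so it is chosen by name. *)
Definition image_measure d1 d2 (T1 : measurableType d1) (T2 : measurableType d2)
    (R : realType) (m : {measure set T1 -> \bar R}) (f : T1 -> T2)
    (mf : measurable_fun setT f) : {measure set T2 -> \bar R} :=
  measure_function_pushforward__canonical__measure_function_Measure m mf.

Lemma expectation_cst (dO : measure_display) (Omega : measurableType dO)
    (R : realType) (P : probability Omega R) (c : \bar R) :
  (\int[P]__ c = c)%E.
Proof.
have -> : (\int[P]__ c = c * P setT)%E by exact: integral_cst.
by rewrite probability_setT mule1.
Qed.

(** * The space of driving sequences *)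

(** A driving sequence lists the waiting variables as inl k and the selection
    variables as inr k; the index type nat + nat is the one over which the
    joint independence of the two families is expressed. *)
Definition driving (R : realType) := (nat + nat -> R)%type.
Definition driving_coordinate_sets (R : realType) : set (set (driving R)) :=
  \bigcup_i preimage_set_system setT (fun e : driving R => e i) measurable.
HB.instance Definition _ (R : realType) := Pointed.on (driving R).
HB.instance Definition _ (R : realType) :=
  Measurable.copy (driving R) (g_sigma_algebraType (@driving_coordinate_sets R)).

Section driving.
Context (R : realType).
Local Notation E := (driving R).

Lemma measurable_driving_coordinate i : measurable_fun setT (fun e : E => e i).
Proof.
move=> _ B mB; apply: sub_sigma_algebra; exists i => //.
by exists B.
Qed.

Lemma measurable_to_driving dT (T : measurableType dT) (f : T -> E) :
  (forall i, measurable_fun setT (fun x => f x i)) -> measurable_fun setT f.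
Proof.
move=> mf; apply: (measurability (@driving_coordinate_sets R)) => //.
move=> _ [_ [i _ [B mB <-]] <-].
by rewrite setTI; have := mf i measurableT B mB; rewrite setTI.
Qed.

Definition idx (i : nat + nat) := match i with inl k => k | inr k => k end.

(** Cylinders are indexed by a length m, constraining exactly the first m
    pairs, so that cutting a sequence at a given pair stays a statement about
    products over an interval of integers. *)
Definition cylinder (m : nat) (B : nat + nat -> set R) : set E :=
  [set e | forall i, (idx i < m)%N -> B i (e i)].

Definition cylinders : set (set E) :=
  [set A | exists m B, (forall i, measurable (B i)) /\ A = cylinder m B].

Lemma cylinder_measurable m B : (forall i, measurable (B i)) ->
  measurable (cylinder m B).
Proof.
move=> mB.
have -> : cylinder m B = \bigcap_j
   ([set e : E | (j < m)%N -> B (inl j) (e (inl j))] `&`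
    [set e : E | (j < m)%N -> B (inr j) (e (inr j))]).
  apply/seteqP; split => e /=.
    by move=> H j _; split => jm; exact: H.
  by move=> H [j|j] /= jm; have [h1 h2] := H j I; auto.
apply: bigcap_measurable => // j _; apply: measurableI.
  case: (ltnP j m) => jm; last first.
    by rewrite (_ : [set _ | _] = setT)//; apply/seteqP; split.
  rewrite (_ : [set _ | _] = (fun e : E => e (inl j)) @^-1` B (inl j)).
    by rewrite -[X in measurable X]setTI; exact: measurable_driving_coordinate.
  by apply/seteqP; split => e /=; auto.
case: (ltnP j m) => jm; last first.
  by rewrite (_ : [set _ | _] = setT)//; apply/seteqP; split.
rewrite (_ : [set _ | _] = (fun e : E => e (inr j)) @^-1` B (inr j)).
  by rewrite -[X in measurable X]setTI; exact: measurable_driving_coordinate.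
by apply/seteqP; split => e /=; auto.
Qed.

Lemma cylinders_setI : setI_closed cylinders.
Proof.
move=> _ _ [m1 [B1 [mB1 ->]]] [m2 [B2 [mB2 ->]]].
exists (maxn m1 m2), (fun i => (if (idx i < m1)%N then B1 i else setT) `&`
   (if (idx i < m2)%N then B2 i else setT)); split.
  by move=> i; apply: measurableI; case: ifPn.
apply/seteqP; split => e /=.
  by move=> [H1 H2] i _; split; case: ifPn => // ?; [exact: H1|exact: H2].
move=> H; split => i im.
  by have := H i; rewrite leq_max im/= => /(_ isT) [].
by have := H i; rewrite leq_max im orbT => /(_ isT) [].
Qed.

Lemma cylinders_gen : measurable = <<s cylinders >> :> set (set E).
Proof.
apply/seteqP; split.
  apply: smallest_sub; first exact: smallest_sigma_algebra.
  move=> _ [i _ [B mB <-]]; rewrite setTI; apply: sub_sigma_algebra.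
  exists (idx i).+1, (fun j => if j == i then B else setT); split.
    by move=> j; case: ifP.
  apply/seteqP; split => e /=; last by move/(_ i); rewrite eqxx; exact.
  by move=> H j _; case: eqP => [->|].
apply: smallest_sub; first exact: sigma_algebra_measurable.
by move=> _ [m [B [mB ->]]]; exact: cylinder_measurable.
Qed.

(** Every law on driving sequences below is identified through this pi-system
    argument. *)
Lemma driving_measure_unique (m1 m2 : {measure set E -> \bar R}) :
  (forall m B, (forall i, measurable (B i)) ->
     m1 (cylinder m B) = m2 (cylinder m B)) ->
  (m1 setT < +oo)%E -> forall A, measurable A -> m1 A = m2 A.
Proof.
move=> m12 m1T A mA.
apply: (@measure_unique _ _ _ cylinders (fun=> setT)) => //.
- exact: cylinders_gen.
- exact: cylinders_setI.
- move=> _; exists 0%N, (fun=> setT); split => //.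
  by apply/seteqP; split.
- exact: bigcup_const.
- by move=> _ [m [B [mB ->]]]; exact: m12.
Qed.

End driving.

(** * Laws of the noise *)
Section uniform.
Context (R : realType).
Local Notation unif := (uniform_prob (@ltr01 R)).
Local Notation mu := (@lebesgue_measure R).

Lemma uniform_lebesgue (A : set R) : measurable A ->
  unif A = mu (A `&` `[0, 1]%classic).
Proof.
move=> mA; rewrite /uniform_prob integral_uniform_pdf.
rewrite (eq_integral (fun=> 1%E)) ?integral_cst ?mul1e//.
- exact: measurableI.
- by move=> x; rewrite inE/= in_itv/= /uniform_pdf => -[_ ->]; rewrite subr0 invr1.
Qed.

(** Given u < g, the ratio u / g is again uniform. Both sides are measures in B,
    so rays suffice, and there the identity is a computation of lengths. *)
Lemma uniform_scale (g : R) (B : set R) : 0 < g <= 1 -> measurable B ->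
  unif [set u | u < g /\ B (u / g)] = (g%:E * unif B)%E.
Proof.
move=> /andP[g0 g1] mB.
have mdiv : measurable_fun setT (fun u : R => u / g).
  exact: mulrr_measurable.
pose f (u : measurableTypeR R) : measurableTypeR R := u / g.
have mg : measurable (`]-oo, g[%classic : set R) by [].
pose m1 := image_measure (mrestr unif mg) (mdiv : measurable_fun setT f).
pose m2 : {measure set (measurableTypeR R) -> \bar R} := mscale (NngNum (ltW g0)) unif.
have -> : unif [set u | u < g /\ B (u / g)] = m1 B.
  rewrite /m1 /pushforward /= /mrestr; congr (uniform_prob _ _).
  by apply/seteqP; split => u /=; rewrite in_itv/= => -[].
rewrite -[RHS]/(m2 B).
apply: (@measure_unique _ R (measurableTypeR R) (@RGenCInfty.G R) (fun k => `[- k%:R, +oo[%classic)) => //.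
- exact: RGenCInfty.measurableE.
- move=> _ _ [x ->] [y ->]; exists (Num.max x y).
  by apply/seteqP; split => u /=; rewrite !in_itv/= !andbT ge_max => /andP//.
- by move=> k; exists (- k%:R).
- apply/seteqP; split => // u _; exists (Num.truncn `|u|).+1 => //=.
  rewrite in_itv/= andbT lerNl.
  by rewrite (le_trans (ler_norm _))// normrN ltW// truncnS_gt.
- move=> _ [x ->].
  have mx : measurable ((fun u : R => u / g) @^-1` `[x, +oo[%classic `&` `]-oo, g[%classic).
    by apply: measurableI => //; rewrite -[X in measurable X]setTI; exact: (mdiv measurableT).
  rewrite /m1 /m2 /pushforward/= /mrestr /mscale/=.
  rewrite [X in X = _](uniform_lebesgue mx) uniform_lebesgue//.
  have -> : `[x, +oo[%classic `&` `[0, 1]%classic = `[Num.max x 0, 1]%classic :> set R.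
    by apply/seteqP; split => u /=; rewrite !in_itv/= andbT ge_max;
       [move=> [-> /andP[-> ->]]|move=> /andP[/andP[-> ->] ->]].
  have -> : (fun u : R => u / g) @^-1` `[x, +oo[%classic `&` `]-oo, g[%classic `&` `[0, 1]%classic
     = `[g * Num.max x 0, g[%classic :> set R.
    apply/seteqP; split => u /=; rewrite !in_itv/= andbT.
      move=> [[xu ug] /andP[u0 u1]]; rewrite ug andbT.
      by rewrite mulrC -ler_pdivlMr// ge_max xu/= divr_ge0// ltW.
    move=> /andP[]; rewrite mulrC -ler_pdivlMr// ge_max => /andP[-> u0] ug.
    split=> //; rewrite (le_trans (ltW ug) g1) andbT.
    by move: u0; rewrite ler_pdivlMr// mul0r.
  rewrite !lebesgue_measure_itv/= !lte_fin.
  have -> : (g * Num.max x 0 < g) = (Num.max x 0 < 1) by rewrite -{2}[g]mulr1 ltr_pM2l.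
  by case: ifPn => _; rewrite ?mule0// -!EFinD -EFinM mulrBr mulr1.
- move=> k; rewrite /m1 /pushforward/= /mrestr.
  have mx : measurable ((fun u : R => u / g) @^-1` `[- k%:R, +oo[%classic `&` `]-oo, g[%classic).
    by apply: measurableI => //; rewrite -[X in measurable X]setTI; exact: (mdiv measurableT).
  exact: le_lt_trans (probability_le1 unif mx) (ltry 1%R).
Qed.
End uniform.
Section laws.
Context (R : realType) (dO : measure_display) (Omega : measurableType dO)
  (P : probability Omega R) (U V : nat -> Omega -> R).
Hypothesis HUV : independent_uniforms P U V.
Local Notation unif := (uniform_prob (@ltr01 R)).

Definition noise (w : Omega) : driving R :=
  fun i => match i with inl k => U k w | inr k => V k w end.

Lemma noise_uniform i : uniform01 P (fun w => noise w i).
Proof. by case: HUV => HU HV _; case: i => k; [exact: HU|exact: HV]. Qed.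

Lemma measurable_noise : measurable_fun setT noise.
Proof. by apply: measurable_to_driving => i; case: (noise_uniform i). Qed.

Lemma noise_cylinder m (B : nat + nat -> set R) : (forall i, measurable (B i)) ->
  P (noise @^-1` cylinder m B) =
  (\prod_(0 <= j < m) (fine (unif (B (inl j))) * fine (unif (B (inr j)))))%:E.
Proof.
move=> mB.
pose s := map (@inl nat nat) (iota 0 m) ++ map (@inr nat nat) (iota 0 m).
have us : uniq s.
  rewrite cat_uniq !map_inj_uniq ?iota_uniq//=; last by move=> ? ? [].
    by rewrite andbT; apply/hasPn => x /mapP[j _ ->]; apply/negP => /mapP[k _].
  by move=> ? ? [].
have -> : noise @^-1` cylinder m B =
    \bigcap_(i in [set` s]) (fun w => noise w i) @^-1` B i.
  apply/seteqP; split => w /= H i.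
    rewrite /= mem_cat => /orP[] /mapP[j]; rewrite mem_iota => /= jm ->; exact: H.
  move=> im; apply: H => /=; rewrite mem_cat; apply/orP.
  by case: i im => j /= jm; [left|right]; apply/mapP; exists j; rewrite // mem_iota.
have mN i : measurable_fun setT (fun w => noise w i) by case: (noise_uniform i).
have [_ _ HI] := HUV.
have -> : \bigcap_(i in [set` s]) (fun w => noise w i) @^-1` B i =
   \bigcap_(i in [set` s]) ((match i with inl k => U k | inr k => V k end) @^-1` B i).
  by apply: eq_bigcapr => -[].
rewrite -[LHS]fineK; last first.
  apply: fin_num_measure; apply: fin_bigcap_measurable => // i _.
  by rewrite -[X in measurable X]setTI; case: i => k; [exact: (mN (inl k))|exact: (mN (inr k))].
rewrite HI//; congr EFin.
have Hf i : fine (P ((match i with inl k => U k | inr k => V k end) @^-1` B i)) = fine (unif (B i)).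
  by congr fine; case: (noise_uniform i) => _ _ /(_ _ (mB i)) <-; case: i.
under eq_bigr do rewrite Hf.
rewrite big_cat/= !big_map/= -big_split/=.
by rewrite /index_iota subn0.
Qed.

(** The second sequence is read from its beginning, so that it plays the part
    of a fresh driving sequence for the path after the k-th jump. *)
Definition splice (k : nat) (p : driving R * driving R) : driving R := fun i =>
  if (idx i < k)%N then p.1 i else
  match i with inl j => p.2 (inl (j - k)%N) | inr j => p.2 (inr (j - k)%N) end.

Lemma measurable_splice k : measurable_fun setT (splice k).
Proof.
apply: measurable_to_driving => i; rewrite /splice; case: (idx i < k)%N.
  exact: (measurableT_comp (@measurable_driving_coordinate R i)).
case: i => j; first exact: (measurableT_comp (@measurable_driving_coordinate R (inl (j - k)%N))).
exact: (measurableT_comp (@measurable_driving_coordinate R (inr (j - k)%N))).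
Qed.

Definition noise_pair (p : Omega * Omega) := (noise p.1, noise p.2).

Lemma measurable_noise_pair : measurable_fun setT noise_pair.
Proof.
by apply: measurable_fun_pair; exact: (measurableT_comp measurable_noise).
Qed.

Definition noise_law := image_measure P measurable_noise.

Lemma splice_cylinder k m (B : nat + nat -> set R) : (forall i, measurable (B i)) ->
  (P \x P)%E ((splice k \o noise_pair) @^-1` cylinder (k + m) B)
  = P (noise @^-1` cylinder (k + m) B).
Proof.
move=> mB.
pose B2 (i : nat + nat) := match i with inl j => B (inl (k + j)%N) | inr j => B (inr (k + j)%N) end.
have mB2 i : measurable (B2 i) by case: i => j; exact: mB.
have -> : (splice k \o noise_pair) @^-1` cylinder (k + m) B =
   (noise @^-1` cylinder k B) `*` (noise @^-1` cylinder m B2).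
  apply/seteqP; split => -[w1 w2] /=; rewrite /splice/=.
    move=> H; split => i im /=.
      by have := H i (ltn_addr _ im); rewrite im.
    case: i im => j /= jm.
      by have := H (inl (k + j)%N); rewrite /= ltn_add2l [(k + j < k)%N]ltnNge leq_addr/= addKn; exact.
    by have := H (inr (k + j)%N); rewrite /= ltn_add2l [(k + j < k)%N]ltnNge leq_addr/= addKn; exact.
  move=> [H1 H2] i im; case: ifPn => ik; first exact: H1.
  rewrite -leqNgt in ik.
  case: i ik im => j /= kj jm.
    by have := H2 (inl (j - k)%N); rewrite /= subnKC// ltn_subLR//; exact.
  by have := H2 (inr (j - k)%N); rewrite /= subnKC// ltn_subLR//; exact.
rewrite product_measure1E; last 2 first.
- rewrite -[X in measurable X]setTI; apply: measurable_noise => //; exact: cylinder_measurable.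
- rewrite -[X in measurable X]setTI; apply: measurable_noise => //; exact: cylinder_measurable.
rewrite [LHS]/= !noise_cylinder// -EFinM; congr EFin.
rewrite [RHS](@big_cat_nat _ _ _ k)//= ?leq_addr//; congr (_ * _).
rewrite -[X in _ = \big[_/_]_(X <= _ < _) _]add0n big_addn addKn.
by apply: eq_bigr => j _; rewrite /B2 addnC.
Qed.

Lemma cylinder_widen m k (B : nat + nat -> set R) :
  cylinder m B = cylinder (k + m) (fun i => if (idx i < m)%N then B i else setT).
Proof.
apply/seteqP; split => e H i im; first by case: ifPn => //; exact: H.
by have := H i (ltn_addl _ im); rewrite im.
Qed.

(** The first k pairs are independent of the following ones, which are
    distributed as the whole sequence. Writing this with an independent copy of
    the noise turns conditioning on the first k pairs into an iterated
    integral. *)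
Lemma splice_law k (f : driving R -> \bar R) : measurable_fun setT f ->
  (forall e, 0 <= f e)%E ->
  (\int[P]_w f (noise w) =
   \int[P]_w \int[P]_w' f (splice k (noise w, noise w')))%E.
Proof.
move=> mf f0.
have mS : measurable_fun setT (splice k \o noise_pair).
  by apply: measurableT_comp; [exact: measurable_splice|exact: measurable_noise_pair].
pose m2 := image_measure (P \x P)%E mS.
have m12 A : measurable A -> noise_law A = m2 A.
  apply: driving_measure_unique => [m B mB|].
    rewrite (cylinder_widen _ k) /m2 /noise_law /= /pushforward.
    by rewrite splice_cylinder// => i; case: ifP.
  by rewrite /noise_law/= /pushforward/= preimage_setT probability_setT ltry.
transitivity (\int[noise_law]_e f e)%E.
  by rewrite [RHS]ge0_integral_pushforward//; exact: measurable_noise.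
rewrite (eq_measure_integral m2); last by move=> A mA _; exact: m12.
rewrite ge0_integral_pushforward//= fubini_tonelli1//=.
by apply: measurableT_comp.
Qed.

Definition stretch (g : R) (e : driving R) : driving R :=
  fun i => if i is inl 0%N then e (inl 0%N) / g else e i.

Lemma measurable_stretch g : measurable_fun setT (stretch g).
Proof.
apply: measurable_to_driving => -[[|j]|j]; rewrite /stretch; try exact: measurable_driving_coordinate.
by apply: measurable_funM => //; exact: measurable_driving_coordinate.
Qed.

(** Conditionally on a first waiting variable below g, the rescaled noise has
    the law of the noise: this is [uniform_scale] in the first coordinate,
    independence in the others. *)
Lemma stretch_law (g : R) (f : driving R -> \bar R) : 0 < g <= 1 ->
  measurable_fun setT f -> (forall e, 0 <= f e)%E ->
  (\int[P]_(w in [set w | (U 0%N w < g)%R]) f (stretch g (noise w)) =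
   g%:E * \int[P]_w f (noise w))%E.
Proof.
move=> g01 mf f0; have /andP[g0 g1] := g01.
pose D := [set w | U 0%N w < g].
have mU : measurable_fun setT (U 0%N) by case: (noise_uniform (inl 0%N)).
have mD : measurable D.
  rewrite (_ : D = U 0%N @^-1` `]-oo, g[%classic); last first.
    by apply/seteqP; split => w; rewrite /D /= in_itv.
  by rewrite -[X in measurable X]setTI; exact: mU.
have mS : measurable_fun setT (stretch g \o noise).
  by apply: measurableT_comp; [exact: measurable_stretch|exact: measurable_noise].
pose m1 := image_measure (mrestr P mD) mS.
pose m2 : {measure set _ -> \bar R} := mscale (NngNum (ltW g0)) noise_law.
have m12 A : measurable A -> m1 A = m2 A.
  apply: driving_measure_unique => [m B mB|]; last first.
    rewrite /m1 /= /pushforward preimage_setT /mrestr/= setTI.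
    exact: le_lt_trans (probability_le1 P mD) (ltry 1%R).
  rewrite (cylinder_widen _ 1%N) add1n.
  set B' := fun i => _.
  have mB' i : measurable (B' i) by rewrite /B'; case: ifP.
  rewrite /m1 /m2/= /mscale/= /pushforward /mrestr.
  pose B2 (i : nat + nat) := if i is inl 0%N then [set u | u < g /\ B' (inl 0%N) (u / g)] else B' i.
  have mB2 i : measurable (B2 i).
    case: i => [[|j]|j]; rewrite /B2//.
    rewrite (_ : [set _ | _] = `]-oo, g[%classic `&` (fun u : R => u / g) @^-1` B' (inl 0%N)).
      apply: measurableI => //; rewrite -[X in measurable X]setTI.
      exact: (@mulrr_measurable R setT g^-1).
    by apply/seteqP; split => u; rewrite /= in_itv.
  have -> : (stretch g \o noise) @^-1` cylinder m.+1 B' `&` D = noise @^-1` cylinder m.+1 B2.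
    apply/seteqP; split => w /=.
      move=> [H wD] -[[|j]|j] jm; rewrite /B2/=.
      - by split => //; have := H (inl 0%N) jm.
      - exact: (H (inl j.+1) jm).
      - exact: (H (inr j) jm).
    move=> H; split; last by case: (H (inl 0%N) isT).
    move=> -[[|j]|j] jm; rewrite /stretch/=.
    - by have [] := H (inl 0%N) jm.
    - exact: (H (inl j.+1) jm).
    - exact: (H (inr j) jm).
  rewrite !noise_cylinder// -EFinM; congr EFin.
  rewrite !big_nat_recl//= !mulrA.
  have fB : unif (B' (inl 0%N)) \is a fin_num by apply: (@fin_num_measure _ _ _ unif); exact: mB'.
  by rewrite uniform_scale// fineM.
transitivity (\int[m1]_e f e)%E.
  rewrite [RHS]ge0_integral_pushforward//= preimage_setT.
  have mfS : measurable_fun setT (fun w => f (stretch g (noise w))).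
    exact: (measurableT_comp mf).
  rewrite [RHS](@ge0_negligible_integral _ _ _ _ _ (~` D))//=; first last.
  - by rewrite /mrestr setICl measure0.
  - exact: measurableC.
  rewrite setTD setCK; apply: eq_measure_integral => A mA AD.
  by rewrite /= /mrestr setIidl.
rewrite (eq_measure_integral m2); last by move=> A mA _; exact: m12.
rewrite ge0_integral_mscale// ge0_integral_pushforward//; exact: measurable_noise.
Qed.

(** Drives the absence of explosion. The event that no variable from the m-th on
    is below 1/2 has probability at most (1/2)^l for every l. *)
Lemma infinitely_many_small :
  {ae P, forall w, forall m, exists2 k, (m <= k)%N & U k w < 2^-1}.
Proof.
pose N m := [set w | forall k, (m <= k)%N -> 2^-1 <= U k w].
pose B m (i : nat + nat) : set R := if i is inl k then
   (if (m <= k)%N then `[2^-1, +oo[%classic else setT) else setT.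
have mB m i : measurable (B m i) by case: i => k; rewrite /B//; case: ifP.
have mC m l : measurable (noise @^-1` cylinder l (B m)).
  rewrite -[X in measurable X]setTI; apply: measurable_noise => //.
  exact: cylinder_measurable.
have Ncyl m : N m = \bigcap_l (noise @^-1` cylinder l (B m)).
  apply/seteqP; split => w /=.
    move=> H l _ -[k|k] //= _; case: ifPn => // mk; rewrite /= in_itv/= andbT; exact: H.
  by move=> H k mk; have := H k.+1 I (inl k) (ltnSn _); rewrite /B mk /= in_itv/= andbT.
have PC m l : (P (noise @^-1` cylinder (m + l) (B m)) = (2^-1 ^+ l)%:E)%E.
  rewrite noise_cylinder//; congr EFin.
  rewrite (@big_cat_nat _ _ _ m)//= ?leq_addr//.
  rewrite big_nat big1; last first.
    by move=> j /andP[_ jm]; rewrite /B leqNgt jm/= !probability_setT/= mulr1.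
  rewrite mul1r big_nat (eq_bigr (fun=> 2^-1)); last first.
    move=> j /andP[mj _]; rewrite /B mj probability_setT/= mulr1 uniform_lebesgue//.
    rewrite (_ : _ `&` _ = `[2^-1, 1]%classic :> set R); last first.
      apply/seteqP; split => u /=; rewrite !in_itv/= andbT.
        by move=> [-> /andP[_ ->]].
      by move=> /andP[h ->]; rewrite h andbT (le_trans _ h).
    by rewrite lebesgue_measure_itv/= lte_fin invf_lt1// ltr1n/=; lra.
  by rewrite -big_nat big_const_nat addKn iter_mulr mulr1.
have mN m : measurable (N m) by rewrite Ncyl; exact: bigcapT_measurable.
have PN m : P (N m) = 0%E.
  have fN : P (N m) \is a fin_num by exact: fin_num_measure.
  have le2 l : fine (P (N m)) <= 2^-1 ^+ l.
    rewrite -lee_fin fineK// -(PC m l); apply: le_measure; rewrite ?inE//.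
    by rewrite Ncyl; exact: bigcap_inf.
  apply/eqP; rewrite -fine_eq0// eq_le fine_ge0 ?measure_ge0// andbT leNgt.
  apply/negP => r0; set r := fine _ in le2 r0.
  (* 2 ^ l exceeds l, which exceeds 1 / r *)
  pose l := (Num.truncn r^-1).+1.
  have rl : r * l%:R <= 1.
    rewrite (le_trans _ (_ : r * 2 ^+ l <= 1))//.
      by rewrite ler_pM2l// -natrX ler_nat ltnW// ltn_expl.
    by rewrite -ler_pdivlMr// ?exprn_gt0// div1r -exprVn.
  have : r^-1 < l%:R by exact: truncnS_gt.
  by rewrite -[_^-1]mul1r ltr_pdivrMr// mulrC => /(le_lt_trans rl); rewrite ltxx.
exists (\bigcup_m N m); split.
- exact: bigcupT_measurable.
- apply/eqP; rewrite eq_le measure_ge0 andbT.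
  rewrite (le_trans (measure_sigma_subadditive _ _ _ (@subset_refl _ _)))//.
    exact: bigcupT_measurable.
  by rewrite eseries0// => m _ _; exact: PN.
- move=> w /= Hw; apply: contrapT => wN; apply: Hw => m.
  apply: contrapT => Hm; apply: wN; exists m => // k mk.
  by rewrite leNgt; apply/negP => Uk; apply: Hm; exists k.
Qed.
End laws.

(** * Trajectories driven by a sequence *)
Section paths.
Context (R : realType) (S : Type).
Variables (drift : S -> R -> S) (W : S -> R -> R) (J : S -> R -> R -> S).
Implicit Types (z : S) (e : driving R).

(** From a state z, the state flows along [drift] during a time W z u and then
    moves to J z u v, where (u, v) is the next pair of the driving sequence. *)
Fixpoint embedded_chain z e (k : nat) : S :=
  if k is j.+1 then J (embedded_chain z e j) (e (inl j)) (e (inr j)) else z.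

Fixpoint jump_epoch z e (k : nat) : R :=
  if k is j.+1 then jump_epoch z e j + W (embedded_chain z e j) (e (inl j)) else 0.

Definition running_index z e (t : R) : set nat :=
  [set k | jump_epoch z e k <= t < jump_epoch z e k.+1].

(** After an explosion the trajectory sits at its starting point. *)
Definition trajectory z e (t : R) : S :=
  if pselect (running_index z e t !=set0) is left _ then
    let k := xget 0%N (running_index z e t) in drift (embedded_chain z e k) (t - jump_epoch z e k)
  else z.

(** All jumps after the k-th one are suppressed, which makes the path a function
    of the first k pairs only; it is the true path up to the (k+1)-st jump. *)
Fixpoint frozen_trajectory (k : nat) z e (t : R) : S :=
  if k is j.+1 then
    if jump_epoch z e k <= t then drift (embedded_chain z e k) (t - jump_epoch z e k)
    else frozen_trajectory j z e t
  else drift z t.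

Definition agree (k : nat) e e' := forall i, (idx i < k)%N -> e i = e' i.

Definition drop_noise (k : nat) e : driving R := fun i =>
  match i with inl j => e (inl (k + j)%N) | inr j => e (inr (k + j)%N) end.

Lemma chain_agree k e e' z j : agree k e e' -> (j <= k)%N ->
  embedded_chain z e j = embedded_chain z e' j.
Proof.
move=> ee'; elim: j => // j IH jk /=.
by rewrite IH ?(ltnW jk)// !ee'.
Qed.

Lemma epoch_agree k e e' z j : agree k e e' -> (j <= k)%N ->
  jump_epoch z e j = jump_epoch z e' j.
Proof.
move=> ee'; elim: j => // j IH jk /=.
by rewrite IH ?(ltnW jk)// (chain_agree z ee' (ltnW jk)) ee'.
Qed.

Lemma frozen_trajectory_agree k e e' z t : agree k e e' ->
  frozen_trajectory k z e t = frozen_trajectory k z e' t.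
Proof.
move=> ee'.
have : (k <= k)%N by [].
elim: {-2}k => // j IH jk.
rewrite [LHS]/= [RHS]/= -!/(jump_epoch _ _ j.+1) -!/(embedded_chain _ _ j.+1).
by rewrite (epoch_agree z ee' jk) (chain_agree z ee' jk) (IH (ltnW jk)).
Qed.

Lemma chainD z e k m : embedded_chain z e (k + m) = embedded_chain (embedded_chain z e k) (drop_noise k e) m.
Proof. by elim: m => [|m IH]; rewrite ?addn0// addnS /= IH. Qed.

Lemma epochD z e k m :
  jump_epoch z e (k + m) = jump_epoch z e k + jump_epoch (embedded_chain z e k) (drop_noise k e) m.
Proof.
elim: m => [|m IH]; first by rewrite addn0 addr0.
by rewrite addnS /= IH chainD addrA.
Qed.

Lemma splice_agree k e e' : agree k (splice k (e, e')) e.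
Proof. by move=> i ik; rewrite /splice ik. Qed.

Lemma drop_noise_splice k e e' : drop_noise k (splice k (e, e')) = e'.
Proof.
apply/funext => -[j|j]; rewrite /drop_noise /splice /=;
by rewrite [(k + j < k)%N]ltnNge leq_addr/= addKn.
Qed.

Hypothesis W_ge0 : forall z u, 0 <= W z u.

Lemma epoch_homo z e : {homo jump_epoch z e : j k / (j <= k)%N >-> j <= k}.
Proof.
apply: homo_leq => //; first by move=> ? ? ?; exact: le_trans.
by move=> k /=; rewrite lerDl.
Qed.

Lemma epoch_ge0 z e k : 0 <= jump_epoch z e k.
Proof. exact: (epoch_homo z e (leq0n k)). Qed.

Lemma running_unique z e t j k : running_index z e t j -> running_index z e t k -> j = k.
Proof.
wlog jk : j k / (j <= k)%N.
  by move=> H Hj Hk; case: (leqP j k) => [|/ltnW] jk; [exact: H|rewrite (H k j)].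
move=> /andP[_ tj] /andP[kt _]; apply/eqP; rewrite eqn_leq jk leqNgt.
apply/negP => /(epoch_homo z e) h.
by have := lt_le_trans tj (le_trans h kt); rewrite ltxx.
Qed.

Lemma trajectory_running z e t k : running_index z e t k ->
  trajectory z e t = drift (embedded_chain z e k) (t - jump_epoch z e k).
Proof.
move=> Hk; rewrite /trajectory; case: pselect => [H|]; last by case; exists k.
by have := running_unique (xgetPex 0%N H) Hk => /= ->.
Qed.

Lemma trajectory_exploded z e t : ~ (running_index z e t !=set0) -> trajectory z e t = z.
Proof. by move=> H; rewrite /trajectory; case: pselect. Qed.

Lemma frozen_trajectoryE k z e t : 0 <= t < jump_epoch z e k.+1 ->
  trajectory z e t = frozen_trajectory k z e t.
Proof.
elim: k => [|k IH] /andP[t0 tk].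
  by rewrite (@trajectory_running _ _ _ 0%N) /running_index/= ?t0//= subr0.
rewrite [RHS]/= -/(jump_epoch z e k.+1) -/(embedded_chain z e k.+1).
case: ifPn => kt; first by rewrite (@trajectory_running _ _ _ k.+1)//= /running_index/= kt.
by apply: IH; rewrite t0/= ltNge.
Qed.

Lemma runningP z e t : 0 <= t ->
  (exists k, running_index z e t k) \/ (forall k, jump_epoch z e k <= t).
Proof.
move=> t0; case: (pselect (exists k, running_index z e t k)) => H; first by left.
right; elim=> [|k IH] //; rewrite leNgt; apply/negP => tk.
by apply: H; exists k; rewrite /running_index/= IH.
Qed.

(** Right-continuity holds at every time: between jumps it is that of the drift,
    and from an explosion on the trajectory is constant. It is stated through a
    real observable phi because the state space carries no topology here. *)
Lemma trajectory_right_cvg z e t (phi : S -> R) : 0 <= t ->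
  (forall k r, 0 <= r < W (embedded_chain z e k) (e (inl k)) ->
     phi (drift (embedded_chain z e k) s) @[s --> r^'+] --> phi (drift (embedded_chain z e k) r)) ->
  phi (trajectory z e s) @[s --> t^'+] --> phi (trajectory z e t).
Proof.
move=> t0 H; have [[k Hk]|Hexp] := runningP z e t0; last first.
  have Hz s : t <= s -> trajectory z e s = z.
    move=> ts; apply: trajectory_exploded => -[k /andP[_]].
    by rewrite ltNge => /negP; apply; exact: le_trans (Hexp _) ts.
  rewrite Hz//; apply: cvg_near_cst; near=> s.
  by congr phi; apply: Hz; near: s; exact: nbhs_right_ge.
rewrite (trajectory_running Hk); have /andP[kt tk] := Hk.
have r0 : 0 <= t - jump_epoch z e k < W (embedded_chain z e k) (e (inl k)).
  by rewrite subr_ge0 kt/= ltrBlDl.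
have /cvg_at_rightP HH := H k _ r0.
apply/(cvg_at_rightP (fun s => phi (trajectory z e s))) => u [ut ucvg].
have HH' := HH (fun n => u n - jump_epoch z e k).
have : (fun n => phi (drift (embedded_chain z e k) (u n - jump_epoch z e k))) @ \oo -->
       phi (drift (embedded_chain z e k) (t - jump_epoch z e k)).
  apply: HH'; split; first by move=> n; rewrite ltrD2r.
  by apply: cvgB => //; exact: cvg_cst.
apply: cvg_trans; apply: near_eq_cvg.
near=> n; rewrite (@trajectory_running _ _ _ k)//.
rewrite /running_index/= (le_trans kt (ltW (ut n)))/=.
near: n; exact: (cvgr_lt t ucvg _ tk).
Unshelve. all: by end_near. Qed.

End paths.

(** * Renewal dynamics *)
Definition unit_range (R : realType) (u : R) := 0 < u <= 1.

(** What the Markov argument uses of the switching system. G z t is the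
    probability that the waiting time from z exceeds t, and [rd_lt_W] says that
    W z is its generalised inverse. [rd_W_drift] and [rd_J_drift] express that a
    wait which has already lasted s continues as a fresh wait from the drifted
    state, driven by u / G z s. [rd_restart] bounds from below, with probability
    1/2, every wait that follows a jump. The maps are total and measurable on
    the whole type; their meaning is prescribed on K only. *)
Record renewal_dynamics (R : realType) (dS : measure_display)
    (S : measurableType dS) (K : set S) (drift : S -> R -> S) (G W : S -> R -> R)
    (J : S -> R -> R -> S) : Prop := RenewalDynamics {
  rd_mK : measurable K;
  rd_mdrift : measurable_fun setT (fun p : S * R => drift p.1 p.2);
  rd_mG : measurable_fun setT (fun p : S * R => G p.1 p.2);
  rd_mW : measurable_fun setT (fun p : S * R => W p.1 p.2);
  rd_mJ : measurable_fun setT (fun p : S * R * R => J p.1.1 p.1.2 p.2);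
  rd_W_ge0 : forall z u, 0 <= W z u;
  rd_G_le1 : forall z t, K z -> 0 <= t -> G z t <= 1;
  rd_G0 : forall z, K z -> G z 0 = 1;
  rd_lt_W : forall z u t, K z -> unit_range u -> 0 <= t ->
    (t < W z u) = (u < G z t);
  rd_drift_K : forall z t, K z -> 0 <= t -> 0 < G z t -> K (drift z t);
  rd_drift0 : forall z, K z -> drift z 0 = z;
  rd_driftD : forall z s t, K z -> 0 <= s -> 0 < G z s -> 0 <= t ->
    drift (drift z s) t = drift z (s + t);
  rd_J_K : forall z u v, K z -> unit_range u -> unit_range v -> K (J z u v);
  rd_W_drift : forall z s u, K z -> 0 <= s -> unit_range u -> u < G z s ->
    W (drift z s) (u / G z s) = W z u - s;
  rd_J_drift : forall z s u v, K z -> 0 <= s -> unit_range u -> unit_range v ->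
    u < G z s -> J (drift z s) (u / G z s) v = J z u v;
  rd_restart : exists2 delta : R, 0 < delta & forall z u v u', K z ->
    unit_range u -> unit_range v -> unit_range u' -> u' < 2^-1 ->
    delta <= W (J z u v) u'
}.

Section dynamics.
Context (R : realType) (dS : measure_display) (S : measurableType dS).
Variables (K : set S) (drift : S -> R -> S) (G W : S -> R -> R)
  (J : S -> R -> R -> S).
Hypothesis RD : renewal_dynamics K drift G W J.
Local Notation chain := (embedded_chain J).
Local Notation epoch := (jump_epoch W J).
Local Notation path := (trajectory drift W J).
Local Notation running := (running_index W J).
Implicit Types (z : S) (e : driving R).

Definition admissible e := forall i, unit_range (e i).
Definition recurrent e := forall m, exists2 k, (m <= k)%N & e (inl k) < 2^-1.

Lemma chain_in z e k : K z -> admissible e -> K (chain z e k).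
Proof.
by move=> Kz ae; elim: k => //= k IH; exact: (rd_J_K RD).
Qed.

(** By [rd_restart] the jump times grow by delta at each of the infinitely many
    small waiting variables. *)
Lemma epoch_unbounded z e (t : R) : K z -> admissible e -> recurrent e ->
  exists k, t < epoch z e k.
Proof.
move=> Kz ae re; have [delta d0 Hd] := rd_restart RD.
have H (n : nat) : exists k, n%:R * delta <= epoch z e k.
  elim: n => [|n [k IH]]; first by exists 0%N; rewrite mul0r.
  have [[//|j] kj uj] := re k.+1.
  exists j.+2; rewrite -[n.+1]addn1 natrD mulrDl mul1r [leRHS]/=.
  rewrite lerD ?Hd//; last exact: chain_in.
  apply: le_trans IH _; exact: (epoch_homo J (rd_W_ge0 RD) z e (ltnW kj)).
have [k Hk] := H (Num.truncn (t / delta)).+1.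
exists k; apply: lt_le_trans Hk.
by rewrite -ltr_pdivrMr// truncnS_gt.
Qed.

Lemma running_exists z e t : 0 <= t -> K z -> admissible e -> recurrent e ->
  exists k, running z e t k.
Proof.
move=> t0 Kz ae re; have [//|H] := runningP W J z e t0.
by have [k] := epoch_unbounded t Kz ae re; rewrite ltNge H.
Qed.

Lemma runningE z e t k : K z -> admissible e ->
  running z e t k <->
  epoch z e k <= t /\ e (inl k) < G (chain z e k) (t - epoch z e k).
Proof.
move=> Kz ae; rewrite /running_index/=; split => [/andP[kt]|[kt]].
  rewrite -ltrBlDl (rd_lt_W RD)// ?subr_ge0//; exact: chain_in.
rewrite -(rd_lt_W RD) ?subr_ge0//; last exact: chain_in.
by rewrite ltrBlDl kt.
Qed.

Lemma trajectory_in z e t : K z -> admissible e -> 0 <= t -> K (path z e t).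
Proof.
move=> Kz ae t0; case: (pselect (running z e t !=set0)) => [[k Hk]|H]; last first.
  by rewrite trajectory_exploded.
rewrite (trajectory_running drift (rd_W_ge0 RD) Hk).
have [kt uG] := (runningE t k Kz ae).1 Hk.
apply: (rd_drift_K RD); rewrite ?subr_ge0//; first exact: chain_in.
by apply: lt_trans uG; case/andP: (ae (inl k)).
Qed.

(** While the first wait has lasted a time r, the future of the trajectory from z
    is the trajectory from the drifted state with a rescaled first waiting
    variable: the chain is the same from its first jump on, and the jump times
    are shifted by r. *)
Section restart.
Variables (z : S) (e : driving R) (r : R).
Hypotheses (Kz : K z) (ae : admissible e) (r0 : 0 <= r)
  (ur : e (inl 0%N) < G z r).

Local Notation z' := (drift z r).
Local Notation e' := (stretch (G z r) e).

Lemma chain_restart k : chain z' e' k.+1 = chain z e k.+1.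
Proof.
elim: k => [|k IH]; first by rewrite /= (rd_J_drift RD).
by rewrite [LHS]/= [RHS]/= -/(chain z' e' k.+1) -/(chain z e k.+1) IH.
Qed.

Lemma epoch_restart k : epoch z' e' k.+1 = epoch z e k.+1 - r.
Proof.
elim: k => [|k IH]; first by rewrite /= !add0r (rd_W_drift RD).
rewrite [LHS]/= [RHS]/= -/(epoch z' e' k.+1) -/(epoch z e k.+1).
by rewrite -/(chain z' e' k.+1) -/(chain z e k.+1) IH chain_restart addrAC.
Qed.

Lemma trajectory_restart t : 0 <= t -> (exists k, running z e (r + t) k) ->
  path z e (r + t) = path z' e' t.
Proof.
move=> t0 [[|k] Hk].
  rewrite (trajectory_running drift (rd_W_ge0 RD) Hk)/= subr0.
  have Hk' : running z' e' t 0%N.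
    by move: Hk; rewrite /running_index/= t0/= -/(epoch z' e' 1) epoch_restart => /andP[_]/=; rewrite ltrBrDl.
  rewrite (trajectory_running drift (rd_W_ge0 RD) Hk')/= subr0 (rd_driftD RD)//.
  by apply: lt_trans ur; case/andP: (ae (inl 0%N)).
rewrite (trajectory_running drift (rd_W_ge0 RD) Hk).
have Hk' : running z' e' t k.+1.
  by move: Hk; rewrite /running_index/mkset !epoch_restart lerBlDl ltrBrDl.
rewrite (trajectory_running drift (rd_W_ge0 RD) Hk') chain_restart epoch_restart.
by congr drift; rewrite opprB addrCA addrA.
Qed.

End restart.

Lemma admissible_drop_noise e k : admissible e -> admissible (drop_noise k e).
Proof. by move=> ae [j|j]; exact: ae. Qed.

(** The pathwise form of the Markov property at a time s lying between the k-th
    jump and the next. *)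
Lemma trajectory_markov z e s t k : K z -> admissible e -> recurrent e -> 0 <= t ->
  running z e s k ->
  path z e (s + t) =
  path (drift (chain z e k) (s - epoch z e k))
    (stretch (G (chain z e k) (s - epoch z e k)) (drop_noise k e)) t.
Proof.
move=> Kz ae re t0 Hk.
have [ks uG] := (runningE s k Kz ae).1 Hk.
have Kk : K (chain z e k) by exact: chain_in.
have s0 : 0 <= s by apply: le_trans ks; exact: epoch_ge0 (rd_W_ge0 RD) _ _ _.
have [n Hn] := running_exists (addr_ge0 s0 t0) Kz ae re.
have kn : (k <= n)%N.
  rewrite leqNgt; apply/negP => nk.
  have /andP[_] := Hn; apply/negP; rewrite -leNgt.
  apply: le_trans (epoch_homo J (rd_W_ge0 RD) z e nk) _.
  by rewrite (le_trans ks)// lerDl.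
move: Hn; rewrite -(subnKC kn); set m := (n - k)%N => Hn.
have Hm : running (chain z e k) (drop_noise k e) (s - epoch z e k + t) m.
  move: Hn; rewrite /running_index/mkset -addnS !epochD.
  by rewrite -lerBrDl -ltrBlDl addrAC.
rewrite -trajectory_restart// ?subr_ge0//; last 3 first.
- exact: admissible_drop_noise.
- by rewrite /drop_noise addn0.
- by exists m.
rewrite (trajectory_running drift (rd_W_ge0 RD) Hn) (trajectory_running drift (rd_W_ge0 RD) Hm).
by rewrite chainD epochD; congr drift; rewrite opprD addrA (addrAC s t).
Qed.

Lemma measurable_chain k :
  measurable_fun setT (fun p : S * driving R => chain p.1 p.2 k).
Proof.
elim: k => [|k IH] /=; first exact: measurable_fst.
apply: (measurableT_comp (rd_mJ RD)
  (g := fun p : S * driving R => (chain p.1 p.2 k, p.2 (inl k), p.2 (inr k)))).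
by apply: measurable_fun_pair; [apply: measurable_fun_pair => //|];
  exact: (measurableT_comp (@measurable_driving_coordinate R _)).
Qed.

Lemma measurable_epoch k :
  measurable_fun setT (fun p : S * driving R => epoch p.1 p.2 k).
Proof.
elim: k => [|k IH] /=; first exact: measurable_cst.
apply: measurable_funD => //.
apply: (measurableT_comp (rd_mW RD)
  (g := fun p : S * driving R => (chain p.1 p.2 k, p.2 (inl k)))).
apply: measurable_fun_pair; first exact: measurable_chain.
exact: (measurableT_comp (@measurable_driving_coordinate R _)).
Qed.

Lemma measurable_piece k : measurable_fun setT (fun p : S * driving R * R =>
  drift (chain p.1.1 p.1.2 k) (p.2 - epoch p.1.1 p.1.2 k)).
Proof.
apply: (measurableT_comp (rd_mdrift RD) (g := fun p : S * driving R * R =>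
  (chain p.1.1 p.1.2 k, p.2 - epoch p.1.1 p.1.2 k))).
apply: measurable_fun_pair; first exact: (measurableT_comp (measurable_chain k)).
by apply: measurable_funB => //; exact: (measurableT_comp (measurable_epoch k)).
Qed.

Lemma measurable_frozen_trajectory k : measurable_fun setT
  (fun p : S * driving R * R => frozen_trajectory drift W J k p.1.1 p.1.2 p.2).
Proof.
elim: k => [|k IH].
  by have := measurable_piece 0; under eq_fun do rewrite /= subr0.
apply: measurable_fun_ifT => //; last exact: (measurable_piece k.+1).
by apply: measurable_fun_ler => //; exact: (measurableT_comp (measurable_epoch k.+1)).
Qed.

Lemma measurable_trajectory :
  measurable_fun setT (fun p : S * driving R * R => path p.1.1 p.1.2 p.2).
Proof.
pose D k := [set p : S * driving R * R | running p.1.1 p.1.2 p.2 k].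
have mD k : measurable (D k).
  have mb : measurable_fun setT (fun p : S * driving R * R =>
      (epoch p.1.1 p.1.2 k <= p.2) && (p.2 < epoch p.1.1 p.1.2 k.+1)).
    apply: measurable_and.
      by apply: measurable_fun_ler => //; exact: (measurableT_comp (measurable_epoch k)).
    by apply: measurable_fun_ltr => //; exact: (measurableT_comp (measurable_epoch k.+1)).
  by have := mb measurableT [set true] I; rewrite setTI.
rewrite -(setUv (\bigcup_k D k)).
apply/measurable_funU; [exact: bigcupT_measurable|apply: measurableC; exact: bigcupT_measurable|split].
  apply/measurable_fun_bigcup => // k.
  apply: (@eq_measurable_fun _ _ _ _ (D k) (fun p => drift (chain p.1.1 p.1.2 k) (p.2 - epoch p.1.1 p.1.2 k))).
    by move=> p /set_mem Dp; rewrite (trajectory_running drift (rd_W_ge0 RD) Dp).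
  exact: measurable_funTS (measurable_piece k).
apply: (@eq_measurable_fun _ _ _ _ _ (fun p => p.1.1)).
  move=> p /set_mem Dp; rewrite trajectory_exploded// => -[k Hk].
  by apply: Dp; exists k.
by apply: measurable_funTS; exact: measurableT_comp.
Qed.

End dynamics.

(** * Stopping times and the strong Markov identity *)
Section process.
Context (R : realType) (dS : measure_display) (S : measurableType dS).
Variables (K : set S) (drift : S -> R -> S) (G W : S -> R -> R)
  (J : S -> R -> R -> S).
Hypothesis RD : renewal_dynamics K drift G W J.
Context (dO : measure_display) (Omega : measurableType dO)
  (P : probability Omega R) (U V : nat -> Omega -> R).
Hypothesis HUV : independent_uniforms P U V.
Local Notation chain := (embedded_chain J).
Local Notation epoch := (jump_epoch W J).
Local Notation path := (trajectory drift W J).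
Local Notation running := (running_index W J).
Local Notation frozen_path := (frozen_trajectory drift W J).
Local Notation noise := (noise U V).
Implicit Types (z : S) (e : driving R) (w : Omega).

Let W0 := rd_W_ge0 RD.

Definition trajectory_process z (t : R) w := path z (noise w) t.
Local Notation Z := trajectory_process.
Local Notation F z := (natural_filtration (Z z)).

Lemma admissible_noise w : admissible (noise w).
Proof.
move=> i; have [_ + _] := noise_uniform HUV i => /(_ w).
by rewrite in_itv.
Qed.

Lemma measurable_process_at z (s : Omega -> R) : measurable_fun setT s ->
  measurable_fun setT (fun w => Z z (s w) w).
Proof.
move=> ms.
apply: (measurableT_comp (measurable_trajectory RD) (g := fun w => (z, noise w, s w))).
apply: measurable_fun_pair => //; apply: measurable_fun_pair => //.
exact: measurable_noise HUV.
Qed.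

Lemma measurable_process z t : measurable_fun setT (Z z t).
Proof. exact: (measurable_process_at z (measurable_cst t)). Qed.

Lemma filtration_measurable z q A : F z q A -> measurable A.
Proof.
move: A; apply: smallest_sub; first exact: sigma_algebra_measurable.
by move=> _ [r _ [B mB <-]]; exact: measurable_process.
Qed.

Definition depends_on_first (k : nat) (A : set (driving R)) :=
  forall e e', agree k e e' -> A e -> A e'.

Lemma agree_sym k e e' : agree k e e' -> agree k e' e.
Proof. by move=> H i ik; rewrite H. Qed.

(** Before the (k+1)-st jump an observer of the path has seen only the first k
    pairs. The property is stable under the operations of a sigma-algebra, and
    for a generator X_r^-1(B) it holds because the path agrees with the frozen
    trajectory. *)
Lemma filtration_local z q k (A : set Omega) : F z q A ->
  exists A' : set (driving R), [/\ measurable A', depends_on_first k A' &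
    forall w, q < epoch z (noise w) k.+1 -> A w <-> A' (noise w)].
Proof.
move: A; apply: smallest_sub.
  split.
  - by exists set0; split => // e e' _ [].
  - move=> A [A' [mA' lA' AA']]; exists (~` A'); split.
    + exact: measurableC.
    + by move=> e e' ee' nA /(lA' _ _ (agree_sym ee')).
    + move=> w /AA'[H1 H2]; split => [[_ nA] /H2//|nA].
      by split => // /H1.
  - move=> A /choice[A' HA']; exists (\bigcup_n A' n); split.
    + by apply: bigcupT_measurable => n; have [] := HA' n.
    + by move=> e e' ee' [n _ An]; exists n => //; have [_ lA _] := HA' n; exact: lA An.
    + move=> w qw; split => -[n _ An]; exists n => //; have [_ _ H] := HA' n.
        exact/(H w qw).1.
      exact/(H w qw).2.
move=> _ [r /= rq [B mB <-]]; rewrite in_itv/= in rq.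
exists [set e | B (frozen_path k z e r)]; split.
- rewrite (_ : [set _ | _] = (fun e => frozen_path k z e r) @^-1` B)//.
  rewrite -[X in measurable X]setTI.
  have : measurable_fun setT (fun e => frozen_path k z e r).
    apply: (measurableT_comp (measurable_frozen_trajectory RD k) (g := fun e => (z, e, r))).
    by apply: measurable_fun_pair => //; exact: measurable_fun_pair.
  exact.
- by move=> e e' ee' /=; rewrite (frozen_trajectory_agree drift W J z r ee').
- move=> w qw; rewrite setTI /preimage/mkset /trajectory_process.
  have /andP[r0 rq'] := rq.
  by rewrite (@frozen_trajectoryE _ _ drift W J W0 k) // r0 (le_lt_trans rq' qw).
Qed.

(** Hence, before the (k+1)-st jump, a stopping time is a function sigma of the
    first k pairs: sigma is the infimum of the rationals q for which T <= q is
    decided positively by these pairs. The two events T < T_(k+1) and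
    sigma < T_(k+1) coincide and T = sigma there, so the event itself can be
    rewritten in terms of sigma. *)
Lemma stopping_time_local z T k : stopping_time (F z) T ->
  exists sigma : driving R -> \bar R, [/\ measurable_fun setT sigma,
    forall e e', agree k e e' -> sigma e = sigma e' &
    forall w, (T w < (epoch z (noise w) k.+1)%:E)%E \/
              (sigma (noise w) < (epoch z (noise w) k.+1)%:E)%E ->
      sigma (noise w) = T w].
Proof.
move=> [T0 HT].
have /choice[B HB] : forall q : rat, exists B : set (driving R),
    0 <= ratr q :> R -> [/\ measurable B, depends_on_first k B &
    forall w, ratr q < epoch z (noise w) k.+1 ->
      (T w <= (ratr q)%:E)%E <-> B (noise w)].
  move=> q; case: (leP 0 (ratr q : R)) => q0; last by exists set0.
  have [B [mB lB HB]] := filtration_local k (HT _ q0).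
  by exists B.
pose h (n : nat) e : \bar R := if unpickle n is Some q then
   (if (0 <= ratr q :> R) && (e \in B q) then (ratr q)%:E else +oo%E) else +oo%E.
have mh n : measurable_fun setT (h n).
  rewrite /h; case: (unpickle n) => [q|]; last exact: measurable_cst.
  case: (leP 0 (ratr q : R)) => q0 /=; last exact: measurable_cst.
  have [mB _ _] := HB q q0.
  apply: measurable_fun_ifT => //.
  apply: (measurable_fun_bool true); rewrite (_ : _ `&` _ = B q)//.
  by apply/seteqP; split => [e [_ /set_mem]//|e Be]; split => //; exact/mem_set.
have lh n e e' : agree k e e' -> h n e = h n e'.
  move=> ee'; rewrite /h; case: (unpickle n) => // q.
  case: (leP 0 (ratr q : R)) => q0 //=.
  have [_ lB _] := HB q q0; congr (if _ then _ else _).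
  by apply/idP/idP => /set_mem H; apply/mem_set; [exact: lB H|exact: (lB _ _ (agree_sym ee'))].
exists (fun e => einfs (h ^~ e) 0%N); split.
- exact: measurable_fun_einfs.
- move=> e e' ee'; congr (einfs _ _); apply/funext => n; exact: lh.
move=> w.
set tk := epoch z (noise w) k.+1; set s := einfs _ _.
have hq q : 0 <= ratr q :> R -> B q (noise w) -> (s <= (ratr q)%:E)%E.
  move=> q0 Bq; apply: ereal_inf_lbound; exists (pickle q) => //.
  by rewrite /h pickleK q0 mem_set.
have hs t : (s < t)%E -> exists2 q : rat, 0 <= ratr q :> R /\ B q (noise w) &
    ((ratr q)%:E < t)%E.
  move=> st; have [_ [n _ <-]] := ereal_inf_lt st.
  rewrite /h; case: (unpickle n) => [q|]; last by rewrite ltNge leey.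
  case: ifPn => [/andP[q0 /set_mem Bq]|_]; last by rewrite ltNge leey.
  by exists q.
have Ts : (T w < tk%:E)%E -> s = T w.
  move=> Ttk; apply/eqP; rewrite eq_le; apply/andP; split; last first.
    rewrite leNgt; apply/negP => sT.
    have [q [q0 Bq] qT] := hs _ sT.
    have qtk : ratr q < tk by rewrite -lte_fin (lt_trans qT).
    have [_ _ /(_ w qtk)[_ /(_ Bq)]] := HB q q0.
    by rewrite leNgt qT.
  apply/lee_addgt0Pr => eps eps0.
  have [r Tr] : exists r, T w = r%:E.
    by case: (T w) (T0 w) Ttk => // r _ _; exists r.
  rewrite Tr in Ttk *.
  rewrite lte_fin in Ttk.
  have rm : r < Num.min tk (r + eps) by rewrite lt_min Ttk ltrDl.
  have [q] := rat_in_itvoo rm; rewrite in_itv/= lt_min => /andP[rq /andP[qtk qr]].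
  have q0 : 0 <= ratr q :> R.
    by rewrite (le_trans _ (ltW rq))// -lee_fin -Tr.
  have [_ _ /(_ w qtk)[+ _]] := HB q q0.
  rewrite Tr lee_fin => /(_ (ltW rq)) /hq - /(_ q0) /le_trans; apply.
  by rewrite -EFinD lee_fin ltW.
case => [//|stk]; apply: Ts.
have [q [q0 Bq] qtk] := hs _ stk.
rewrite lte_fin in qtk.
have [_ _ /(_ w qtk)[_ /(_ Bq)]] := HB q q0.
by move=> /le_lt_trans; apply; rewrite lte_fin.
Qed.

Lemma stopping_time_measurable z T : stopping_time (F z) T ->
  measurable_fun setT T.
Proof.
move=> [T0 HT]; apply: (measurability (@ErealGenOInfty.G R)).
  exact: ErealGenOInfty.measurableE.
move=> _ [_ [r ->] <-]; rewrite setTI.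
case: (leP 0 r) => r0; last first.
  rewrite (_ : _ @^-1` _ = setT)//; apply/seteqP; split => // w _.
  by rewrite /= in_itv/= andbT (lt_le_trans _ (T0 w)).
rewrite (_ : _ @^-1` _ = ~` [set w | (T w <= r%:E)%E]).
  by apply: measurableC; exact: filtration_measurable (HT r r0).
by apply/seteqP; split => w; rewrite /= in_itv/= andbT ltNge; move/negP.
Qed.

Section markov_identity.
Variables (z : S) (t : R) (f : S -> R).
Hypotheses (Kz : K z) (t0 : 0 <= t) (mf : measurable_fun setT f)
  (f0 : forall x, 0 <= f x).

(** Extended real values let Tonelli apply with no integrability of f. *)
Definition expectation_after (x : S) : \bar R := (\int[P]_w (f (Z x t w))%:E)%E.
Local Notation Pf := expectation_after.

Lemma expectation_after_ge0 x : (0 <= Pf x)%E.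
Proof. by apply: integral_ge0 => w _; rewrite lee_fin. Qed.

Lemma measurable_expectation_after : measurable_fun setT Pf.
Proof.
apply: (measurable_fun_fubini_tonelli_F (m2 := P)
  (fun p : S * Omega => (f (Z p.1 t p.2))%:E)).
  apply/measurable_EFinP; apply: (measurableT_comp mf).
  apply: (measurableT_comp (measurable_trajectory RD)
    (g := fun p : S * Omega => (p.1, noise p.2, t))).
  apply: measurable_fun_pair => //; apply: measurable_fun_pair => //.
  exact: (measurableT_comp (measurable_noise HUV)).
by move=> p; rewrite lee_fin.
Qed.

Lemma measurable_trajectory_at (s : driving R -> R) : measurable_fun setT s ->
  measurable_fun setT (fun e => path z e (s e)).
Proof.
move=> ms; apply: (measurableT_comp (measurable_trajectory RD) (g := fun e => (z, e, s e))).
by apply: measurable_fun_pair => //; exact: measurable_fun_pair.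
Qed.

Section piece.
Variables (k : nat) (sigma : driving R -> \bar R).
Hypotheses (msigma : measurable_fun setT sigma)
  (lsigma : forall e e', agree k e e' -> sigma e = sigma e').

Let active (e : driving R) :=
  ((epoch z e k)%:E <= sigma e)%E && (sigma e < (epoch z e k.+1)%:E)%E.
Let after e := if active e then (f (path z e (fine (sigma e) + t)))%:E else 0%E.
Let here e := if active e then Pf (path z e (fine (sigma e))) else 0%E.

Let mactive : measurable_fun setT active.
Proof.
have me j : measurable_fun setT (fun e => (epoch z e j)%:E).
  apply/measurable_EFinP.
  apply: (measurableT_comp (measurable_epoch RD j) (g := fun e => (z, e))).
  exact: measurable_fun_pair.
apply: measurable_and.
  exact: measurable_fun_lee.
exact: measurable_fun_lte.
Qed.

Let mfine : measurable_fun setT (fun e => fine (sigma e)).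
Proof. exact: (measurableT_comp (fine_measurable measurableT)). Qed.

Lemma measurable_after : measurable_fun setT after.
Proof.
apply: measurable_fun_ifT => //; apply/measurable_EFinP.
apply: (measurableT_comp mf); apply: measurable_trajectory_at.
exact: measurable_funD.
Qed.

Lemma measurable_here : measurable_fun setT here.
Proof.
apply: measurable_fun_ifT => //.
apply: (measurableT_comp measurable_expectation_after).
exact: measurable_trajectory_at.
Qed.

Lemma after_ge0 e : (0 <= after e)%E.
Proof. by rewrite /after; case: ifP; rewrite ?lee_fin. Qed.

Lemma here_ge0 e : (0 <= here e)%E.
Proof. by rewrite /here; case: ifP => // _; exact: expectation_after_ge0. Qed.

(** The strong Markov identity on the event that sigma falls between the k-th
    jump and the next. By [splice_law] the first k pairs may be held fixed, hence
    also sigma = s, the state zeta reached at the k-th jump, and the time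
    r = s - T_k already waited. The event becomes u < g with g = G zeta r for the
    next waiting variable u. On both sides the inner integral is then g times the
    expectation started from the state drift zeta r: for the future after s by
    [trajectory_markov] and [stretch_law], for the expectation at s because
    the integrand is constant on an event of probability g. *)
Lemma markov_piece :
  (\int[P]_w after (noise w) = \int[P]_w here (noise w))%E.
Proof.
rewrite (splice_law HUV k measurable_after after_ge0).
rewrite (splice_law HUV k measurable_here here_ge0).
apply: eq_integral => w _; set e1 := noise w.
set zeta := chain z e1 k; set s1 := epoch z e1 k.
have chainE e' : chain z (splice k (e1, e')) k = zeta.
  exact: (chain_agree J z (@splice_agree R k e1 e') (leqnn k)).
have epochE e' : epoch z (splice k (e1, e')) k = s1.
  exact: (epoch_agree W J z (@splice_agree R k e1 e') (leqnn k)).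
have sigmaE e' : sigma (splice k (e1, e')) = sigma e1.
  by apply: lsigma; exact: splice_agree.
have ukE e' : splice k (e1, e') (inl k) = e' (inl 0%N).
  by rewrite /splice/= ltnn subnn.
have activeE e' : active (splice k (e1, e')) =
    (s1%:E <= sigma e1)%E && (sigma e1 < (s1 + W zeta (e' (inl 0%N)))%:E)%E.
  by rewrite /active [epoch _ _ k.+1]/= epochE sigmaE chainE ukE.
have Kzeta : K zeta by apply: (chain_in RD) => //; exact: admissible_noise.
have [[s [sE s1s]]|nos] : (exists s, sigma e1 = s%:E /\ s1 <= s) \/
    (forall e', active (splice k (e1, e')) = false).
  case: (leP s1%:E (sigma e1)) => h; last first.
    by right => e'; rewrite activeE leNgt h.
  case E : (sigma e1) h => [s| |] // h; first by left; exists s.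
  by right => e'; rewrite activeE E [in X in _ && X]ltNge !leey.
(* sigma is infinite or precedes the k-th jump: the integrands vanish *)
2: by rewrite !integral0_eq// => w' _; rewrite /after/here nos.
set r := s - s1; set g := G zeta r.
have r0 : 0 <= r by rewrite subr_ge0.
have activeE' w' : active (splice k (e1, noise w')) = (U 0%N w' < g).
  rewrite activeE sE !lee_fin lte_fin s1s/= -ltrBlDl (rd_lt_W RD)//.
  exact: admissible_noise w' (inl 0%N).
pose D := [set w' | U 0%N w' < g].
have memD w' : (w' \in D) = (U 0%N w' < g).
  by apply/idP/idP => [/set_mem//|?]; exact/mem_set.
have mD : measurable D.
  have mU : measurable_fun setT (U 0%N) by case: (noise_uniform HUV (inl 0%N)).
  rewrite (_ : D = U 0%N @^-1` `]-oo, g[%classic); last first.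
    by apply/seteqP; split => w'; rewrite /D /= in_itv.
  by rewrite -[X in measurable X]setTI; exact: mU.
have msplice : measurable_fun setT (fun w' => splice k (e1, noise w')).
  apply: (measurableT_comp (@measurable_splice R k) (g := fun w' => (e1, noise w'))).
  by apply: measurable_fun_pair => //; exact: measurable_noise HUV.
have -> : (\int[P]_w' here (splice k (e1, noise w')) =
           \int[P]_(w' in D) Pf (drift zeta r))%E.
  rewrite [RHS]integral_mkcond; apply: eq_integral => w' _.
  rewrite /here /patch activeE' memD; case: ifPn => // ug.
  rewrite sigmaE sE/= (trajectory_running drift W0 (k := k)) ?chainE ?epochE//.
  by have := activeE' w'; rewrite ug /active/= sigmaE sE !lee_fin lte_fin.
have -> : (\int[P]_w' after (splice k (e1, noise w')) =
           \int[P]_(w' in D) (f (path (drift zeta r) (stretch g (noise w')) t))%:E)%E.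
  transitivity (\int[P]_(w' in D) (f (path z (splice k (e1, noise w')) (s + t)))%:E)%E.
    rewrite [RHS]integral_mkcond; apply: eq_integral => w' _.
    by rewrite /after /patch activeE' memD sigmaE sE/=.
  apply: ae_eq_integral => //.
  - apply/measurable_EFinP; apply: measurable_funTS; apply: (measurableT_comp mf).
    apply: (measurableT_comp (measurable_trajectory RD) (g := fun w' => (z, splice k (e1, noise w'), s + t))).
    by apply: measurable_fun_pair => //; exact: measurable_fun_pair.
  - apply/measurable_EFinP; apply: measurable_funTS; apply: (measurableT_comp mf).
    apply: (measurableT_comp (measurable_trajectory RD) (g := fun w' => (drift zeta r, stretch g (noise w'), t))).
    apply: measurable_fun_pair => //; apply: measurable_fun_pair => //.
    apply: (measurableT_comp (@measurable_stretch R g)); exact: measurable_noise HUV.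
  - have [N [mN N0 HN]] := infinitely_many_small HUV.
    exists N; split => // w' /= Hw'; apply: HN => /= rec; apply: Hw' => Dw'.
    have arec : recurrent (splice k (e1, noise w')).
      move=> m; have [j mj uj] := rec m; exists (k + j)%N; first by rewrite (leq_trans mj)// leq_addl.
      by rewrite /splice /= ltnNge leq_addr/= addKn.
    have aadm : admissible (splice k (e1, noise w')).
      by move=> i; rewrite /splice; case: ifP => _; [exact: admissible_noise|case: i => j; exact: admissible_noise].
    have Hrun : running z (splice k (e1, noise w')) s k.
      by have := activeE' w'; rewrite (Dw' : U 0%N w' < g) /active/= sigmaE sE !lee_fin lte_fin.
    by rewrite (trajectory_markov RD Kz aadm arec t0 Hrun) chainE epochE drop_noise_splice.
case: (leP g 0) => g0.
  have -> : D = set0; last by rewrite !integral_set0.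
  apply/seteqP; split => // w'; rewrite /D/= => Uw'.
  have /andP[+ _] := admissible_noise w' (inl 0%N).
  by rewrite /= ltNge (le_trans (ltW Uw') g0).
have g1 : g <= 1 by exact: (rd_G_le1 RD).
have g01 : 0 < g <= 1 by rewrite g0.
rewrite (stretch_law HUV (f := fun e => (f (path (drift zeta r) e t))%:E) g01); first last.
- by move=> e; rewrite lee_fin.
- apply/measurable_EFinP; apply: (measurableT_comp mf).
  apply: (measurableT_comp (measurable_trajectory RD) (g := fun e => (drift zeta r, e, t))).
  by apply: measurable_fun_pair => //; exact: measurable_fun_pair.
rewrite (stretch_law HUV (f := fun=> Pf (drift zeta r)) g01)//; last first.
  by move=> _; exact: expectation_after_ge0.
by rewrite expectation_cst.
Qed.
End piece.

(** Up to a null set, a finite time falls between two consecutive jumps. *)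
Lemma finite_part_split T (h : Omega -> \bar R) : stopping_time (F z) T ->
  measurable_fun setT h -> (forall w, 0 <= h w)%E ->
  (\int[P]_(w in [set w | T w < +oo]) h w = \sum_(k <oo)
     \int[P]_(w in [set w | (epoch z (noise w) k)%:E <= T w <
        (epoch z (noise w) k.+1)%:E]) h w)%E.
Proof.
move=> sT mh h0; set D := [set w | (T w < +oo)%E]; pose Dk k := [set w | ((epoch z (noise w) k)%:E <= T w <
        (epoch z (noise w) k.+1)%:E)%E].
have mT := stopping_time_measurable sT.
have me k : measurable_fun setT (fun w => (epoch z (noise w) k)%:E).
  apply/measurable_EFinP.
  apply: (measurableT_comp (measurable_epoch RD k) (g := fun w => (z, noise w))).
  by apply: measurable_fun_pair => //; exact: measurable_noise HUV.
have mDk k : measurable (Dk k).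
  have mb : measurable_fun setT (fun w => ((epoch z (noise w) k)%:E <= T w)%E &&
        (T w < (epoch z (noise w) k.+1)%:E)%E).
    by apply: measurable_and; [exact: measurable_fun_lee|exact: measurable_fun_lte].
  by have := mb measurableT [set true] I; rewrite setTI.
have mD : measurable D.
  by have := emeasurable_fun_infty_o measurableT mT +oo%E; rewrite setTI.
have DkD : \bigcup_k Dk k `<=` D.
  by move=> w [k _] /andP[_ /lt_le_trans]; apply; rewrite leey.
have tDk : trivIset setT Dk.
  apply/trivIsetP => i j _ _ ij; apply/seteqP; split => // w [].
  case E : (T w) => [s| |]; rewrite /Dk /= E ?leey//.
  rewrite !lee_fin !lte_fin => Hi Hj; move/eqP: ij; apply.
  exact: (running_unique W0 Hi Hj).
have [N [mN N0 HN]] := infinitely_many_small HUV.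
have mU : measurable (\bigcup_k Dk k) by exact: bigcupT_measurable.
rewrite (@ge0_negligible_integral _ _ _ P D (D `\` \bigcup_k Dk k))//; last 3 first.
- exact: measurableD.
- exact: measurable_funTS.
- apply/eqP; rewrite eq_le measure_ge0 andbT -N0; apply: le_measure; rewrite ?inE//.
    exact: measurableD.
  move=> w [Dw nDw]; apply: HN => /= rec; apply: nDw.
  have [T0 _] := sT.
  case E : (T w) (T0 w) Dw => [s| |] //; rewrite /D/= E// lee_fin => s0 _.
  have [k Hk] := running_exists RD s0 Kz (admissible_noise w) rec.
  by exists k => //; rewrite /Dk/= E !lee_fin lte_fin.
rewrite setDD setIidr// ge0_integral_bigcup//.
exact: measurable_funTS.
Qed.

Lemma strong_markov_identity T : stopping_time (F z) T ->
  (\int[P]_(w in [set w | T w < +oo]) (f (Z z (fine (T w) + t) w))%:E =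
   \int[P]_(w in [set w | T w < +oo]) expectation_after (Z z (fine (T w)) w))%E.
Proof.
move=> sT; have mT := stopping_time_measurable sT.
have mfT : measurable_fun setT (fun w => fine (T w)).
  exact: (measurableT_comp (fine_measurable measurableT)).
rewrite !finite_part_split//; last 4 first.
- apply: (measurableT_comp measurable_expectation_after); exact: measurable_process_at.
- by move=> w; exact: expectation_after_ge0.
- by apply/measurable_EFinP; apply: (measurableT_comp mf); apply: measurable_process_at; exact: measurable_funD.
- by move=> w; rewrite lee_fin.
apply: eq_eseriesr => k _.
have [sigma [ms ls Hs]] := stopping_time_local k sT.
have act w : ((epoch z (noise w) k)%:E <= sigma (noise w))%E &&
     (sigma (noise w) < (epoch z (noise w) k.+1)%:E)%E =
   ((epoch z (noise w) k)%:E <= T w < (epoch z (noise w) k.+1)%:E)%E.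
  apply/idP/idP => /andP[h1 h2].
    by rewrite -(Hs w (or_intror h2)) h1.
  by rewrite (Hs w (or_introl h2)) h1.
have memD w : (w \in [set w | (epoch z (noise w) k)%:E <= T w <
    (epoch z (noise w) k.+1)%:E])%E =
    ((epoch z (noise w) k)%:E <= T w < (epoch z (noise w) k.+1)%:E)%E.
  by apply/idP/idP => [/set_mem//|?]; exact/mem_set.
have := markov_piece ms ls.
congr (_ = _); rewrite [RHS]integral_mkcond; apply: eq_integral => w _;
  rewrite /patch act memD; case: ifPn => // /andP[_ h2];
  by rewrite (Hs w (or_introl h2)).
Qed.
End markov_identity.
End process.

(** * The state at a stopping time *)
Section adapted.
Context (R : realType) (dS : measure_display) (S : measurableType dS).
Variables (K : set S) (drift : S -> R -> S) (G W : S -> R -> R)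
  (J : S -> R -> R -> S).
Hypothesis RD : renewal_dynamics K drift G W J.
Context (dO : measure_display) (Omega : measurableType dO)
  (P : probability Omega R) (U V : nat -> Omega -> R).
Hypothesis HUV : independent_uniforms P U V.
Context (I : Type) (gen : I -> S -> R).
Hypothesis gen_measurable : @measurable _ S =
  <<s \bigcup_i preimage_set_system setT (gen i) measurable >>.
Hypothesis gen_cvg : forall i z r, K z -> 0 <= r -> 0 < G z r ->
  gen i (drift z s) @[s --> r^'+] --> gen i (drift z r).
Local Notation noise := (noise U V).
Local Notation Z := (trajectory_process drift W J U V).
Local Notation F z := (natural_filtration (Z z)).

Lemma process_right_cvg i z t w : K z -> 0 <= t ->
  gen i (Z z s w) @[s --> t^'+] --> gen i (Z z t w).
Proof.
move=> Kz t0; apply: (trajectory_right_cvg (rd_W_ge0 RD)) => // k r /andP[r0 rW].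
have aw := admissible_noise HUV w.
have Kk : K (embedded_chain J z (noise w) k) by exact: (chain_in RD).
apply: gen_cvg => //.
have := rd_lt_W RD Kk (aw (inl k)) r0; rewrite rW => /esym.
by apply: lt_trans; case/andP: (aw (inl k)).
Qed.

Section fixed_time.
Variables (z : S) (q : R) (T : Omega -> \bar R).
Hypotheses (Kz : K z) (q0 : 0 <= q) (sT : stopping_time (F z) T).

(* The sample space with the sigma-algebra of the natural filtration at q. *)
Let OmegaF := g_sigma_algebraType
  (\bigcup_(r in `[0, q]%classic) preimage_set_system setT (Z z r) measurable).

Let stop_lt s : s <= q -> @measurable _ OmegaF [set w | (T w < s%:E)%E].
Proof.
move=> sq.
have -> : [set w | (T w < s%:E)%E] = \bigcup_n
    (if 0 <= s - n.+1%:R^-1 then [set w | (T w <= (s - n.+1%:R^-1)%:E)%E] else set0).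
  apply/seteqP; split => w /=; last first.
    move=> [n _]; case: ifP => //= _ /le_lt_trans; apply.
    by rewrite lte_fin gtrBl invr_gt0.
  have [T0 _] := sT.
  case E : (T w) (T0 w) => [t| |] //; rewrite lee_fin lte_fin => t0 ts.
  have st : 0 < s - t by rewrite subr_gt0.
  exists (Num.truncn (s - t)^-1) => //.
  have tn : t <= s - (Num.truncn (s - t)^-1).+1%:R^-1.
    rewrite lerBrDl -lerBrDr.
    rewrite -[leRHS]invrK lef_pV2 ?posrE ?invr_gt0//.
    by rewrite ltW// truncnS_gt.
  by rewrite (le_trans t0 tn)/= E lee_fin.
apply: bigcupT_measurable => n; case: ifPn => // h.
have [_ HT] := sT.
move: (HT _ h); rewrite /natural_filtration; apply: sub_sigma_algebra2.
move=> A [r rs [B mB <-]]; exists r; last by exists B.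
move: rs; rewrite /= !in_itv/= => /andP[-> rs].
by rewrite (le_trans rs)// (le_trans _ sq)// gerBl.
Qed.

Let Z_measurable r : 0 <= r <= q -> measurable_fun (setT : set OmegaF) (Z z r).
Proof.
move=> rq _ B mB; apply: sub_sigma_algebra; exists r; last by exists B.
by rewrite /= in_itv.
Qed.

Let D : set OmegaF := [set w | (T w < q%:E)%E].

(* The approximations of T from the right along the grid of mesh 1/(n+1), cut at
   q. On T < q they lie strictly above T, as right limits require. *)
Let a n (w : OmegaF) : R :=
  Num.min q ((Num.truncn (fine (T w) * n.+1%:R)).+1%:R / n.+1%:R).

Let measurable_approx i n : measurable_fun D (fun w => gen i (Z z (a n w) w)).
Proof.
pose b j : R := Num.min q (j%:R / n.+1%:R).
have bq j : b j <= q by rewrite /b ge_min lexx.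
have b0 j : 0 <= b j by rewrite /b le_min q0/= divr_ge0.
pose Dj j : set OmegaF := [set w | (T w < (b j.+1)%:E)%E] `\` [set w | (T w < (b j)%:E)%E].
have Dfin w : D w -> exists2 t, T w = t%:E & 0 <= t.
  have [T0 _] := sT; rewrite /D/=.
  by case E : (T w) (T0 w) => [t| |] //; rewrite lee_fin => t0 _; exists t.
have -> : D = \bigcup_j Dj j.
  apply/seteqP; split => w; last first.
    by move=> [j _ [/= Tb _]]; apply: (lt_le_trans Tb); rewrite lee_fin bq.
  move=> Dw; have [t Tt t0] := Dfin w Dw.
  move: Dw; rewrite /D/= Tt lte_fin => tq.
  exists (Num.truncn (t * n.+1%:R)) => //; split; rewrite /= Tt lte_fin /b.
    by rewrite lt_min tq/= ltr_pdivlMr// truncnS_gt.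
  rewrite lt_min tq/= ltr_pdivlMr//; apply/negP; rewrite -leNgt.
  by rewrite truncn_le// mulr_ge0.
have mDj j : measurable (Dj j) by apply: measurableD; exact: stop_lt.
apply/measurable_fun_bigcup => // j.
apply: (@eq_measurable_fun _ _ _ _ (Dj j) (fun w => gen i (Z z (b j.+1) w))).
  move=> w /set_mem [Tb nTb].
  have Dw : D w by apply: (lt_le_trans Tb); rewrite lee_fin bq.
  have [t Tt t0] := Dfin w Dw.
  congr (gen i (Z z _ w)); rewrite /a /b Tt/=; congr (Num.min q (_.+1%:R / _)).
  move: Tb nTb; rewrite /= Tt !lte_fin /b !lt_min.
  have -> /= : t < q by move: Dw; rewrite /D /= Tt lte_fin.
  rewrite !ltr_pdivlMr// => t1 /negP; rewrite -leNgt => t2.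
  by apply/eqP; rewrite eq_sym truncn_eq// ?mulr_ge0// t2.
apply: measurable_funTS.
apply: (measurableT_comp (T2 := S)); last by apply: Z_measurable; rewrite b0 bq.
move=> _ B mB; rewrite gen_measurable; apply: sub_sigma_algebra.
by exists i => //; exists B.
Qed.

(** On T < q the state at T is the limit of the states at the approximations of
    T, each of which is known at time q. *)
Lemma measurable_before : measurable_fun D (fun w : OmegaF => Z z (fine (T w)) w).
Proof.
apply: (measurability (\bigcup_i preimage_set_system setT (gen i) measurable)).
  exact: gen_measurable.
move=> _ [_ [i _ [B mB <-]] <-]; rewrite setTI.
suff : measurable_fun D (fun w : OmegaF => gen i (Z z (fine (T w)) w)).
  by move=> H; apply: H => //; exact: stop_lt.
apply: (@measurable_fun_cvg _ _ _ _ (fun n w => gen i (Z z (a n w) w))).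
- by move=> n; exact: measurable_approx.
move=> w Dw; have [T0 _] := sT.
case E : (T w) (T0 w) (Dw) => [t| |]; rewrite /D/= ?E// lee_fin lte_fin => t0 tq.
have /cvg_at_rightP := @process_right_cvg i z t w Kz t0; apply.
have ta n : t < a n w.
  by rewrite /a E/= lt_min tq/= ltr_pdivlMr// truncnS_gt.
split => //.
apply: (@squeeze_cvgr _ _ _ _ (fun=> t) (fun n => t + n.+1%:R^-1)).
- apply: nearW => n; rewrite ltW//= /a E/= ge_min; apply/orP; right.
  rewrite ler_pdivrMr// mulrDl mulVf// -natr1 lerD2r.
  by rewrite truncn_le// mulr_ge0.
- exact: cvg_cst.
- rewrite -[X in _ --> X]addr0; apply: cvgD; first exact: cvg_cst.
  exact: cvg_harmonic.
Qed.

(** The state at T is measurable for the stopped sigma-algebra. The event T = q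
    is treated apart: there is no room to approximate T from the right within
    [0, q]. *)
Lemma stopped_state_adapted (C : set S) : measurable C ->
  F z q ([set w | Z z (fine (T w)) w \in C] `&` [set w | (T w <= q%:E)%E]).
Proof.
move=> mC.
have mT : @measurable _ OmegaF [set w | (T w <= q%:E)%E] by have [_] := sT; apply.
have -> : [set w | Z z (fine (T w)) w \in C] `&` [set w | (T w <= q%:E)%E] =
   (D `&` (fun w => Z z (fine (T w)) w) @^-1` C) `|`
   (([set w | (T w <= q%:E)%E] `\` D) `&` Z z q @^-1` C).
  apply/seteqP; split => w /=; rewrite ?inE.
    move=> [CT]; rewrite le_eqVlt => /orP[/eqP Tq|Tq]; last by left.
    right; split; last by move: CT; rewrite Tq.
    split; first by rewrite Tq eqxx.
    by move=> /=; rewrite /D/= Tq ltxx.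
  move=> [[Dw CT]|[[Tq nD] CT]]; split => //; first exact: ltW.
  suff -> : T w = q%:E by [].
  by apply/eqP; rewrite eq_le Tq/= leNgt; exact/negP.
apply: (@measurableU _ OmegaF).
  by apply: measurable_before => //; exact: stop_lt.
apply: (@measurableI _ OmegaF); first by apply: measurableD => //; exact: stop_lt.
by rewrite -[X in measurable X]setTI; apply: Z_measurable; rewrite ?q0 ?lexx.
Qed.

End fixed_time.
End adapted.

(** * The strong Markov property of renewal dynamics *)

(** The semigroups at T are compared only at states visited by the process,
    which lie in K. *)
Lemma strong_markov_ext (R : realType) (dO : measure_display)
    (Omega : measurableType dO) (P : probability Omega R)
    (dS : measure_display) (S : measurableType dS) (K : set S)
    (Z Z' : S -> R -> Omega -> S) :
  (forall z, K z -> Z z = Z' z) -> strong_markov P K Z -> strong_markov P K Z'.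
Proof.
move=> ZZ' [mK mZ vZ sZ kZ pZ]; split => //.
- by move=> z t Kz t0; rewrite -ZZ'//; exact: mZ.
- by move=> z t w Kz t0; rewrite -ZZ'//; exact: vZ.
- by move=> z Kz; rewrite -ZZ'//; exact: sZ.
- move=> t A t0 mA.
  apply: (@eq_measurable_fun _ _ _ _ K (fun z => P (Z z t @^-1` A))); last exact: kZ.
  by move=> z /set_mem Kz; rewrite ZZ'.
- move=> z T t f Kz t0 sT mf fM; rewrite -ZZ'// in sT *.
  have [T0 _] := sT.
  have := pZ z T t f Kz t0 sT mf fM; congr (conditional_expectation _ _ _ _).
  apply/funext => w; case E : (T w) (T0 w) => [r| |] //; rewrite lee_fin => r0.
  by rewrite /semigroup ZZ'//; exact: vZ.
Qed.

Section abstract_strong_markov.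
Context (R : realType) (dS : measure_display) (S : measurableType dS).
Variables (K : set S) (drift : S -> R -> S) (G W : S -> R -> R)
  (J : S -> R -> R -> S).
Hypothesis RD : renewal_dynamics K drift G W J.
Context (dO : measure_display) (Omega : measurableType dO)
  (P : probability Omega R) (U V : nat -> Omega -> R).
Hypothesis HUV : independent_uniforms P U V.
Context (I : Type) (gen : I -> S -> R).
Hypothesis gen_measurable : @measurable _ S =
  <<s \bigcup_i preimage_set_system setT (gen i) measurable >>.
Hypothesis gen_cvg : forall i z r, K z -> 0 <= r -> 0 < G z r ->
  gen i (drift z s) @[s --> r^'+] --> gen i (drift z r).
Local Notation noise := (noise U V).
Local Notation Z := (trajectory_process drift W J U V).
Local Notation F z := (natural_filtration (Z z)).

Lemma process_start z : K z -> {ae P, forall w, Z z 0 w = z}.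
Proof.
move=> Kz; exists (U 0%N @^-1` [set 1]); split.
- rewrite -[X in measurable X]setTI.
  by case: (noise_uniform HUV (inl 0%N)) => mU _ _; exact: mU.
- case: (noise_uniform HUV (inl 0%N)) => _ _ /(_ [set 1]) -> //.
  rewrite uniform_lebesgue// (_ : _ `&` _ = [set 1])//.
    by rewrite lebesgue_measure_set1.
  by apply/seteqP; split => x /= => [[]//|->]; rewrite in_itv/= ler01 lexx.
- move=> w /= Hw; apply: contrapT => U1; apply: Hw.
  have aw := admissible_noise HUV w.
  rewrite /trajectory_process (@trajectory_running _ _ drift W J (rd_W_ge0 RD) _ _ _ 0%N)/= ?subrr ?subr0 ?(rd_drift0 RD)//.
  rewrite /running_index/= lexx add0r/=.
  have -> := rd_lt_W RD Kz (aw (inl 0%N)) (lexx 0).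
  rewrite (rd_G0 RD Kz) lt_neqAle; have /andP[_ ->] := aw (inl 0%N).
  by rewrite andbT; apply/eqP.
Qed.

Section bounded_function.
Variables (t M : R) (f : S -> R).
Hypotheses (t0 : 0 <= t) (mf : measurable_fun K f)
  (fM : forall y, K y -> `|f y| <= M).

Let M0 z : K z -> 0 <= M. Proof. by move=> /fM; exact: le_trans. Qed.

(* The identity is available for nonnegative observables, so f is raised by its
   bound M; it is set to 0 outside K, which the process never visits. *)
Let lifted : S -> R := (fun y => f y + M) \_ K.

Let lifted_ge0 y : 0 <= lifted y.
Proof.
rewrite /lifted patchE; case: ifPn => // /set_mem /fM.
by rewrite ler_norml => /andP[+ _]; lra.
Qed.

Let mlifted : measurable_fun setT lifted.
Proof.
apply/(measurable_restrictT _ (rd_mK RD)); apply: measurable_funD => //.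
Qed.

Let liftedE y : K y -> f y = lifted y - M.
Proof. by move=> Ky; rewrite /lifted patchE mem_set// addrK. Qed.

Local Notation Pf := (expectation_after drift W J P U V t lifted).

Let mZt x : measurable_fun setT (fun w => (lifted (Z x t w))%:E).
Proof.
by apply/measurable_EFinP; apply: (measurableT_comp mlifted); exact: (measurable_process RD HUV).
Qed.

Let Pf_bound x : K x -> (0 <= Pf x <= (M + M)%:E)%E.
Proof.
move=> Kx; rewrite expectation_after_ge0//=.
apply: (le_trans (y := (\int[P]_w (M + M)%:E)%E)).
  apply: ge0_le_integral => //.
  - by move=> w _; rewrite lee_fin.
  - move=> w _; rewrite lee_fin /lifted patchE mem_set; last first.
      by apply: (trajectory_in RD) => //; exact: admissible_noise HUV _.
    rewrite lerD2r (le_trans (ler_norm _))// fM//.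
    by apply: (trajectory_in RD) => //; exact: admissible_noise HUV _.
by rewrite expectation_cst.
Qed.

Let Pf_fin x : K x -> Pf x \is a fin_num.
Proof.
move=> /Pf_bound/andP[h1 h2]; rewrite ge0_fin_numE//.
by rewrite (le_lt_trans h2)// ltry.
Qed.

Let semigroupE x : K x -> semigroup P Z t f x = fine (Pf x) - M.
Proof.
move=> Kx; rewrite /semigroup /Rintegral.
have -> : (\int[P]_w (f (Z x t w))%:E)%E = (Pf x - M%:E)%E.
  transitivity (\int[P]_w ((lifted (Z x t w))%:E - M%:E))%E.
    apply: eq_integral => w _; rewrite liftedE// .
    by apply: (trajectory_in RD) => //; exact: admissible_noise HUV _.
  rewrite integralB//.
  - by rewrite expectation_cst.
  - apply/integrableP; split => //.
    under eq_integral do rewrite gee0_abs ?lee_fin//.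
    by have := Pf_fin Kx; rewrite ge0_fin_numE//; exact: expectation_after_ge0.
  - exact: finite_measure_integrable_cst.
by rewrite fineB// Pf_fin.
Qed.

(** For A in the stopped sigma-algebra, the time TA equal to T on A and +oo
    outside is again a stopping time, and the identity at TA is the identity at T
    integrated over A. *)
Lemma strong_markov_bounded z T : K z -> stopping_time (F z) T ->
  conditional_expectation P (stopped_sigma_algebra (F z) T)
    (fun w => if T w is r%:E then f (Z z (r + t) w) else 0)
    (fun w => if T w is r%:E then semigroup P Z t f (Z z r w) else 0).
Proof.
move=> Kz sT; have [T0 HT] := sT.
have mT := stopping_time_measurable RD HUV sT.
have mfT : measurable_fun setT (fun w => fine (T w)).
  exact: (measurableT_comp (fine_measurable measurableT)).
have KZ s w : 0 <= s -> K (Z z s w).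
  by move=> s0; apply: (trajectory_in RD) => //; exact: admissible_noise HUV _.
have mZs (s : Omega -> R) : measurable_fun setT s ->
    measurable_fun setT (fun w => Z z (s w) w).
  exact: (measurable_process_at RD HUV).
pose D := [set w | (T w < +oo)%E].
have mD : measurable D.
  by have := emeasurable_fun_infty_o measurableT mT +oo%E; rewrite setTI.
have finT w : D w -> exists2 s, T w = s%:E & 0 <= s.
  by rewrite /D/=; case: (T w) (T0 w) => [s| |] //; rewrite lee_fin => s0 _; exists s.
set X := fun w => _ : R; set Y := fun w => _ : R.
pose h x := fine (Pf x) - M.
have mh : measurable_fun setT h.
  apply: measurable_funB => //; apply: (measurableT_comp (fine_measurable measurableT)) => //.
  exact: (measurable_expectation_after RD HUV t mlifted lifted_ge0).
pose X' := (fun w => lifted (Z z (fine (T w) + t) w) - M) \_ D.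
pose Y' := (fun w => h (Z z (fine (T w)) w)) \_ D.
have XE : X = X'.
  apply/funext => w; rewrite /X /X' patchE; case: ifPn => [/set_mem Dw|/negP nD].
    by have [s -> s0] := finT w Dw; rewrite liftedE//; apply: KZ; rewrite addr_ge0.
  case E : (T w) => [s| |] //; exfalso; apply: nD; apply/mem_set.
  by rewrite /D/= E ltry.
have YE : Y = Y'.
  apply/funext => w; rewrite /Y /Y' patchE; case: ifPn => [/set_mem Dw|/negP nD].
    by have [s -> s0] := finT w Dw; rewrite semigroupE//; exact: KZ.
  case E : (T w) => [s| |] //; exfalso; apply: nD; apply/mem_set.
  by rewrite /D/= E ltry.
have mX : measurable_fun setT X.
  rewrite XE; apply/(measurable_restrictT _ mD); apply: measurable_funTS.
  apply: measurable_funB => //; apply: (measurableT_comp mlifted); apply: mZs.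
  exact: measurable_funD.
have mY : measurable_fun setT Y.
  rewrite YE; apply/(measurable_restrictT _ mD); apply: measurable_funTS.
  by apply: (measurableT_comp mh); exact: mZs.
have M0' := M0 Kz.
have bX w : `|X w| <= M.
  rewrite /X; case E : (T w) (T0 w) => [s| |]; rewrite ?normr0// lee_fin => s0.
  by apply: fM; apply: KZ; rewrite addr_ge0.
have bY w : `|Y w| <= M.
  rewrite /Y; case E : (T w) (T0 w) => [s| |]; rewrite ?normr0// lee_fin => s0.
  have Ks := KZ _ w s0; rewrite semigroupE//.
  have := Pf_bound Ks; rewrite -(fineK (Pf_fin Ks)) !lee_fin => /andP[h1 h2].
  by rewrite ler_norml; apply/andP; split; lra.
have bi (g : Omega -> R) : measurable_fun setT g -> (forall w, `|g w| <= M) ->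
    P.-integrable setT (EFin \o g).
  move=> mg bg; apply: measurable_bounded_integrable => //.
    exact: le_lt_trans (probability_le1 P measurableT) (ltry 1%R).
  by exists M; split; [exact: num_real|move=> m Mm w _; exact: le_trans (bg w) (ltW Mm)].
have iX := bi _ mX bX; have iY := bi _ mY bY.
split => //.
- move=> B mB; split; first by rewrite -[X in measurable X]setTI; exact: mY.
  move=> q q0.
  have -> : Y @^-1` B `&` [set w | (T w <= q%:E)%E] =
     [set w | Z z (fine (T w)) w \in h @^-1` B] `&` [set w | (T w <= q%:E)%E].
    have YhE w : (T w <= q%:E)%E -> Y w = h (Z z (fine (T w)) w).
      move=> Tq; rewrite YE /Y' patchE mem_set//; rewrite /D/=.
      by rewrite (le_lt_trans Tq)// ltry.
    apply/seteqP; split => w [BY Tq]; split => //.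
      by apply/mem_set; rewrite /preimage/= -YhE.
    by move/set_mem : BY; rewrite /preimage/= -YhE.
  apply: (stopped_state_adapted RD HUV gen_measurable gen_cvg) => //.
  by rewrite -[X in measurable X]setTI; exact: mh.
move=> A [mA HA].
pose TA w := if w \in A then T w else +oo%E.
have sTA : stopping_time (F z) TA.
  split; first by move=> w; rewrite /TA; case: ifP => // _; rewrite leey.
  move=> q q0; rewrite (_ : [set w | _] = A `&` [set w | (T w <= q%:E)%E]); first exact: HA.
  apply/seteqP; split => w; rewrite /TA/=.
    by case: ifPn => [/set_mem//|_]; rewrite leye_eq.
  by move=> [/mem_set ->].
have mAD : measurable (A `&` D) by exact: measurableI.
have TAE : [set w | (TA w < +oo)%E] = A `&` D.
  apply/seteqP; split => w; rewrite /TA/=.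
    by case: ifPn => [/set_mem//|_]; rewrite ltxx.
  by move=> [/mem_set ->].
have key := strong_markov_identity RD HUV Kz t0 mlifted lifted_ge0 sTA.
rewrite TAE in key.
have restr (g : Omega -> R) : (\int[P]_(w in A) ((g \_ D) w)%:E =
    \int[P]_(w in A `&` D) (g w)%:E)%E.
  rewrite [LHS]integral_mkcond [RHS]integral_mkcond; apply: eq_integral => w _.
  rewrite !patchE in_setI; case: (w \in A) => //=; by case: (w \in D).
rewrite XE YE !restr; symmetry.
have bounded_diff (g : Omega -> \bar R) : measurable_fun setT g ->
  (forall w, (A `&` D) w -> 0 <= g w <= (M + M)%:E)%E ->
  (\int[P]_(w in A `&` D) (fine (g w) - M)%:E =
   \int[P]_(w in A `&` D) g w - \int[P]_(w in A `&` D) M%:E)%E.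
  move=> mg bg.
  have fg w : (A `&` D) w -> g w \is a fin_num.
    move=> /bg /andP[g0 gM]; rewrite ge0_fin_numE//.
    by rewrite (le_lt_trans gM)// ltry.
  rewrite -integralB//.
  - apply: eq_integral => w /set_mem Dw.
    by rewrite EFinB fineK// fg.
  - apply: (@le_integrable _ _ _ P _ mAD g (fun=> (M + M)%:E)) => //.
    + exact: measurable_funTS.
    + move=> w /bg /andP[g0 gM]; rewrite !gee0_abs// lee_fin addr_ge0//.
    + exact: finite_measure_integrable_cst.
  - exact: finite_measure_integrable_cst.
have DA w : (A `&` D) w -> TA w = T w by move=> [/mem_set Aw _]; rewrite /TA Aw.
transitivity (\int[P]_(w in A `&` D) (lifted (Z z (fine (T w) + t) w))%:E - \int[P]_(w in A `&` D) M%:E)%E.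
  rewrite -(bounded_diff (fun w => (lifted (Z z (fine (T w) + t) w))%:E))//.
    apply/measurable_EFinP; apply: (measurableT_comp mlifted); apply: mZs.
    exact: measurable_funD.
  move=> w [_ /finT[s -> s0]]; rewrite !lee_fin lifted_ge0/=.
  have Ks : K (Z z (s + t) w) by apply: KZ; rewrite addr_ge0.
  rewrite /lifted patchE mem_set// lerD2r.
  by rewrite (le_trans (ler_norm _))// fM.
transitivity (\int[P]_(w in A `&` D) (Pf (Z z (fine (T w)) w)) - \int[P]_(w in A `&` D) M%:E)%E.
  congr (_ - _)%E.
  transitivity (\int[P]_(w in A `&` D) (lifted (Z z (fine (TA w) + t) w))%:E)%E.
    by apply: eq_integral => w /set_mem /DA ->.
  rewrite key; by apply: eq_integral => w /set_mem /DA ->.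
rewrite -(bounded_diff (fun w => Pf (Z z (fine (T w)) w)))//.
  apply: (measurableT_comp (measurable_expectation_after RD HUV t mlifted lifted_ge0)).
  exact: mZs.
by move=> w [_ /finT[s -> s0]]; apply: Pf_bound; exact: KZ.
Qed.

End bounded_function.

Theorem renewal_strong_markov : strong_markov P K Z.
Proof.
split.
- exact: (rd_mK RD).
- by move=> z t _ _; exact: (measurable_process RD HUV).
- by move=> z t w Kz t0; apply: (trajectory_in RD) => //; exact: admissible_noise HUV _.
- exact: process_start.
- move=> t A t0 mA; apply: measurable_funTS.
  apply: (@eq_measurable_fun _ _ _ _ _ (expectation_after drift W J P U V t \1_A)).
    move=> z _; rewrite /expectation_after integral_indic//=.
      by rewrite setIT.
    by rewrite -[X in measurable X]setTI; exact: (measurable_process RD HUV).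
  by apply: (measurable_expectation_after RD HUV t (measurable_indic mA)) => x; rewrite indicE.
- move=> z T t f Kz t0 sT mf [M fM].
  exact: (strong_markov_bounded t0 mf fM).
Qed.
End abstract_strong_markov.

(** * Local Lipschitz bounds *)
Section lipschitz.
Context (R : realType) (d : nat).
Implicit Types (x y v : 'rV[R]_d) (F : 'rV[R]_d -> 'rV[R]_d).

Lemma norm_coord x i : `|x ord0 i| <= `|x|.
Proof.
rewrite [leRHS]/Num.Def.normr/= mx_normrE.
exact: (le_bigmax _ (fun ij : 'I_1 * 'I_d => `|x ij.1 ij.2|) (ord0, i)).
Qed.

Lemma norm_le_coords x (M : R) : 0 <= M -> (forall i, `|x ord0 i| <= M) ->
  `|x| <= M.
Proof.
move=> M0 xM; rewrite [leLHS]/Num.Def.normr/= mx_normrE.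
by apply: bigmax_le => // -[i j] _; rewrite /= (ord1 i).
Qed.

Lemma closed_ball_compact (M : R) : compact [set x : 'rV[R]_d | `|x| <= M].
Proof.
have C := @rV_compact R d (fun=> `[- M, M]%classic) (fun=> @segment_compact R _ _).
case: (leP 0 M) => M0; last first.
  rewrite (_ : [set _ | _] = set0); first exact: compact0.
  apply/seteqP; split => // x /= xM; have := le_trans (normr_ge0 x) xM.
  by rewrite leNgt M0.
suff -> : [set x : 'rV[R]_d | `|x| <= M] =
    [set v | forall i, `[- M, M]%classic (v ord0 i)] by [].
apply/seteqP; split => x /= H.
  by move=> i; rewrite in_itv/= -ler_norml (le_trans (norm_coord _ _)).
by apply: norm_le_coords => // i; have := H i; rewrite in_itv/= -ler_norml.
Qed.

Lemma bounded_on_ball (g : 'rV[R]_d -> 'rV[R]_d) (M : R) : continuous g ->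
  exists2 C, 0 <= C & forall x, `|x| <= M -> `|g x| <= C.
Proof.
move=> cg; case: (leP 0 M) => M0; last first.
  exists 0 => // x xM; have := le_trans (normr_ge0 x) xM.
  by rewrite leNgt M0.
have ne : [set x : 'rV[R]_d | `|x| <= M] !=set0 by exists 0; rewrite /= normr0.
have cn : {within [set x : 'rV[R]_d | `|x| <= M], continuous (fun x => `|g x|)}.
  apply: continuous_subspaceT => x.
  exact: (continuous_comp (cg x) (@norm_continuous _ _ _)).
have [c _ Hc] := EVT_max_rV ne (@closed_ball_compact M) cn.
by exists `|g c| => // x xM; apply: Hc; exact/mem_set.
Qed.

Definition unit_vec (j : 'I_d) : 'rV[R]_d := delta_mx ord0 j.

Lemma is_derive_line F x v (t : R) i : derivable F (x + t *: v) v ->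
  is_derive t 1 (fun s : R => F (x + s *: v) ord0 i)
    ('D_v F (x + t *: v) ord0 i).
Proof.
move=> dF.
have E (h : R) : h^-1 *: (F (x + (h *: 1 + t) *: v) - F (x + t *: v)) =
    h^-1 *: (F (h *: v + (x + t *: v)) - F (x + t *: v)).
  by congr (_ *: (F _ - _)); rewrite scalerDl [h *: 1]mulr1 addrCA.
have dG : derivable (fun s : R => F (x + s *: v)) t 1.
  by move: dF; rewrite /derivable; under eq_fun do rewrite -E.
have DE : 'D_1 (fun s : R => F (x + s *: v)) t = 'D_v F (x + t *: v).
  by rewrite /derive; under eq_fun do rewrite E.
apply: DeriveDef; first by move/derivable_mxP : dG; exact.
by rewrite -DE (derive_mx dG) mxE.
Qed.

(** Mean value theorem along one coordinate axis, in each component. The segment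
    stays in the ball because the norm is the maximum of the coordinates. *)
Lemma partial_lipschitz F (M C : R) (j : 'I_d) x (h : R) :
  (forall y, derivable F y (unit_vec j)) ->
  (forall y, `|y| <= M -> `|'D_(unit_vec j) F y| <= C) ->
  `|x| <= M -> `|x + h *: unit_vec j| <= M ->
  `|F (x + h *: unit_vec j) - F x| <= C * `|h|.
Proof.
move=> dF bF xM xhM; set v := unit_vec j.
have C0 : 0 <= C by apply: le_trans (bF x xM).
apply: norm_le_coords; first by rewrite mulr_ge0.
move=> i; rewrite !mxE.
pose g (s : R) : R := F (x + s *: v) ord0 i.
have dg (s : R) : is_derive s 1 g ('D_v F (x + s *: v) ord0 i) by exact: is_derive_line.
have cg : continuous g.
  by move=> s; apply: differentiable_continuous; apply/derivable1_diffP; case: (dg s).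
have inball s : Num.min 0 h <= s <= Num.max 0 h -> `|x + s *: v| <= M.
  move=> /andP[s1 s2]; apply: norm_le_coords; first exact: le_trans xM.
  move=> k; have := le_trans (norm_coord x k) xM.
  have := le_trans (norm_coord (x + h *: v) k) xhM.
  rewrite !mxE /=; case: (k == j) => /=; rewrite ?mulr0 ?addr0// !mulr1.
  rewrite !ler_norml => /andP[h1 h2] /andP[h3 h4].
  by move: s1 s2; case: (leP 0 h) => h0 s1 s2; apply/andP; split; lra.
have [c cin Hc] : exists2 c, Num.min 0 h <= c <= Num.max 0 h &
    `|g h - g 0| = `|'D_v F (x + c *: v) ord0 i| * `|h|.
  case: (leP 0 h) => h0.
    have [|c] := @MVT_segment R g (fun s => 'D_v F (x + s *: v) ord0 i) 0 h h0 (fun s _ => dg s).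
      exact: continuous_subspaceT.
    by rewrite in_itv/= => ch ->; exists c; rewrite ?subr0 ?normrM.
  have [|c] := @MVT_segment R g (fun s => 'D_v F (x + s *: v) ord0 i) h 0 (ltW h0) (fun s _ => dg s).
    exact: continuous_subspaceT.
  rewrite in_itv/= => ch H; exists c => //.
  by rewrite -normrN opprB H sub0r normrM normrN.
have g0E : g 0 = F x ord0 i by rewrite /g scale0r addr0.
rewrite -g0E -/(g h) Hc ler_wpM2r//.
by rewrite (le_trans (norm_coord _ _))// bF// inball.
Qed.

(** x is reached from y by changing the coordinates one at a time. The hybrid
    points stay in the ball, so only the partial derivatives have to be
    bounded. *)
Lemma Ck1_locally_lipschitz F (M : R) : Ck 1 F ->
  exists2 L, 0 <= L & forall x y, `|x| <= M -> `|y| <= M ->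
    `|F x - F y| <= L * `|x - y|.
Proof.
move=> [_ HF].
have /choice[C HC] : forall j : 'I_d, exists C, 0 <= C /\
    forall y, `|y| <= M -> `|'D_(unit_vec j) F y| <= C.
  move=> j; have [_ [cD _]] := HF (unit_vec j).
  by have [C C0 HC] := bounded_on_ball M cD; exists C.
exists (\sum_j C j); first by apply: sumr_ge0 => j _; have [] := HC j.
move=> x y xM yM.
have M0 : 0 <= M by exact: le_trans xM.
pose hyb (k : nat) : 'rV[R]_d := \row_j (if (j < k)%N then x ord0 j else y ord0 j).
have hybM k : `|hyb k| <= M.
  apply: norm_le_coords => // i; rewrite mxE; case: ifP => _.
    exact: le_trans (norm_coord _ _) xM.
  exact: le_trans (norm_coord _ _) yM.
have hyb0 : hyb 0%N = y by apply/rowP => j; rewrite mxE ltn0.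
have hybd : hyb d = x by apply/rowP => j; rewrite mxE ltn_ord.
have hybS (k : 'I_d) : hyb k.+1 = hyb k + (x ord0 k - y ord0 k) *: unit_vec k.
  apply/rowP => j; rewrite !mxE /= ltnS leq_eqVlt.
  rewrite -val_eqE /=; case: eqP => /= [jk|_]; last by rewrite mulr0 addr0.
  have -> : j = k by exact: val_inj.
  by rewrite ltnn mulr1 addrCA subrr addr0.
have -> : F x - F y = \sum_(k < d) (F (hyb k.+1) - F (hyb k)).
  rewrite -{1}hybd -{1}hyb0 -(telescope_sumr (fun k => F (hyb k)))//.
  by rewrite big_mkord.
rewrite (le_trans (ler_norm_sum _ _ _))// mulr_suml; apply: ler_sum => k _.
have [C0 Ck_bound] := HC k.
rewrite hybS (le_trans (partial_lipschitz (C := C k) (M := M) _ _ _ _))//.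
- by move=> z; have [] := HF (unit_vec k).
- by rewrite -hybS.
- rewrite ler_wpM2l//; have := norm_coord (x - y) k; by rewrite !mxE.
Qed.

End lipschitz.

(** * Uniqueness of solutions *)
Section gronwall.
Context (R : realType) (d : nat).
Implicit Types (x y v : 'rV[R]_d) (F : 'rV[R]_d -> 'rV[R]_d) (t a b : R).

(** The Euclidean square distance, which unlike the maximum norm is
    differentiable. *)
Definition sqdist x y : R := \sum_i (x ord0 i - y ord0 i) ^+ 2.

Lemma sqdist_ge0 x y : 0 <= sqdist x y.
Proof. by apply: sumr_ge0 => i _; exact: sqr_ge0. Qed.

Lemma sqdistxx x : sqdist x x = 0.
Proof. by rewrite /sqdist big1// => i _; rewrite subrr expr0n. Qed.

Lemma norm_sub_sqdist x y : `|x - y| ^+ 2 <= sqdist x y.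
Proof.
have le i : `|(x - y) ord0 i| <= Num.sqrt (sqdist x y).
  rewrite -sqrtr_sqr ler_wsqrtr//= !mxE /sqdist (bigD1 i)//= lerDl.
  by apply: sumr_ge0 => j _; exact: sqr_ge0.
have := norm_le_coords (sqrtr_ge0 _) le.
by rewrite -(@ler_pXn2r _ 2)// ?nnegrE ?sqrtr_ge0// sqr_sqrtr// sqdist_ge0.
Qed.

Lemma sqdist_norm_sub x y : sqdist x y <= d%:R * `|x - y| ^+ 2.
Proof.
have -> : d%:R * `|x - y| ^+ 2 = \sum_(i < d) `|x - y| ^+ 2.
  by rewrite sumr_const card_ord mulr_natl.
apply: ler_sum => i _; rewrite -real_normK ?num_real// ler_pXn2r ?nnegrE//.
by have := norm_coord (x - y) i; rewrite !mxE.
Qed.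

Lemma sqdist_le0 x y : sqdist x y <= 0 -> x = y.
Proof.
move=> h; apply/eqP; rewrite -subr_eq0 -normr_eq0 -sqrf_eq0 eq_le sqr_ge0 andbT.
exact: le_trans (norm_sub_sqdist _ _) h.
Qed.

Lemma is_derive_coord (y : R -> 'rV[R]_d) t v i : is_derive t 1 y v ->
  is_derive t 1 (fun s => y s ord0 i) (v ord0 i).
Proof.
move=> [dy Dy]; apply: DeriveDef; first by move/derivable_mxP : dy; exact.
by rewrite -Dy (derive_mx dy) mxE.
Qed.

Lemma is_derive_sqdist (y1 y2 : R -> 'rV[R]_d) v1 v2 t :
  is_derive t 1 y1 v1 -> is_derive t 1 y2 v2 ->
  is_derive t 1 (fun s => sqdist (y1 s) (y2 s))
    (\sum_i 2 * (y1 t ord0 i - y2 t ord0 i) * (v1 ord0 i - v2 ord0 i)).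
Proof.
move=> d1 d2.
have E : (fun s => sqdist (y1 s) (y2 s)) =
    \sum_(i < d) ((fun s => y1 s ord0 i) - (fun s => y2 s ord0 i)) ^+ 2.
  by apply/funext => s; rewrite fct_sumE; apply: eq_bigr => i _; rewrite exprfctE.
rewrite E; apply: is_derive_sum => i.
have := is_derive_coord i d1; have := is_derive_coord i d2 => h2 h1.
apply: is_derive_eq; rewrite expr1 /GRing.scale/= -mulr_natl.
by [].
Qed.

Lemma is_derive_expR_scale c t : is_derive t 1 (fun s => expR (c * s)) (c * expR (c * t)).
Proof.
apply: is_derive_eq.
by rewrite /GRing.scale/= mulr1 mulrC.
Qed.

Section comparison.
Variables (F : 'rV[R]_d -> 'rV[R]_d) (M L a b : R) (y1 y2 : R -> 'rV[R]_d).
Hypotheses (L0 : 0 <= L) (ab : a <= b).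
Hypothesis lipF : forall x y, `|x| <= M -> `|y| <= M -> `|F x - F y| <= L * `|x - y|.
Hypothesis dy1 : forall t, a <= t <= b -> is_derive t 1 y1 (F (y1 t)).
Hypothesis dy2 : forall t, a <= t <= b -> is_derive t 1 y2 (F (y2 t)).
Hypothesis by1 : forall t, a <= t <= b -> `|y1 t| <= M.
Hypothesis by2 : forall t, a <= t <= b -> `|y2 t| <= M.

Let C := 2 * d%:R * L.
Let sq t := sqdist (y1 t) (y2 t).
Let dsq t := \sum_i 2 * (y1 t ord0 i - y2 t ord0 i) * (F (y1 t) ord0 i - F (y2 t) ord0 i).

Let dsq_bound t : a <= t <= b -> `|dsq t| <= C * sq t.
Proof.
move=> tab; apply: (le_trans (y := C * `|y1 t - y2 t| ^+ 2)); last first.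
  by rewrite ler_wpM2l ?norm_sub_sqdist// !mulr_ge0.
rewrite (le_trans (ler_norm_sum _ _ _))//.
have -> : C * `|y1 t - y2 t| ^+ 2 = \sum_(i < d) 2 * (L * `|y1 t - y2 t| ^+ 2).
  by rewrite sumr_const card_ord -mulr_natl /C; ring.
apply: ler_sum => i _; rewrite !normrM normr_nat -!mulrA ler_wpM2l//.
have h1 := norm_coord (y1 t - y2 t) i.
have h2 := norm_coord (F (y1 t) - F (y2 t)) i.
have h3 := lipF (by1 tab) (by2 tab).
rewrite !mxE in h1 h2.
apply: le_trans (ler_pM _ _ h1 (le_trans h2 h3)) _ => //.
by rewrite expr2 mulrCA.
Qed.

(* By the Lipschitz bound, the derivative of sq has absolute value at most C * sq,
   so sq * exp(- C t) decreases and sq * exp(C t) increases. *)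
Let weighted (c : R) t := sq t * expR (c * t).

Let is_derive_weighted c t : a <= t <= b ->
  is_derive t 1 (weighted c) ((dsq t + c * sq t) * expR (c * t)).
Proof.
move=> tab; have h1 := is_derive_sqdist (dy1 tab) (dy2 tab).
have h2 := is_derive_expR_scale c t.
rewrite (_ : weighted c = sq * (fun s => expR (c * s))); last exact/funext.
apply: is_derive_eq; rewrite /GRing.scale/= mulrDl addrC; congr (_ + _).
  by rewrite mulrC.
by rewrite mulrCA mulrA.
Qed.

Let weighted_cont c : {within `[a, b], continuous (weighted c)}.
Proof.
apply: derivable_within_continuous => t; rewrite in_itv => tab.
by case: (is_derive_weighted c tab).
Qed.

Let tabW t : t \in `]a, b[ -> a <= t <= b.
Proof. by rewrite in_itv/= => /andP[/ltW -> /ltW ->]. Qed.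

Lemma gronwall_forward : sq b <= sq a * expR (C * (b - a)).
Proof.
have : weighted (- C) b <= weighted (- C) a.
  apply: (@ler0_derive1_nincr _ (weighted (- C)) a b) => //.
  - by move=> t /tabW tab; case: (is_derive_weighted (- C) tab).
  - move=> t /tabW tab; have dw := is_derive_weighted (- C) tab.
    rewrite derive1E (@derive_val _ _ _ _ _ _ _ dw) pmulr_lle0 ?expR_gt0//.
    by have := le_trans (ler_norm _) (dsq_bound tab); rewrite mulNr subr_le0.
rewrite /weighted -ler_pdivlMr ?expR_gt0// -mulrA => /le_trans; apply.
by rewrite ler_wpM2l ?sqdist_ge0// -expRN -expRD ler_expR; lra.
Qed.

Lemma gronwall_backward : sq a <= sq b * expR (C * (b - a)).
Proof.
have : weighted C a <= weighted C b.
  apply: (@ger0_derive1_ndecr _ (weighted C) a b) => //.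
  - by move=> t /tabW tab; case: (is_derive_weighted C tab).
  - move=> t /tabW tab; have dw := is_derive_weighted C tab.
    rewrite derive1E (@derive_val _ _ _ _ _ _ _ dw) mulr_ge0 ?expR_ge0//.
    have := le_trans (ler_norm _) (_ : `|- dsq t| <= C * sq t).
    by rewrite normrN => /(_ (dsq_bound tab)); lra.
rewrite /weighted -ler_pdivlMr ?expR_gt0// -mulrA => /le_trans; apply.
by rewrite ler_wpM2l ?sqdist_ge0// -expRN -expRD ler_expR; lra.
Qed.

End comparison.

Lemma solution_bounded (y : R -> 'rV[R]_d) a b : a <= b ->
  (forall t, a <= t <= b -> derivable y t 1) ->
  exists2 M, 0 <= M & forall t, a <= t <= b -> `|y t| <= M.
Proof.
move=> ab dy.
have cn : {within `[a, b], continuous (fun t => `|y t|)}.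
  have cy : {within `[a, b], continuous y}.
    by apply: derivable_within_continuous => t; rewrite in_itv => /dy.
  move=> t; exact: (continuous_comp (cy t) (@norm_continuous _ _ _)).
have [c _ Hc] := EVT_max ab cn.
by exists `|y c| => // t tab; apply: Hc; rewrite in_itv.
Qed.

Lemma solution_unique F (J : set R) (y1 y2 : R -> 'rV[R]_d) a : Ck 1 F ->
  is_interval J -> J a -> y1 a = y2 a ->
  (forall t, J t -> is_derive t 1 y1 (F (y1 t))) ->
  (forall t, J t -> is_derive t 1 y2 (F (y2 t))) ->
  forall t, J t -> y1 t = y2 t.
Proof.
move=> CF iJ Ja y12 d1 d2 t Jt.
pose l := Num.min a t; pose u := Num.max a t.
have lu : l <= u by rewrite /l /u; case: (leP a t) => // /ltW.
have HJ s : l <= s <= u -> J s.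
  move=> /andP[ls su]; rewrite /l /u in ls su; move: ls su.
  by case: (leP a t) => at_ ls su; [apply: (iJ a t)|apply: (iJ t a)] => //; rewrite ls su.
have [M1 M10 HM1] : exists2 M, 0 <= M & forall t, l <= t <= u -> `|y1 t| <= M.
  by apply: solution_bounded => // s /HJ /d1 [].
have [M2 M20 HM2] : exists2 M, 0 <= M & forall t, l <= t <= u -> `|y2 t| <= M.
  by apply: solution_bounded => // s /HJ /d2 [].
pose M := Num.max M1 M2.
have [L L0 HL] := Ck1_locally_lipschitz M CF.
have b1 s : l <= s <= u -> `|y1 s| <= M by move=> /HM1; rewrite /M le_max => ->.
have b2 s : l <= s <= u -> `|y2 s| <= M by move=> /HM2; rewrite /M le_max => ->; rewrite orbT.
have d1' s : l <= s <= u -> is_derive s 1 y1 (F (y1 s)) by move=> /HJ; exact: d1.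
have d2' s : l <= s <= u -> is_derive s 1 y2 (F (y2 s)) by move=> /HJ; exact: d2.
have fw := gronwall_forward L0 lu HL d1' d2' b1 b2.
have bw := gronwall_backward L0 lu HL d1' d2' b1 b2.
apply: sqdist_le0; move: fw bw; rewrite /l /u.
case: (leP a t) => _; rewrite y12 sqdistxx mul0r => fw bw //.
Qed.

End gronwall.

(** * The flow of a forward-complete vector field *)
Section flow.
Context (R : realType) (d n : nat) (D : switching_data R d n).
Hypothesis HD : standing_assumptions D.
Implicit Types (x : 'rV[R]_d) (i : 'I_n.+1) (s t : R).
Local Notation fl := (flow D).
Local Notation esc := (esc D).

Definition alive i x : set R := [set t | (- esc i x < t%:E)%E].

Lemma vfield_Ck1 i : Ck 1 (vfield D i).
Proof. exact: (vfield_smooth HD i 1%N). Qed.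

Lemma alive_up i x s t : alive i x s -> s <= t -> alive i x t.
Proof. by move=> h st; apply: lt_le_trans h _; rewrite lee_fin. Qed.

Lemma alive_ge0 i x t : 0 <= t -> alive i x t.
Proof.
apply: alive_up; rewrite /alive/= oppe_lt0; exact: (esc_gt0 HD).
Qed.

Lemma flow0 i x : fl i 0 x = x.
Proof. by case: (flow_maximal HD i x). Qed.

Lemma alive_open i x : open (alive i x).
Proof. by case: (flow_maximal HD i x) => _ _ []. Qed.

Lemma alive_interval i x : is_interval (alive i x).
Proof. by case: (flow_maximal HD i x) => _ _ []. Qed.

Lemma flow_is_derive i x t : alive i x t ->
  is_derive t 1 (fun s => fl i s x) (vfield D i (fl i t x)).
Proof. by case: (flow_maximal HD i x) => _ _ [_ _ H] _; exact: H. Qed.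

Lemma flow_maximality i x (J : set R) y : alive i x `<=` J ->
  (forall t, alive i x t -> y t = fl i t x) -> solves (vfield D i) J y ->
  J `<=` alive i x.
Proof. by case: (flow_maximal HD i x) => _ _ _; exact. Qed.

Lemma is_derive_translate (y : R -> 'rV[R]_d) s t v : is_derive (t + s) 1 y v ->
  is_derive t 1 (fun r => y (r + s)) v.
Proof.
move=> [dy Dy]; have E (h : R) : h^-1 *: (y (h *: 1 + t + s) - y (t + s)) =
   h^-1 *: (y (h *: 1 + (t + s)) - y (t + s)) by rewrite addrA.
apply: DeriveDef; first by move: dy; rewrite /derivable; under eq_fun do rewrite -E.
by rewrite -Dy /derive; under eq_fun do rewrite E.
Qed.

Lemma solves_translate i x s : solves (vfield D i)
  [set t | alive i x (t + s)] (fun t => fl i (t + s) x).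
Proof.
split.
- have -> : [set t | alive i x (t + s)] = (fun t => t + s) @^-1` alive i x by [].
  apply: open_comp; last exact: alive_open.
  by move=> t _; apply: cvgD; [exact: cvg_id|exact: cvg_cst].
- move=> t1 t2 /= h1 h2 t /andP[t1t tt2].
  by apply: (alive_up h1); rewrite lerD2r.
- by move=> t /= h; exact: (is_derive_translate (flow_is_derive h)).
Qed.

Lemma flow_overlap i x s t : alive i x s -> alive i (fl i s x) t ->
  alive i x (t + s) -> fl i t (fl i s x) = fl i (t + s) x.
Proof.
move=> hs ht hts.
have [_ int1 der1] := solves_translate i x s.
apply: (@solution_unique _ _ (vfield D i)
  ([set t | alive i x (t + s)] `&` alive i (fl i s x)) (fun t => fl i t (fl i s x))
  (fun t => fl i (t + s) x) 0) => //.
- exact: vfield_Ck1.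
- move=> t1 t2 [h1 h1'] [h2 h2'] r rt; split.
    exact: (int1 _ _ h1 h2 r rt).
  exact: (alive_interval h1' h2' rt).
- split; first by rewrite /= add0r.
  exact: alive_ge0.
- by rewrite flow0 add0r.
- by move=> r [_ h]; exact: flow_is_derive.
- by move=> r [h _]; exact: der1.
Qed.

(** The maximal solution through the point reached at time s is the maximal
    solution through x, translated by s. Both domains are unbounded above, so one
    contains the other; two solutions agree on the smaller domain, and the one on
    the larger domain extends the other, which maximality forbids unless the
    domains are equal. *)
Lemma alive_flow i x s t : alive i x s ->
  alive i (fl i s x) t <-> alive i x (t + s).
Proof.
move=> hs; set p := fl i s x.
have up (A B : set R) : (forall r r', A r -> r <= r' -> A r') ->
    (forall r r', B r -> r <= r' -> B r') -> A `<=` B \/ B `<=` A.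
  move=> uA uB; case: (pselect (A `<=` B)) => [|nAB]; first by left.
  right => b Bb; have [a [Aa nBa]] : exists a, A a /\ ~ B a.
    apply: contrapT => H; apply: nAB => a Aa; apply: contrapT => nBa.
    by apply: H; exists a.
  case: (leP a b) => ab; first exact: uA Aa ab.
  by exfalso; apply: nBa; exact: uB Bb (ltW ab).
have [sub1|sub2] := up (alive i p) [set t | alive i x (t + s)]
    (@alive_up i p) (fun r r' h rr' => alive_up h (lerD rr' (lexx s))).
- split; first exact: sub1.
  move=> h; apply: (flow_maximality sub1 _ (solves_translate i x s)) => //.
  by move=> r hr; rewrite flow_overlap//; exact: sub1.
- split; last exact: sub2.
  move=> h; rewrite -[t](addrK s) in h.
  have sub : alive i x `<=` [set r | alive i p (r - s)].
    by move=> r hr; apply: sub2; rewrite /= subrK.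
  have := flow_maximality sub _ (solves_translate i p (- s)).
  apply => // r hr.
  by rewrite flow_overlap ?subrK//; apply: sub2; rewrite /= subrK.
Qed.

Lemma flowD i x s t : alive i x s -> alive i x (t + s) ->
  fl i t (fl i s x) = fl i (t + s) x.
Proof. by move=> hs hts; apply: flow_overlap => //; apply/alive_flow. Qed.

Lemma flow_bounded i x T : 0 <= T ->
  exists2 M, 0 <= M & forall t, 0 <= t <= T -> `|fl i t x| <= M.
Proof.
move=> T0; apply: solution_bounded => // t /andP[t0 _].
by case: (flow_is_derive (alive_ge0 i x t0)).
Qed.

(** Trajectories from nearby points stay close on [0, T]. The Lipschitz constant L
    is that of a ball of radius one more than the reference trajectory needs.
    Gronwall's bound [gr] holds while the square distance sq is at most 1, and for
    delta small it keeps sq below 1/2; [key] excludes a first time r at which sq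
    would exceed 1. Forward completeness provides all the solutions. *)
Lemma flow_continuous_initial i x0 T (eps : R) : 0 <= T -> 0 < eps ->
  exists2 delta, 0 < delta & forall x t, `|x - x0| < delta -> 0 <= t <= T ->
    `|fl i t x - fl i t x0| <= eps.
Proof.
move=> T0 eps0; have [M M0 HM] := flow_bounded i x0 T0.
have [L L0 HL] := Ck1_locally_lipschitz (M + 1) (vfield_Ck1 i).
pose C := 2 * d%:R * L; have C0 : 0 <= C by rewrite /C !mulr_ge0.
pose eta := Num.min (eps ^+ 2) (2^-1 : R).
have eta0 : 0 < eta by rewrite lt_min exprn_gt0//= invr_gt0.
pose A := d%:R * expR (C * T).
have A0 : 0 <= A by rewrite mulr_ge0// expR_ge0.
pose delta := Num.min 1 (eta / (A + 1)).
have delta0 : 0 < delta by rewrite lt_min ltr01/= divr_gt0// ltr_wpDl.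
exists delta => // x t xx0.
pose sq s := sqdist (fl i s x) (fl i s x0).
have sq0 : sq 0 * expR (C * T) <= eta.
  rewrite /sq !flow0; apply: (@le_trans _ _ (A * `|x - x0| ^+ 2)).
    by rewrite /A [leRHS]mulrAC ler_wpM2r ?expR_ge0// sqdist_norm_sub.
  have x1 : `|x - x0| <= 1 by apply: ltW; apply: lt_le_trans xx0 _; rewrite ge_min lexx.
  have x2 : `|x - x0| <= eta / (A + 1) by apply: ltW; apply: lt_le_trans xx0 _; rewrite ge_min lexx orbT.
  apply: (@le_trans _ _ (A * (eta / (A + 1)))).
    rewrite ler_wpM2l// (le_trans _ x2)// expr2.
    by rewrite -[leRHS]mulr1 ler_wpM2l.
  rewrite mulrA ler_pdivrMr ?ltr_wpDl// mulrDr mulr1 mulrC lerDl; exact: ltW.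
have gr s : 0 <= s <= T -> (forall r, 0 <= r <= s -> sq r <= 1) -> sq s <= eta.
  move=> /andP[s0 sT] Hr.
  have b2 r : 0 <= r <= s -> `|fl i r x0| <= M + 1.
    by move=> /andP[r0 rs]; rewrite (le_trans (HM r _)) ?lerDl// r0 (le_trans rs).
  have b1 r : 0 <= r <= s -> `|fl i r x| <= M + 1.
    move=> rs; have /andP[r0 rs'] := rs.
    rewrite -[fl i r x](subrK (fl i r x0)) (le_trans (ler_normD _ _))// addrC lerD//.
      by apply: HM; rewrite r0 (le_trans rs').
    rewrite -(@ler_pXn2r _ 2)// ?nnegrE// expr1n.
    exact: le_trans (norm_sub_sqdist _ _) (Hr r rs).
  have de y r : 0 <= r <= s -> is_derive r 1 (fun s => fl i s y) (vfield D i (fl i r y)).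
    by move=> /andP[r0 _]; apply: flow_is_derive; exact: alive_ge0.
  have := gronwall_forward L0 s0 HL (de x) (de x0) b1 b2.
  move=> /le_trans; apply; apply: le_trans sq0.
  by rewrite ler_wpM2l ?sqdist_ge0// ler_expR subr0 ler_wpM2l.
have dsq s : 0 <= s -> derivable sq s 1.
  move=> s0; have h1 := flow_is_derive (alive_ge0 i x s0).
  have h2 := flow_is_derive (alive_ge0 i x0 s0).
  by case: (is_derive_sqdist h1 h2).
have csq s : 0 <= s -> {for s, continuous sq}.
  by move=> /dsq /derivable1_diffP /differentiable_continuous.
have key s : 0 <= s <= T -> sq s <= 1.
  move=> sT; apply: contrapT => /negP; rewrite -ltNge => sq1.
  pose B := [set r | 0 <= r <= T /\ 1 < sq r].
  have Bs : B s by [].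
  have hB : has_inf B.
    by split; [exists s|exists 0 => r [/andP[]]].
  pose r := inf B.
  have r0 : 0 <= r by apply: lb_le_inf; [exists s|move=> ? [/andP[]]].
  have rs : r <= s by apply: ge_inf => //; exact: hB.2.
  have rT : r <= T by apply: le_trans rs _; case/andP: sT.
  have before q : 0 <= q -> q < r -> sq q <= 1.
    move=> q0 qr; rewrite leNgt; apply/negP => sqq.
    have Bq : B q by split => //; rewrite q0/= (le_trans (ltW qr)).
    by have := ge_inf hB.2 Bq; rewrite leNgt qr.
  have eta12 : eta <= 2^-1 by rewrite ge_min lexx orbT.
  have /cvgrPdist_lt /(_ (4^-1)) := csq r r0.
  rewrite invr_gt0 => /(_ (ltr0n R 4)) [e /= e0 He].
  have [q1 Bq1 q1r] := inf_adherent e0 hB; have [_ sq1'] := Bq1.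
  have rq1 : r <= q1.
    exact: (ge_inf hB.2 Bq1).
  have close1 : `|sq r - sq q1| < 4^-1.
    by apply: He; rewrite /ball_/= distrC ger0_norm ?subr_ge0// ltrBlDl.
  pose q2 := Num.max 0 (r - e / 2).
  have q20 : 0 <= q2 by rewrite le_max lexx.
  have q2r : q2 <= r by rewrite ge_max r0/= gerBl divr_ge0// ltW.
  have close2 : `|sq r - sq q2| < 4^-1.
    apply: He; rewrite /ball_/= ger0_norm ?subr_ge0// ltrBlDr -ltrBlDl lt_max.
    by apply/orP; right; lra.
  have sqq2 : sq q2 <= eta.
    apply: gr; first by rewrite q20 (le_trans q2r).
    move=> q /andP[q0 qq2].
    case: (ltP 0 r) => r0'; last first.
      have -> : q = 0.
        by apply/eqP; rewrite eq_le q0 andbT (le_trans qq2)// (le_trans q2r).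
      have e1 : 1 <= expR (C * T) by rewrite -expR0 ler_expR mulr_ge0.
      have : sq 0 <= sq 0 * expR (C * T) by rewrite -[leLHS]mulr1 ler_wpM2l// sqdist_ge0.
      by move=> /le_trans /(_ sq0); lra.
    apply: before => //; apply: le_lt_trans qq2 _.
    by rewrite gt_max r0'/= gtrBl divr_gt0.
  move: close1 close2; rewrite !ltr_norml => /andP[c1 c2] /andP[c3 c4]; lra.
move=> tT; have h : sq t <= eta.
  apply: gr => // r /andP[r0 rt]; apply: key; rewrite r0 (le_trans rt)//.
  by case/andP: tT.
rewrite -(@ler_pXn2r _ 2)// ?nnegrE ?(ltW eps0)//.
apply: le_trans (norm_sub_sqdist _ _) _; apply: le_trans h _.
by rewrite ge_min lexx.
Qed.

End flow.

(** * Borel sets of vectors and of products *)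

(** In a space with a countable dense family, an open set is the union of the
    countably many balls around that family, of radii 1/(m+1), which it
    contains. *)
Lemma open_in_sigma_algebra (R : realType) (T : pseudoMetricType R)
    (I : countType) (c : I -> T) (M : set (set T)) :
  M set0 -> (forall A : (set T)^nat, (forall k, M (A k)) -> M (\bigcup_k A k)) ->
  (forall i e, 0 < e -> M (ball (c i) e)) ->
  (forall x e, 0 < e -> exists i, ball (c i) e x) ->
  forall O, open O -> M O.
Proof.
move=> M0 MU Mb dense_c O oO.
pose A k : set T := if unpickle k is Some (i, m)
  then (if pselect (ball (c i) m.+1%:R^-1 `<=` O) is left _ then ball (c i) m.+1%:R^-1 else set0)
  else set0.
have -> : O = \bigcup_k A k.
  apply/seteqP; split => x; last first.
    move=> [k _]; rewrite /A; case: (unpickle k) => [[i m]|]//.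
    by case: pselect => // h /h.
  move=> Ox; have /nbhs_ballP[e /= e0 He] := open_nbhs_nbhs (conj oO Ox).
  pose m := Num.truncn (e / 2)^-1.
  have me : m.+1%:R^-1 < e / 2.
    by rewrite -[ltRHS]invrK ltf_pV2 ?posrE ?invr_gt0 ?divr_gt0// truncnS_gt.
  have m0 : 0 < m.+1%:R^-1 :> R by rewrite invr_gt0.
  have [i Hi] := dense_c x _ m0.
  exists (pickle (i, m)) => //; rewrite /A pickleK; case: pselect => // -[] y Hy.
  apply: He; apply: (le_ball (e1 := m.+1%:R^-1 + m.+1%:R^-1)); first by rewrite [leRHS]splitr lerD // ltW.
  exact: ball_triangle (ball_sym Hi) Hy.
apply: MU => k; rewrite /A; case: (unpickle k) => [[i m]|//].
by case: pselect => // _; apply: Mb; rewrite invr_gt0.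
Qed.

Section borel.
Context (R : realType) (d : nat).

Lemma rat_vector_dense (x : 'rV[R]_d) (e : R) : 0 < e ->
  exists q : 'rV[rat]_d, ball (map_mx ratr q : 'rV[R]_d) e x.
Proof.
move=> e0; have /choice[q Hq] : forall i : 'I_d, exists q : rat,
    `|ratr q - x ord0 i| < e.
  move=> i; have : x ord0 i - e < x ord0 i + e by rewrite ltrD2l gtrN.
  move=> /rat_in_itvoo[q]; rewrite in_itv/= => /andP[h1 h2]; exists q.
  by rewrite ltr_distl h1 h2.
exists (\row_i q i).
by split => // i j; rewrite (ord1 i) !mxE /ball/=.
Qed.

Lemma rat_dense (x : R) (e : R) : 0 < e -> exists q : rat, ball (ratr q : R) e x.
Proof.
move=> e0; have : x - e < x + e by rewrite ltrBlDr -addrA ltrDl addr_gt0.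
move=> /rat_in_itvoo[q]; rewrite in_itv/= => /andP[h1 h2]; exists q.
by rewrite /ball/= ltr_distl h1 h2.
Qed.

Lemma measurable_ball_rV (x : 'rV[R]_d) e : measurable (ball x e).
Proof.
case: (leP e 0) => e0; last first.
  by apply: sub_sigma_algebra; exact: ball_open.
rewrite (_ : ball x e = set0)//; apply/seteqP; split => // y [].
by rewrite ltNge e0.
Qed.

(** The product sigma-algebra contains the Borel sets of the product topology. *)
Lemma open_prod_measurable (O : set (R * 'rV[R]_d)) : open O -> measurable O.
Proof.
apply: (@open_in_sigma_algebra R _ (rat * 'rV[rat]_d)%type
  (fun q => (ratr q.1 : R, map_mx ratr q.2 : 'rV[R]_d))).
- exact: measurable0.
- by move=> A mA; exact: bigcupT_measurable.
- move=> q e e0; rewrite (_ : ball _ _ = ball (ratr q.1 : R) e `*` ball (map_mx ratr q.2 : 'rV[R]_d) e)//.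
  by apply: measurableX; [exact: measurable_ball|exact: measurable_ball_rV].
- move=> [t x] e e0; have [q1 h1] := rat_dense t e0; have [q2 h2] := rat_vector_dense x e0.
  by exists (q1, q2).
Qed.

Lemma closed_prod_measurable (C : set (R * 'rV[R]_d)) : closed C -> measurable C.
Proof.
by move=> cC; rewrite -(setCK C); apply: measurableC; apply: open_prod_measurable;
  rewrite openC.
Qed.

Definition coordinate_sets : set (set 'rV[R]_d) :=
  \bigcup_i preimage_set_system setT (fun x : 'rV[R]_d => x ord0 i) measurable.

Lemma measurable_coordinate i :
  measurable_fun setT (fun x : 'rV[R]_d => x ord0 i).
Proof.
apply: (measurability (@RGenOpens.G R)); first exact: RGenOpens.measurableE.
move=> _ [_ [a [b ->]] <-]; rewrite setTI; apply: sub_sigma_algebra.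
apply: open_comp; last exact: itv_open.
by move=> x _; exact: coord_continuous.
Qed.

Lemma measurable_rV_generated : @measurable _ 'rV[R]_d = <<s coordinate_sets >>.
Proof.
apply/seteqP; split; last first.
  apply: smallest_sub; first exact: sigma_algebra_measurable.
  by move=> _ [i _ [B mB <-]]; exact: measurable_coordinate.
apply: smallest_sub; first exact: smallest_sigma_algebra.
move=> O; apply: (@open_in_sigma_algebra R 'rV[R]_d 'rV[rat]_d
  (fun q => map_mx ratr q) (<<s coordinate_sets >>)).
- exact: sigma_algebra0.
- by move=> A mA; exact: sigma_algebra_bigcup.
- move=> q e e0; set x := map_mx ratr q.
  have -> : ball x e = \bigcap_(i in [set: 'I_d]) (fun y : 'rV[R]_d => y ord0 i) @^-1` ball (x ord0 i) e.
    apply/seteqP; split => y; first by move=> [_ H] i _; exact: H.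
    by move=> H; split => // i j; rewrite (ord1 i); exact: H.
  pose T := g_sigma_algebraType coordinate_sets.
  apply: (@fin_bigcap_measurable _ T) => // i _.
  apply: sub_sigma_algebra; exists i => //; exists (ball (x ord0 i) e); last by rewrite setTI.
  exact: measurable_ball.
- by move=> x e e0; exact: rat_vector_dense.
Qed.

Lemma measurable_fun_to_rV dT (T : measurableType dT) (A : set T) (f : T -> 'rV[R]_d) :
  measurable A -> (forall O, open O -> measurable (A `&` f @^-1` O)) ->
  measurable_fun A f.
Proof.
move=> mA H; apply: (measurability (@open 'rV[R]_d)) => //.
by move=> _ [B oB <-]; exact: H.
Qed.

Lemma measurable_continuous_prod (f : R * 'rV[R]_d -> 'rV[R]_d) :
  continuous f -> measurable_fun setT f.
Proof.
move=> cf; apply: measurable_fun_to_rV => // O oO; rewrite setTI.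
by apply: open_prod_measurable; exact: (open_comp (fun x _ => cf x)).
Qed.

Lemma measurable_continuous_real (f : 'rV[R]_d -> R) :
  continuous f -> measurable_fun setT f.
Proof.
move=> cf; apply: (measurability (@RGenOpens.G R)); first exact: RGenOpens.measurableE.
move=> _ [_ [a [b ->]] <-]; rewrite setTI; apply: sub_sigma_algebra.
by apply: open_comp; [move=> x _; exact: cf|exact: itv_open].
Qed.

End borel.

(** * Measurability of the flow, forward and backward *)
Section flow_measurability.
Context (R : realType) (d n : nat) (D : switching_data R d n).
Hypothesis HD : standing_assumptions D.
Implicit Types (x : 'rV[R]_d) (i : 'I_n.+1) (s t : R).
Local Notation fl := (flow D).
Local Notation alive := (alive D).

(** Negative times are replaced by 0, which makes the map total and
    continuous. *)
Definition forward_flow i (p : R * 'rV[R]_d) := fl i (Num.max p.1 0) p.2.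

Lemma flow_continuous_time i x t : alive i x t -> {for t, continuous (fun s => fl i s x)}.
Proof.
move=> /(flow_is_derive HD)[h _]; apply: differentiable_continuous.
exact/derivable1_diffP.
Qed.

Lemma forward_flow_continuous i : continuous (forward_flow i).
Proof.
move=> [t0 x0]; apply/cvgrPdist_le => e e0.
have e20 : 0 < e / 2 by rewrite divr_gt0.
set T := Num.max t0 0 + 1.
have T0 : 0 <= T by rewrite addr_ge0// le_max lexx orbT.
have [delta delta0 Hdelta] := flow_continuous_initial HD i x0 T0 e20.
have ctime : {for t0, continuous (fun s => fl i (Num.max s 0) x0)}.
  apply: (@continuous_comp _ _ _ (fun s : R => Num.max s 0) (fun s => fl i s x0)).
    by apply: continuous_max; [exact: cvg_id|exact: cvg_cst].
  by apply: flow_continuous_time; apply: alive_ge0 => //; rewrite le_max lexx orbT.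
have /cvgrPdist_le /(_ _ e20) [r /= r0 Hr] := ctime.
exists (ball t0 (Num.min r 1), ball x0 delta) => /=.
  by split; apply: nbhsx_ballx => //; rewrite lt_min r0/=.
move=> [t x] [/= tb xb]; rewrite /forward_flow/=.
have tr : ball t0 r t by apply: le_ball tb; rewrite ge_min lexx.
have t1 : `|t0 - t| < 1 by have := tb; rewrite /ball/= lt_min => /andP[].
rewrite -(subrK (fl i (Num.max t 0) x0) (fl i (Num.max t0 0) x0)) -addrA.
rewrite (le_trans (ler_normD _ _))// (splitr e) lerD//; first exact: Hr.
rewrite distrC; apply: Hdelta.
  by move: xb; rewrite -ball_normE /= distrC.
rewrite le_max lexx orbT/= /T.
move: t1; rewrite ltr_norml => /andP[h1 h2].
by rewrite ge_max; apply/andP; split; case: (leP t0 0) => ?; lra.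
Qed.

(** A point x can be followed back during a time s >= 0 exactly when it is
    flow s y for some y, and then y is flow (- s) x. So the set is the image of
    [0, +oo[ * C under (s, y) |-> (s, flow s y), a countable union of continuous
    images of compact sets. *)
Lemma backward_image_measurable i (C : set 'rV[R]_d) : closed C ->
  measurable [set p : R * 'rV[R]_d | [/\ 0 <= p.1, alive i p.2 (- p.1) &
     C (fl i (- p.1) p.2)]].
Proof.
move=> cC.
pose h (p : R * 'rV[R]_d) := (p.1, forward_flow i p).
have ch : continuous h.
  move=> p; have c1 : (fun q : R * 'rV[R]_d => q.1) @ p --> p.1 by exact: cvg_fst.
  exact: (cvg_pair c1 (@forward_flow_continuous i p)).
pose L (m : nat) : set (R * 'rV[R]_d) :=
  `[0, m%:R]%classic `*` ([set x | `|x| <= m%:R] `&` C).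
have cL m : compact (L m).
  apply: compact_setX; first exact: segment_compact.
  exact: (compact_closedI (@closed_ball_compact R d m%:R) cC).
have -> : [set p : R * 'rV[R]_d | [/\ 0 <= p.1, alive i p.2 (- p.1) &
     C (fl i (- p.1) p.2)]] = \bigcup_m (h @` L m).
  apply/seteqP; split => [[s x] /= [s0 sx Cx]|p].
    pose y := fl i (- s) x.
    pose m := (Num.truncn (Num.max s `|y|)).+1.
    have mm : Num.max s `|y| < m%:R by exact: truncnS_gt.
    exists m => //; exists (s, y).
      move: mm; rewrite gt_max => /andP[/ltW sm /ltW ym].
      by split => //; rewrite /= in_itv/= s0.
    rewrite /h /forward_flow/= max_l// /y (flowD HD)//; first by rewrite addrN (flow0 HD).
    by rewrite addrN; exact: (alive_ge0 HD).
  move=> [m _ [[s y] [/= sm [ym Cy]] <-]] /=.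
  rewrite in_itv/= in sm; have /andP[s0 _] := sm.
  rewrite /forward_flow/= max_l//.
  have asy := alive_ge0 HD i y s0.
  have back : alive i (fl i s y) (- s).
    by apply/(alive_flow HD) => //; rewrite addNr; exact: (alive_ge0 HD).
  split => //; rewrite (flowD HD)// addNr ?(flow0 HD)//.
  exact: (alive_ge0 HD).
apply: bigcupT_measurable => m; apply: closed_prod_measurable.
apply: compact_closed; first exact: norm_hausdorff.
apply: continuous_compact => //.
exact: continuous_subspaceT.
Qed.

Definition backward_domain i : set (R * 'rV[R]_d) :=
  [set p | 0 <= p.1 /\ alive i p.2 (- p.1)].

Lemma measurable_backward_domain i : measurable (backward_domain i).
Proof.
have := @backward_image_measurable i setT closedT.
by congr measurable; apply/seteqP; split => p [] //.
Qed.

Lemma measurable_backward_flow i :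
  measurable_fun (backward_domain i) (fun p => fl i (- p.1) p.2).
Proof.
apply: measurable_fun_to_rV; first exact: measurable_backward_domain.
move=> O oO.
have -> : backward_domain i `&` (fun p => fl i (- p.1) p.2) @^-1` O =
  backward_domain i `\` [set p : R * 'rV[R]_d | [/\ 0 <= p.1, alive i p.2 (- p.1) &
     (~` O) (fl i (- p.1) p.2)]].
  apply/seteqP; split => p [[p0 pa]].
    by move=> Op; split => // -[_ _]; exact.
  move=> nO; split => //; apply: contrapT => h; exact: nO.
apply: measurableD; first exact: measurable_backward_domain.
by apply: backward_image_measurable; rewrite closedC.
Qed.

(* The two half-lines of times are glued by reversing the sign of the second. *)
Definition alive_set i : set (R * 'rV[R]_d) := [set p | alive i p.2 p.1].

Lemma alive_setE i : alive_set i = [set p | 0 <= p.1] `|`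
  (fun p => (- p.1, p.2)) @^-1` backward_domain i.
Proof.
apply/seteqP; split => [[t x] /= h|[t x] [/= t0|[/= t0]]].
- case: (leP 0 t) => t0; first by left.
  by right; split => /=; rewrite ?opprK// oppr_ge0 ltW.
- exact: (alive_ge0 HD).
- by rewrite opprK.
Qed.

Let mneg : measurable_fun setT (fun p : R * 'rV[R]_d => (- p.1, p.2)).
Proof. by apply: measurable_fun_pair => //; apply: measurable_funN. Qed.

Let mnonneg : measurable [set p : R * 'rV[R]_d | 0 <= p.1].
Proof.
have := @measurable_fst _ _ R 'rV[R]_d.
move=> /(_ measurableT `[0, +oo[%classic); rewrite setTI => /(_ _).
have -> : fst @^-1` `[0, +oo[%classic = [set p : R * 'rV[R]_d | 0 <= p.1].
  by apply/seteqP; split => p /=; rewrite in_itv/= andbT.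
by apply.
Qed.

Lemma measurable_alive_set i : measurable (alive_set i).
Proof.
rewrite alive_setE; apply: measurableU => //.
rewrite -[X in measurable X]setTI; apply: mneg => //.
exact: measurable_backward_domain.
Qed.

Lemma measurable_flow i : measurable_fun (alive_set i) (fun p => fl i p.1 p.2).
Proof.
rewrite alive_setE; apply/measurable_funU => //.
  rewrite -[X in measurable X]setTI; apply: mneg => //.
  exact: measurable_backward_domain.
split.
  apply: (@eq_measurable_fun _ _ _ _ _ (forward_flow i)).
    by move=> p /set_mem /= p0; rewrite /forward_flow max_l.
  apply: measurable_funTS; apply: measurable_continuous_prod.
  exact: forward_flow_continuous.
apply: (@eq_measurable_fun _ _ _ _ _ ((fun p => fl i (- p.1) p.2) \o (fun p => (- p.1, p.2)))).
  by move=> p _ /=; rewrite opprK.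
apply: (measurable_comp (F := backward_domain i)).
- exact: measurable_backward_domain.
- by move=> _ [p hp <-].
- exact: measurable_backward_flow.
- exact: measurable_funTS.
Qed.

End flow_measurability.

(** * Tails of the clocks *)

(** The tail function is the complementary cumulative distribution function of
    this variable under the law of the clock. *)
Definition identity_variable (R : realType) : measurableTypeR R -> R := idfun.
HB.instance Definition _ (R : realType) :=
  @isMeasurableFun.Build _ _ _ _ (@identity_variable R) (@measurable_id _ _ setT).

Section tail.
Context (R : realType) (d n : nat) (D : switching_data R d n).
Hypothesis HD : standing_assumptions D.
Implicit Types (i : 'I_n.+1) (s t u : R).
Local Notation tail := (tail D).

Lemma tailE i t : (tail i t)%:E = ccdf (@identity_variable R : {RV (clock D i) >-> R}) t.
Proof.
rewrite /tail /ccdf /distribution /pushforward preimage_id fineK//.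
exact: fin_num_measure.
Qed.

Lemma tail_ge0 i t : 0 <= tail i t.
Proof. exact: fine_ge0. Qed.

Lemma tail_nonincreasing i s t : s <= t -> tail i t <= tail i s.
Proof. by move=> st; rewrite -lee_fin !tailE; exact: ccdf_nonincreasing. Qed.

Lemma measurable_tail i : measurable_fun setT (tail i).
Proof.
apply: nonincreasing_measurable => // s t; exact: tail_nonincreasing.
Qed.

Lemma tail_right_continuous i t u : u < tail i t ->
  exists2 delta, 0 < delta & u < tail i (t + delta).
Proof.
move=> ut; have h := @ccdf_right_continuous _ _ _ _ (@identity_variable R : {RV (clock D i) >-> R}) t.
have /h : nbhs (ccdf (@identity_variable R : {RV (clock D i) >-> R}) t) [set y | (u%:E < y)%E].
  apply: open_nbhs_nbhs; split; first exact: open_ereal_gt_ereal.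
  by rewrite /= -tailE lte_fin.
move=> [e /= e0 He]; exists (e / 2); first by rewrite divr_gt0.
rewrite -lte_fin tailE; apply: He => /=; last by rewrite ltrDl divr_gt0.
by rewrite opprD addNKr normrN gtr0_norm ?divr_gt0// ltr_pdivrMr// mulr_natr mulr2n ltrDl.
Qed.

Lemma tail0 i : tail i 0 = 1.
Proof.
have := clock_supp HD i; rewrite -(setU1itv false)// measureU//.
  by rewrite [X in (X + _ = _)%E -> _](clock_0 HD i) add0e /tail => ->.
by apply/seteqP; split => // x [/= ->]; rewrite in_itv/= ltxx.
Qed.

Lemma tail_vanish i u : 0 < u -> exists t, tail i t <= u.
Proof.
move=> u0; have h := @cvg_ccdfy0 _ _ _ _ (@identity_variable R : {RV (clock D i) >-> R}).
have /h[M [_ HM]] : nbhs (0 : \bar R)%E [set y | (y < u%:E)%E].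
  apply: open_nbhs_nbhs; split; first exact: open_ereal_lt_ereal.
  by rewrite /= lte_fin.
exists (M + 1); rewrite -lee_fin tailE ltW// HM//.
by rewrite ltrDl.
Qed.

(** Right-continuity of the tail makes tbar the end of the open interval of
    positivity. *)
Lemma lt_tbar i t : 0 <= t -> (t%:E < tbar D i)%E <-> 0 < tail i t.
Proof.
move=> t0; split => [tb|tl].
  rewrite lt_def tail_ge0 andbT; apply/eqP => tail_t.
  have : (tbar D i <= t%:E)%E by apply: ereal_inf_lbound; exists t.
  by rewrite leNgt tb.
have [delta d0 tld] := tail_right_continuous tl.
apply: (@lt_le_trans _ _ (t + delta)%:E); first by rewrite lte_fin ltrDl.
apply: le_ereal_inf_tmp => _ [s [s0 ts] <-]; rewrite lee_fin leNgt.
apply/negP => /ltW /(tail_nonincreasing i); rewrite ts.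
by rewrite leNgt tld.
Qed.

End tail.

(** * Hazard, survival and waiting times *)
Section hazard.
Context (R : realType) (d n : nat) (D : switching_data R d n).
Hypothesis HD : standing_assumptions D.
Implicit Types (z : state R d n) (i : 'I_n.+1) (r s t u : R).
Local Notation mu := (@lebesgue_measure R).
Local Notation alive := (alive D).

Lemma rate_lower : exists2 lo, 0 < lo & forall i x, lo <= rate D i x.
Proof.
have := rate_inf HD; set A := (X in ereal_inf X) => A0.
have H i x : (ereal_inf A <= (rate D i x)%:E)%E.
  by apply: ereal_inf_lbound; exists (x, i).
case E : (ereal_inf A) A0 H => [lo| |] // lo0 H; first by exists lo => // i x; rewrite -lee_fin.
by exists 1 => // i x; have := H i x; rewrite leye_eq.
Qed.

Lemma rate_upper : exists2 hi, 0 < hi & forall i x, rate D i x <= hi.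
Proof.
have := rate_sup HD; set A := (X in ereal_sup X) => A0.
have H i x : ((rate D i x)%:E <= ereal_sup A)%E.
  by apply: ereal_sup_ubound; exists (x, i).
case E : (ereal_sup A) A0 H => [hi| |] // _ H; last first.
  by exists 1 => // i x; have := H i x; rewrite leeNy_eq.
exists (Num.max hi 1); first by rewrite lt_max ltr01 orbT.
by move=> i x; rewrite le_max -lee_fin H.
Qed.

(** The part of the state space that does not involve the clock: there the
    hazard is the integral of the rate along an actual trajectory. *)
Definition ageable : set (state R d n) :=
  [set z | 0 <= age z /\ alive (mode z) (pos z) (- age z)].

Lemma state_spaceE z : state_space D z <->
  ageable z /\ ((hazard D z 0)%:E < tbar D (mode z))%E.
Proof.
rewrite /state_space /ageable /alive/= EFinN.
by rewrite lteN2; split => [[]|[[]]].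
Qed.

Definition rate_along z r := rate D (mode z) (flow D (mode z) r (pos z)).

Lemma rate_along_continuous z r : alive (mode z) (pos z) r ->
  {for r, continuous (rate_along z)}.
Proof.
move=> ar; apply: (@continuous_comp _ _ _ (fun s => flow D (mode z) s (pos z))).
  exact: flow_continuous_time.
exact: (rate_continuous HD).
Qed.

Lemma rate_along_within z a b : alive (mode z) (pos z) a ->
  {within `[a, b], continuous (rate_along z)}.
Proof.
move=> aa; apply: continuous_in_subspaceT => r; rewrite inE/= in_itv/= => /andP[ar _].
exact: rate_along_continuous (alive_up aa ar).
Qed.

Lemma rate_along_integrable z a b : alive (mode z) (pos z) a ->
  mu.-integrable `[a, b] (EFin \o rate_along z).
Proof.
move=> aa; apply: continuous_compact_integrable; first exact: segment_compact.
exact: rate_along_within.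
Qed.

Lemma hazard_increment z s t lo hi :
  (forall i x, lo <= rate D i x) -> (forall i x, rate D i x <= hi) ->
  ageable z -> - age z <= s -> s <= t ->
  lo * (t - s) <= hazard D z t - hazard D z s <= hi * (t - s).
Proof.
move=> Hlo Hhi [a0 az] as_ st.
have iz := rate_along_integrable t az.
rewrite /hazard (@Rintegral_itvB R (rate_along z) (BLeft (- age z)) (BRight t) s iz); last 2 first.
- by rewrite bnd_simp.
- by rewrite bnd_simp.
have mI : measurable (`]s, t]%classic : set R) by [].
have iz' : mu.-integrable `]s, t] (EFin \o rate_along z).
  apply: integrableS iz => //; apply: subset_itv; by rewrite bnd_simp.
have finI : (mu `]s, t]%classic < +oo)%E.
  by rewrite lebesgue_measure_itv/=; case: ifP => // _; rewrite -EFinB ltry.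
have ic (c : R) : mu.-integrable `]s, t] (EFin \o (fun=> c)).
  apply: measurable_bounded_integrable => //; exact: bounded_cst.
have lenE : fine (mu `]s, t]%classic) = t - s.
  rewrite lebesgue_measure_itv/= lte_fin; case: ltP => [//|ts]/=.
  by apply/eqP; rewrite eq_sym subr_eq0 eq_le ts st.
apply/andP; split.
  rewrite -lenE -(@Rintegral_cst _ _ _ mu `]s, t]%classic mI lo).
  by apply: le_Rintegral => // r _; exact: Hlo.
rewrite -lenE -(@Rintegral_cst _ _ _ mu `]s, t]%classic mI hi).
by apply: le_Rintegral => // r _; exact: Hhi.
Qed.

Lemma hazard_age0 z : hazard D z (- age z) = 0.
Proof. by rewrite /hazard set_itv1 Rintegral_set1. Qed.

Lemma drift_ageable z r : ageable z -> 0 <= r -> ageable (drift D z r).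
Proof.
move=> [a0 az] r0; split; rewrite /age/= ?addr_ge0//.
rewrite /mode/pos/=; apply/(alive_flow HD); first exact: alive_ge0.
by rewrite opprD subrK.
Qed.

(** Both integrals run over the same stretch of the trajectory, whose origin of
    time is moved by r. *)
Lemma hazard_drift z r t : ageable z -> 0 <= r -> 0 <= t ->
  hazard D (drift D z r) t = hazard D z (r + t).
Proof.
move=> [a0 az] r0 t0; rewrite /hazard /Rintegral; congr fine.
rewrite {1}/age/= /mode/= /pos/=.
set i := z.2; set x := z.1.1.
transitivity (\int[mu]_(q in `[(- (age z + r))%R, t]) (rate_along z (q + r)%R)%:E)%E.
  apply: eq_integral => q; rewrite inE/= in_itv/= => /andP[aq _].
  rewrite /rate_along (flowD HD)//; first exact: alive_ge0.
  by apply: alive_up az _; rewrite -lerBlDr -opprD.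
pose F (q : R) := q + r.
have F'E : derive1 F = cst 1.
  apply/funext => q; rewrite derive1E.
  by have := is_derive_shift q 1 r => -[_ ->].
have -> : (`[- age z, r + t] = `[F (- (age z + r)), F t])%classic.
  by rewrite /F opprD subrK [r + t]addrC.
rewrite (@integration_by_substitution_increasing R F (rate_along z)).
- by apply: eq_integral => q _; rewrite F'E /= mulr1.
- by rewrite (le_trans _ t0)// oppr_le0 addr_ge0.
- by move=> p q _ _; rewrite /F ltrD2r.
- by rewrite F'E => q _; exact: cvg_cst.
- by rewrite F'E; exact: is_cvg_cst.
- by rewrite F'E; exact: is_cvg_cst.
- split.
  + by move=> q _; by case: (is_derive_shift q 1 r).
  + apply: cvg_at_right_filter; apply: cvgD; [exact: cvg_id|exact: cvg_cst].
  + apply: cvg_at_left_filter; apply: cvgD; [exact: cvg_id|exact: cvg_cst].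
- by apply: rate_along_within; rewrite /F opprD subrK.
Qed.

Lemma survivalE z t : survival D z t =
  tail D (mode z) (hazard D z t) / tail D (mode z) (hazard D z 0).
Proof. by []. Qed.

Lemma hazard_ge0 z t : 0 <= hazard D z t.
Proof. by apply: Rintegral_ge0 => r _; exact: (rate_ge0 HD). Qed.

Lemma hazard_le z s t : ageable z -> - age z <= s -> s <= t ->
  hazard D z s <= hazard D z t.
Proof.
move=> az as_ st; have [lo lo0 Hlo] := rate_lower; have [hi _ Hhi] := rate_upper.
have /andP[h _] := hazard_increment Hlo Hhi az as_ st.
by rewrite -subr_ge0 (le_trans _ h)// mulr_ge0 ?subr_ge0// ltW.
Qed.

Section waiting.
Variable z : state R d n.
Hypothesis Kz : state_space D z.

Let az : ageable z. Proof. by have [] := (state_spaceE z).1 Kz. Qed.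

Let ltr_age t : 0 <= t -> - age z <= t.
Proof. by move=> t0; rewrite (le_trans _ t0)// oppr_le0; case: az. Qed.

Lemma tail_hazard0_gt0 : 0 < tail D (mode z) (hazard D z 0).
Proof.
have [_ h] := (state_spaceE z).1 Kz.
by apply/lt_tbar => //; exact: hazard_ge0.
Qed.
Let T0 := tail_hazard0_gt0.

Lemma survival_nonincreasing s t : 0 <= s -> s <= t ->
  survival D z t <= survival D z s.
Proof.
move=> s0 st; rewrite !survivalE ler_pM2r ?invr_gt0//.
by apply: tail_nonincreasing => //; apply: hazard_le => //; exact: ltr_age.
Qed.

Lemma survival0 : survival D z 0 = 1.
Proof. by rewrite survivalE divff// gt_eqF. Qed.

(** The hazard is Lipschitz in time and the tail is right-continuous. *)
Lemma survival_right_continuous t u : 0 <= t -> u < survival D z t ->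
  exists2 delta, 0 < delta & u < survival D z (t + delta).
Proof.
move=> t0; rewrite survivalE ltr_pdivlMr// => h.
have [e e0 He] := tail_right_continuous h.
have [lo _ Hlo] := rate_lower; have [hi hi0 Hhi] := rate_upper.
exists (e / hi); first by rewrite divr_gt0.
rewrite survivalE ltr_pdivlMr// (lt_le_trans He)//.
apply: tail_nonincreasing => //.
have tt : t <= t + e / hi by rewrite lerDl divr_ge0// ltW.
have /andP[_] := hazard_increment Hlo Hhi az (ltr_age t0) tt.
by rewrite [t + _ - t]addrAC subrr add0r mulrCA divff ?gt_eqF// mulr1 lerBlDl.
Qed.

(** The hazard grows at least linearly, so it reaches any level of the tail. *)
Lemma survival_vanish u : 0 < u -> exists2 t, 0 <= t & survival D z t <= u.
Proof.
move=> u0; have [t0 Ht0] := tail_vanish D (mode z) (mulr_gt0 u0 T0).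
have [lo lo0 Hlo] := rate_lower; have [hi hi0 Hhi] := rate_upper.
pose t := Num.max 0 t0 / lo.
have t00 : 0 <= t by apply: divr_ge0; [rewrite le_max lexx|exact: ltW].
exists t => //; rewrite survivalE ler_pdivrMr// (le_trans _ Ht0)//.
apply: tail_nonincreasing => //.
have /andP[h _] := hazard_increment Hlo Hhi az (ltr_age (lexx 0)) t00.
move: h; rewrite subr0 /t mulrCA divff ?gt_eqF// mulr1 => h.
apply: (le_trans (y := Num.max 0 t0)); first by rewrite le_max lexx orbT.
by have := hazard_ge0 z 0; lra.
Qed.

Let A u := [set r : R | 0 <= r /\ survival D z r <= u].

Lemma waiting_ge0 u : 0 < u -> 0 <= waiting D z u.
Proof.
move=> u0; have [t t0 ht] := survival_vanish u0.
by apply: lb_le_inf => [|r []//]; exists t.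
Qed.

(** The waiting time is the generalised inverse of the survival function, which
    is nonincreasing and right-continuous with limit 0. *)
Lemma lt_waiting t u : 0 <= t -> 0 < u -> (t < waiting D z u) = (u < survival D z t).
Proof.
move=> t0 u0; apply/idP/idP => h.
  rewrite ltNge; apply/negP => hu; move: h; apply/negP; rewrite -leNgt.
  by apply: ge_inf => //; exists 0 => r [].
have [delta d0 hd] := survival_right_continuous t0 h.
apply: (@lt_le_trans _ _ (t + delta)); first by rewrite ltrDl.
have [t1 t10 ht1] := survival_vanish u0.
apply: lb_le_inf; first by exists t1.
move=> r [r0 hr]; rewrite leNgt; apply/negP => rt.
by have := le_lt_trans hr hd; rewrite ltNge survival_nonincreasing// ltW.
Qed.

End waiting.
End hazard.

(** * Total measurable versions of the data *)
Section by_mode.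
Context (n : nat).
Lemma measurable_by_mode d1 d2 (T : measurableType d1) (U : measurableType d2)
    (m : T -> 'I_n.+1) (f : 'I_n.+1 -> T -> U) :
  measurable_fun setT m -> (forall i, measurable_fun setT (f i)) ->
  measurable_fun setT (fun x => f (m x) x).
Proof.
move=> mm mf.
pose E (k : nat) := [set x : T | val (m x) = k].
have mE k : measurable (E k).
  have := mm measurableT [set i : 'I_n.+1 | val i = k] I.
  by rewrite setTI.
have -> : [set: T] = \bigcup_k E k by apply/seteqP; split => // x _; exists (val (m x)).
apply/measurable_fun_bigcup => // k.
case: (pselect (exists i : 'I_n.+1, val i = k)) => [[i ik]|nk]; last first.
  rewrite (_ : E k = set0); first exact: measurable_fun_set0.
  by apply/seteqP; split => // x Ex; apply: nk; exists (m x).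
apply: (@eq_measurable_fun _ _ _ _ _ (f i)).
  by move=> x /set_mem Ex; congr (f _ x); apply: val_inj; exact: etrans ik (esym Ex).
exact: measurable_funTS.
Qed.

Lemma measurable_to_mode d1 (T : measurableType d1) (f : T -> 'I_n.+1) :
  (forall k, measurable (f @^-1` [set k])) -> measurable_fun setT f.
Proof.
move=> mf _ B _; rewrite setTI.
have -> : f @^-1` B = \bigcup_(k in B) (f @^-1` [set k]).
  by apply/seteqP; split => x; [move=> Bx; exists (f x)|move=> [k Bk /= ->]].
by apply: fin_bigcup_measurable => //; exact: finite_finset.
Qed.
End by_mode.

Section measurability.
Context (R : realType) (d n : nat) (D : switching_data R d n).
Hypothesis HD : standing_assumptions D.
Implicit Types (z : state R d n) (i j : 'I_n.+1) (r s t u : R).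
Local Notation mu := (@lebesgue_measure R).
Local Notation alive := (alive D).
Local Notation S := (state R d n).

Lemma measurable_mode : measurable_fun setT (@mode R d n).
Proof. exact: measurable_snd. Qed.
Lemma measurable_pos : measurable_fun setT (@pos R d n).
Proof. exact: (measurableT_comp measurable_fst measurable_fst). Qed.
Lemma measurable_age : measurable_fun setT (@age R d n).
Proof. exact: (measurableT_comp measurable_snd measurable_fst). Qed.

Lemma measurable_ageable : measurable (ageable D : set S).
Proof.
have -> : ageable D = \bigcup_i ((@mode R d n) @^-1` [set i] `&`
   ((@age R d n) @^-1` `[0, +oo[%classic `&` (fun z : S => (- age z, pos z)) @^-1` alive_set D i)).
  apply/seteqP; split => z /=.
    move=> [a0 az]; exists (mode z) => //; split => //; split => //.
    by rewrite /= in_itv/= a0.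
  by move=> [i _ [/= <- []]]; rewrite /= in_itv/= andbT.
apply: fin_bigcup_measurable => // i _; apply: measurableI.
  by rewrite -[X in measurable X]setTI; exact: measurable_mode.
apply: measurableI; rewrite -[X in measurable X]setTI.
  exact: measurable_age.
have h : measurable_fun setT (fun z : S => (- age z, pos z)).
  by apply: measurable_fun_pair; [apply: measurable_funN; exact: measurable_age|exact: measurable_pos].
by apply: h => //; exact: (measurable_alive_set HD).
Qed.

Definition rate_patch i : R * 'rV[R]_d -> R :=
  (fun q => rate D i (flow D i q.1 q.2)) \_ (alive_set D i).

Lemma measurable_rate_patch i : measurable_fun setT (rate_patch i).
Proof.
apply/(measurable_restrictT _ (measurable_alive_set HD i)).
apply: measurableT_comp; last exact: measurable_flow.
by apply: measurable_continuous_real; exact: (rate_continuous HD).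
Qed.

Lemma rate_patch_ge0 i q : 0 <= rate_patch i q.
Proof. by rewrite /rate_patch patchE; case: ifP => // _; exact: (rate_ge0 HD). Qed.

Definition hazard_integrand (p : S * R) (r : measurableTypeR R) : R :=
  if (- age p.1 <= r) && (r <= p.2) then rate_patch (mode p.1) (r, pos p.1) else 0.

Definition total_hazard (p : S * R) : R :=
  fine (\int[mu]_r (hazard_integrand p r)%:E)%E.

Lemma hazard_total z t : ageable D z -> hazard D z t = total_hazard (z, t).
Proof.
move=> [a0 az]; rewrite /hazard /Rintegral; congr fine.
rewrite integral_mkcond; apply: eq_integral => r _.
rewrite /hazard_integrand patchE mem_setE in_itv/=.
case: ifPn => // /andP[ar rt]; rewrite /rate_patch patchE mem_set//.
exact: alive_up az ar.
Qed.

(** The hazard is a partial integral of a function jointly measurable in state,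
    bound and time. *)
Lemma measurable_total_hazard : measurable_fun setT total_hazard.
Proof.
apply: (measurableT_comp (fine_measurable measurableT)).
apply: (measurable_fun_fubini_tonelli_F (m2 := mu)
  (fun q : (S * R) * measurableTypeR R => (hazard_integrand q.1 q.2)%:E)); last first.
  by move=> q; rewrite lee_fin /hazard_integrand; case: ifP => // _; exact: rate_patch_ge0.
apply/measurable_EFinP.
have mr : measurable_fun setT (fun q : (S * R) * measurableTypeR R => q.2 : R) by exact: measurable_snd.
have mst (f : S -> R) : measurable_fun setT f ->
    measurable_fun setT (fun q : (S * R) * measurableTypeR R => f q.1.1).
  move=> mf; apply: (measurableT_comp mf).
  exact: (measurableT_comp measurable_fst measurable_fst).
apply: measurable_fun_ifT => //.
- apply: measurable_and.
    by apply: measurable_fun_ler => //; apply: measurable_funN; apply: mst; exact: measurable_age.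
  by apply: measurable_fun_ler => //; exact: (measurableT_comp measurable_snd measurable_fst).
- apply: (@measurable_by_mode n _ _ _ _ (fun q : (S * R) * measurableTypeR R => mode q.1.1)
    (fun i q => rate_patch i (q.2, pos q.1.1))).
    apply: (measurableT_comp measurable_mode).
    exact: (measurableT_comp measurable_fst measurable_fst).
  move=> i; apply: (measurableT_comp (measurable_rate_patch i)).
  apply: measurable_fun_pair => //; apply: (measurableT_comp measurable_pos).
  exact: (measurableT_comp measurable_fst measurable_fst).
Qed.

Definition total_tail (p : S * R) : R := tail D (mode p.1) (total_hazard p).

Lemma measurable_total_tail : measurable_fun setT total_tail.
Proof.
apply: (@measurable_by_mode n _ _ _ _ (fun p : S * R => mode p.1) (fun i p => tail D i (total_hazard p))).
  exact: (measurableT_comp measurable_mode).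
by move=> i; apply: (measurableT_comp (measurable_tail D i)); exact: measurable_total_hazard.
Qed.

Lemma measurable_state_space : measurable (state_space D).
Proof.
have -> : state_space D = ageable D `&` [set z | 0 < total_tail (z, 0)].
  apply/seteqP; split => z.
    move/state_spaceE => [az hz]; split => //=.
    rewrite /total_tail -hazard_total//; apply/lt_tbar => //.
    exact: hazard_ge0.
  move=> [az hz]; apply/state_spaceE; split => //.
  by apply/lt_tbar; [exact: hazard_ge0|rewrite hazard_total].
apply: measurableI; first exact: measurable_ageable.
have h : measurable_fun setT (fun z : S => 0 < total_tail (z, 0)).
  apply: measurable_fun_ltr => //; apply: (measurableT_comp measurable_total_tail).
  exact: measurable_fun_pair.
by have := h measurableT [set true] I; rewrite setTI.
Qed.

Definition total_survival : S * R -> R :=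
  (fun p => survival D p.1 p.2) \_ (ageable D `*` setT).

Lemma measurable_total_survival : measurable_fun setT total_survival.
Proof.
have mA : measurable (ageable D `*` setT : set (S * R)).
  by apply: measurableX => //; exact: measurable_ageable.
apply/(measurable_restrictT _ mA).
apply: (@eq_measurable_fun _ _ _ _ _ (fun p => total_tail p * (total_tail (p.1, 0) `^ (-1)))).
  move=> [z t] /set_mem [/= az _]; rewrite /survival !hazard_total//.
  by rewrite powR_inv1 ?tail_ge0.
apply: measurable_funTS; apply: measurable_funM; first exact: measurable_total_tail.
have hV : measurable_fun setT (fun x : R => x `^ (-1)) by exact: measurable_powR.
apply: (measurableT_comp hV).
apply: (measurableT_comp measurable_total_tail).
exact: measurable_fun_pair.
Qed.

Lemma total_survivalE z t : state_space D z -> total_survival (z, t) = survival D z t.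
Proof.
move=> /state_spaceE[az _]; rewrite /total_survival patchE mem_set//.
Qed.

(** Outside the state space the infimum defining the waiting time has no control;
    0 keeps jump times nondecreasing for every driving sequence. *)
Definition total_waiting (p : S * R) : R :=
  if pselect (state_space D p.1 /\ unit_range p.2) is left _ then waiting D p.1 p.2 else 0.

Lemma total_waitingE z u : state_space D z -> unit_range u ->
  total_waiting (z, u) = waiting D z u.
Proof. by move=> Kz ru; rewrite /total_waiting; case: pselect => // -[]. Qed.

Lemma total_waiting_ge0 p : 0 <= total_waiting p.
Proof.
rewrite /total_waiting; case: pselect => // -[Kz /andP[u0 _]].
exact: waiting_ge0.
Qed.

Lemma measurable_total_waiting : measurable_fun setT total_waiting.
Proof.
apply: (measurability (@RGenOInfty.G R)); first exact: RGenOInfty.measurableE.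
move=> _ [_ [t ->] <-]; rewrite setTI.
case: (leP 0 t) => t0; last first.
  rewrite (_ : _ @^-1` _ = setT)//; apply/seteqP; split => // p _ /=.
  by rewrite in_itv/= andbT (lt_le_trans t0)// total_waiting_ge0.
have -> : total_waiting @^-1` `]t, +oo[%classic =
   (state_space D `*` `]0, 1]%classic) `&` [set p : S * R | p.2 < total_survival (p.1, t)].
  apply/seteqP; split => -[z u] /=; rewrite !in_itv/= andbT.
    rewrite /total_waiting; case: pselect => [[/= Kz ru]|_]; last by rewrite ltNge t0.
    have /andP[u0 _] := ru.
    by rewrite (lt_waiting HD)// total_survivalE.
  move=> [[Kz ru]]; rewrite total_survivalE// total_waitingE//.
  by have /andP[u0 _] := ru; rewrite (lt_waiting HD).
apply: measurableI.
  by apply: measurableX => //; exact: measurable_state_space.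
have h : measurable_fun setT (fun p : S * R => p.2 < total_survival (p.1, t)).
  apply: measurable_fun_ltr => //; apply: (measurableT_comp measurable_total_survival).
  exact: measurable_fun_pair.
by have := h measurableT [set true] I; rewrite setTI.
Qed.

Definition total_drift (p : S * R) : S :=
  (forward_flow D (mode p.1) (p.2, pos p.1), age p.1 + p.2, mode p.1).

Lemma total_driftE z t : 0 <= t -> total_drift (z, t) = drift D z t.
Proof. by move=> t0; rewrite /total_drift /drift /forward_flow/= max_l. Qed.

Lemma measurable_forward i d1 (T : measurableType d1) (f : T -> R) (g : T -> 'rV[R]_d) :
  measurable_fun setT f -> measurable_fun setT g ->
  measurable_fun setT (fun x => forward_flow D i (f x, g x)).
Proof.
move=> mf mg.
have h : measurable_fun setT (forward_flow D i).
  by apply: measurable_continuous_prod; exact: forward_flow_continuous.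
by apply: (measurableT_comp h); exact: measurable_fun_pair.
Qed.

Lemma measurable_total_drift : measurable_fun setT total_drift.
Proof.
have m1 := measurableT_comp measurable_pos (@measurable_fst _ _ S R).
have m2 := measurableT_comp measurable_mode (@measurable_fst _ _ S R).
apply: measurable_fun_pair => //; apply: measurable_fun_pair.
  apply: (@measurable_by_mode n _ _ _ _ (fun p : S * R => mode p.1)
    (fun i p => forward_flow D i (p.2, pos p.1))) => // i.
  exact: measurable_forward.
by apply: measurable_funD => //; exact: (measurableT_comp measurable_age).
Qed.

(** The selected mode is a function of the finitely many truth values telling
    which modes satisfy the selection inequalities. *)
Lemma measurable_next_mode d1 (T : measurableType d1) (i : 'I_n.+1)
    (f : T -> 'rV[R]_d) (g : T -> R) :
  measurable_fun setT f -> measurable_fun setT g ->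
  measurable_fun setT (fun x => next_mode D i (f x) (g x)).
Proof.
move=> mf mg.
have mq l : measurable_fun setT (fun x => trans D (f x) i l).
  have h : measurable_fun setT (fun y => trans D y i l).
    apply: measurable_continuous_real => y.
    apply: (@continuous_comp _ _ _ (trans D) (fun M : 'M[R]_n.+1 => M i l)).
      exact: (trans_continuous HD).
    exact: coord_continuous.
  exact: (measurableT_comp h).
pose hit x (j : 'I_n.+1) := \sum_(l < n.+1 | (l < j)%N) trans D (f x) i l < g x
      <= \sum_(l < n.+1 | (l <= j)%N) trans D (f x) i l.
have mhit j : measurable_fun setT (hit^~ j).
  have ms (Q : pred 'I_n.+1) : measurable_fun setT (fun x => \sum_(l < n.+1 | Q l) trans D (f x) i l).
    under eq_fun do rewrite big_mkcond.
    apply: measurable_sum => l; case: (Q l) => //.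
  by apply: measurable_and; [exact: measurable_fun_ltr|exact: measurable_fun_ler].
pose select (b : {ffun 'I_n.+1 -> bool}) := odflt i [pick j | b j].
apply: measurable_to_mode => k.
have -> : (fun x => next_mode D i (f x) (g x)) @^-1` [set k] =
  \bigcup_(b in [set b | select b = k]) \bigcap_(j in [set: 'I_n.+1]) ((hit^~ j) @^-1` [set b j]).
  apply/seteqP; split => x /=.
    move=> nx; exists [ffun j => hit x j] => /=; last by move=> j _; rewrite /= ffunE.
    by rewrite -nx /select /next_mode; congr (odflt _ _); apply: eq_pick => j; rewrite ffunE.
  move=> [b /= <- Hb]; rewrite /select /next_mode; congr (odflt _ _).
  by apply: eq_pick => j; have := Hb j I => /=.
apply: fin_bigcup_measurable; first exact: finite_finset.
move=> b _; apply: fin_bigcap_measurable => // j _.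
by rewrite -[X in measurable X]setTI; exact: mhit.
Qed.

Definition total_jump (p : S * R * R) : S :=
  let y := forward_flow D (mode p.1.1) (total_waiting p.1, pos p.1.1) in
  (y, 0, next_mode D (mode p.1.1) y p.2).

Lemma total_jumpE z u v : state_space D z -> unit_range u ->
  total_jump (z, u, v) = jump D z u v.
Proof.
move=> Kz ru; rewrite /total_jump /jump total_waitingE// /forward_flow/= max_l//.
by rewrite -total_waitingE// total_waiting_ge0.
Qed.

Lemma measurable_total_jump : measurable_fun setT total_jump.
Proof.
have m1 := @measurable_fst _ _ (S * R)%type R.
have mm : measurable_fun setT (fun p : S * R * R => mode p.1.1).
  exact: (measurableT_comp measurable_mode (measurableT_comp measurable_fst m1)).
have mp : measurable_fun setT (fun p : S * R * R => pos p.1.1).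
  exact: (measurableT_comp measurable_pos (measurableT_comp measurable_fst m1)).
have mw : measurable_fun setT (fun p : S * R * R => total_waiting p.1).
  exact: (measurableT_comp measurable_total_waiting m1).
have my i : measurable_fun setT (fun p : S * R * R => forward_flow D i (total_waiting p.1, pos p.1.1)).
  exact: measurable_forward.
apply: measurable_fun_pair.
  apply: measurable_fun_pair => //.
  exact: (@measurable_by_mode n _ _ _ _ (fun p : S * R * R => mode p.1.1)
    (fun i p => forward_flow D i (total_waiting p.1, pos p.1.1))).
apply: (@measurable_by_mode n _ _ _ _ (fun p : S * R * R => mode p.1.1)
    (fun i p => next_mode D i (forward_flow D i (total_waiting p.1, pos p.1.1)) p.2)) => // i.
by apply: measurable_next_mode.
Qed.

End measurability.

(** * The switching process *)
Section instance.
Context (R : realType) (d n : nat) (D : switching_data R d n).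
Hypothesis HD : standing_assumptions D.
Implicit Types (z : state R d n) (i j : 'I_n.+1) (r s t u v : R).
Local Notation S := (state R d n).
Local Notation K := (state_space D).

(** Multiplicativity of survival along the drift: the common factor is the tail
    at the hazard reached at s. *)
Lemma survival_drift z s t : K z -> 0 <= s -> 0 <= t -> 0 < survival D z s ->
  survival D (drift D z s) t * survival D z s = survival D z (s + t).
Proof.
move=> Kz s0 t0 ss; have [az _] := (state_spaceE D z).1 Kz.
have T0 := tail_hazard0_gt0 HD Kz.
have Ts : 0 < tail D (mode z) (hazard D z s).
  by move: ss; rewrite /survival pmulr_lgt0// invr_gt0.
rewrite /survival !(hazard_drift HD)// addr0 /mode/= -/(mode z).
by rewrite mulrA divfK// gt_eqF.
Qed.

Lemma drift_state_space z t : K z -> 0 <= t -> 0 < survival D z t -> K (drift D z t).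
Proof.
move=> Kz t0 st; have [az _] := (state_spaceE D z).1 Kz.
have T0 := tail_hazard0_gt0 HD Kz.
apply/state_spaceE; split; first exact: drift_ageable.
apply/lt_tbar; first exact: hazard_ge0.
rewrite (hazard_drift HD)// addr0 /mode/= -/(mode z).
by move: st; rewrite /survival pmulr_lgt0// invr_gt0.
Qed.

Lemma fresh_state_space (x : 'rV[R]_d) i : K (x, 0, i).
Proof.
apply/state_spaceE; split.
  by split; rewrite /age/= ?oppr0//; exact: alive_ge0.
apply/lt_tbar; first exact: hazard_ge0.
have := hazard_age0 D (x, 0, i); rewrite /age/= oppr0 => ->.
by rewrite /mode/= (tail0 HD).
Qed.

(** Both sides are nonnegative and exceed the same times t >= 0, by
    [lt_waiting] and [survival_drift]. *)
Lemma waiting_drift z s u : K z -> 0 <= s -> 0 < u -> u < survival D z s ->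
  waiting D (drift D z s) (u / survival D z s) = waiting D z u - s.
Proof.
move=> Kz s0 u0 us; set g := survival D z s in us *.
have g0 : 0 < g by exact: lt_trans us.
have Kd : K (drift D z s) by exact: drift_state_space.
have ug0 : 0 < u / g by rewrite divr_gt0.
have same t : 0 <= t -> (t < waiting D (drift D z s) (u / g)) = (t < waiting D z u - s).
  move=> t0; rewrite (lt_waiting HD)// ltr_pdivrMr// survival_drift//.
  by rewrite -(lt_waiting HD)// ?addr_ge0// ltrBrDl.
have a0 : 0 <= waiting D (drift D z s) (u / g) by exact: waiting_ge0.
have b0 : 0 <= waiting D z u - s by rewrite subr_ge0 ltW// (lt_waiting HD).
apply/eqP; rewrite eq_le; apply/andP; split; rewrite leNgt; apply/negP => h.
  by move: h; rewrite same// ltxx.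
by move: h; rewrite -same// ltxx.
Qed.

(** A wait from age zero starts with hazard 0, where every tail is 1, and the
    hazard grows at a bounded rate; so there is a time before which each tail
    stays above 1/2. *)
Lemma fresh_waiting : exists2 delta, 0 < delta & forall (x : 'rV[R]_d) i u,
  0 < u -> u < 2^-1 -> delta <= waiting D (x, 0, i) u.
Proof.
have /choice[e He] : forall i, exists e, 0 < e /\ 2^-1 < tail D i e.
  move=> i; have h1 : (2^-1 : R) < tail D i 0.
    by rewrite (tail0 HD) invf_lt1// ltr1n.
  by have [e e0] := tail_right_continuous h1; rewrite add0r => h2; exists e.
have [lo _ Hlo] := rate_lower HD; have [hi hi0 Hhi] := rate_upper HD.
pose m := \big[Num.min/1]_i e i.
have m0 : 0 < m by apply: lt_bigmin => // i _; case: (He i).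
have mi i : m <= e i by exact: bigmin_le_cond.
have delta0 : 0 < m / hi by rewrite divr_gt0.
exists (m / hi) => // x i u u0 u2; apply: ltW.
have Kz := fresh_state_space x i; set z := (x, 0, i) in Kz *.
rewrite (lt_waiting HD)//; last exact: ltW.
have [az _] := (state_spaceE D z).1 Kz.
have h0 : hazard D z 0 = 0.
  by have := hazard_age0 D z; rewrite /age/= oppr0.
have age0 : - age z <= 0 by rewrite /age/= oppr0.
have /andP[_] := hazard_increment HD Hlo Hhi az age0 (ltW delta0).
rewrite h0 !subr0 mulrCA divff ?gt_eqF// mulr1 => hm.
rewrite /survival h0 (tail0 HD) divr1 (lt_trans u2)//.
have [_ h] := He i; apply: lt_le_trans h _.
by apply: tail_nonincreasing; exact: le_trans hm (mi i).
Qed.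

Let G z t := total_survival D (z, t).
Let W z u := total_waiting D (z, u).
Let J z u v := total_jump D (z, u, v).
Let dr z t := total_drift D (z, t).

Lemma switching_dynamics : renewal_dynamics K dr G W J.
Proof.
have GE z t : K z -> G z t = survival D z t by exact: total_survivalE.
have WE z u : K z -> unit_range u -> W z u = waiting D z u by exact: total_waitingE.
have unitG z s u : K z -> 0 <= s -> unit_range u -> u < survival D z s ->
    unit_range (u / survival D z s).
  move=> Kz s0 /andP[u0 _] us; have g0 := lt_trans u0 us.
  by rewrite /unit_range divr_gt0//= ler_pdivrMr// mul1r ltW.
split.
- exact: measurable_state_space.
- by rewrite /dr; under eq_fun do rewrite -surjective_pairing; exact: measurable_total_drift.
- by rewrite /G; under eq_fun do rewrite -surjective_pairing; exact: measurable_total_survival.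
- by rewrite /W; under eq_fun do rewrite -surjective_pairing; exact: measurable_total_waiting.
- by rewrite /J; under eq_fun do rewrite -!surjective_pairing; exact: measurable_total_jump.
- by move=> z u; exact: total_waiting_ge0.
- move=> z t Kz t0; rewrite GE// -(survival0 HD Kz).
  exact: survival_nonincreasing.
- by move=> z Kz; rewrite GE// (survival0 HD).
- move=> z u t Kz ru t0; rewrite GE// WE//; have /andP[u0 _] := ru.
  exact: lt_waiting.
- by move=> z t Kz t0; rewrite GE// /dr total_driftE//; exact: drift_state_space.
- by move=> z _; rewrite /dr total_driftE// /drift (flow0 HD) addr0; case: z => -[].
- move=> z s t Kz s0 _ t0; rewrite /dr !total_driftE ?addr_ge0// /drift /pos/age/mode/=.
  rewrite (flowD HD) ?[t + s]addrC ?addrA//; apply: alive_ge0 => //; exact: addr_ge0.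
- by move=> z u v Kz ru _; rewrite /J total_jumpE//; exact: fresh_state_space.
- move=> z s u Kz s0 ru; rewrite GE// => us; have /andP[u0 _] := ru.
  have gs := lt_trans u0 us.
  rewrite /dr total_driftE// WE//; last exact: unitG.
    by rewrite waiting_drift// WE.
  exact: drift_state_space.
- move=> z s u v Kz s0 ru rv; rewrite GE// => us; have /andP[u0 _] := ru.
  have gs := lt_trans u0 us.
  rewrite /dr total_driftE// /J !total_jumpE//; last exact: unitG.
    rewrite /jump waiting_drift// /drift /pos/mode/=.
    have w0 : 0 <= waiting D z u by exact: waiting_ge0.
    have -> : flow D z.2 (waiting D z u - s) (flow D z.2 s z.1.1) =
        flow D z.2 (waiting D z u) z.1.1; last by [].
      rewrite (flowD HD) ?subrK//; first exact: alive_ge0.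
      exact: alive_ge0.
  exact: drift_state_space.
- have [delta d0 Hd] := fresh_waiting; exists delta => // z u v u' Kz ru rv ru' u2.
  rewrite /J total_jumpE// WE//; last exact: fresh_state_space.
  by apply: Hd => //; case/andP: ru'.
Qed.

(** Finitely many real functions that generate the sigma-algebra of states and
    are right-continuous along the drift. *)
Definition observable (k : 'I_d + bool) (z : S) : R :=
  match k with
  | inl j => pos z ord0 j
  | inr true => age z
  | inr false => (mode z : nat)%:R
  end.

Lemma measurable_observable k : measurable_fun setT (observable k).
Proof.
case: k => [j|[]]; rewrite /observable.
- exact: (measurableT_comp (measurable_coordinate j) (@measurable_pos R d n)).
- exact: measurable_age.
- have h : measurable_fun setT (fun i : 'I_n.+1 => (i : nat)%:R : R) by [].
  exact: (measurableT_comp h (@measurable_mode R d n)).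
Qed.

Lemma observable_generate : @measurable _ S =
  <<s \bigcup_k preimage_set_system setT (observable k) measurable >>.
Proof.
set gens := \bigcup_k _.
apply/seteqP; split; last first.
  apply: smallest_sub; first exact: sigma_algebra_measurable.
  by move=> _ [k _ [B mB <-]]; exact: measurable_observable.
pose T := g_sigma_algebraType gens.
have mobs k : measurable_fun (setT : set T) (observable k).
  by move=> _ B mB; apply: sub_sigma_algebra; exists k => //; exists B.
have mid : measurable_fun (setT : set T) (fun z : T => (pos z, age z, mode z) : S).
  apply: measurable_fun_pair; first apply: measurable_fun_pair.
  - apply: (measurability (@coordinate_sets R d)); first exact: measurable_rV_generated.
    move=> _ [_ [j _ [B mB <-]] <-]; rewrite !setTI.
    by have := mobs (inl j) measurableT B mB; rewrite setTI.
  - exact: (mobs (inr true)).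
  - apply: measurable_to_mode => k.
    have := mobs (inr false) measurableT [set (k : nat)%:R] (measurable_set1 _).
    rewrite setTI; congr measurable; apply/seteqP; split => z /=.
      by move/eqP; rewrite eqr_nat => /eqP /val_inj.
    by move=> ->.
move=> A mA; have := mid measurableT A mA; rewrite setTI.
rewrite [X in measurable X](_ : _ = A)//.
by apply/seteqP; split => -[[x a] i].
Qed.

Lemma observable_right_cvg k z r : K z -> 0 <= r -> 0 < G z r ->
  observable k (dr z s) @[s --> r^'+] --> observable k (dr z r).
Proof.
move=> Kz r0 _; apply: cvg_at_right_filter; case: k => [j|[]] /=.
- rewrite /dr /total_drift /pos/=.
  have h : {for r, continuous (fun s => forward_flow D (mode z) (s, pos z))}.
    apply: (@continuous_comp _ _ _ (fun s : R => (s, pos z)) (forward_flow D (mode z))).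
      have c1 : (fun s : R => s) @ r --> r by exact: cvg_id.
      have c2 : (fun _ : R => pos z) @ r --> pos z by exact: cvg_cst.
      exact: (cvg_pair c1 c2).
    exact: forward_flow_continuous.
  have hc := @coord_continuous R 1 d ord0 j.
  exact: (continuous_comp h (hc _)).
- by apply: cvgD; [exact: cvg_cst|exact: cvg_id].
- exact: cvg_cst.
Qed.

Section law.
Context (dO : measure_display) (Omega : measurableType dO) (P : probability Omega R)
  (U V : nat -> Omega -> R).
Hypothesis HUV : independent_uniforms P U V.

(** By induction the chain of states and the jump times agree, since the chain
    stays in the state space and the driving variables stay in ]0, 1]. *)
Lemma process_trajectory z : K z -> trajectory_process dr W J U V z = process D U V z.
Proof.
move=> Kz; apply/funext => t; apply/funext => w.
rewrite /trajectory_process /process; set e := noise U V w.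
have ae := admissible_noise HUV w.
have Kc k := chain_in switching_dynamics k Kz ae.
have chE k : embedded_chain J z e k = skeleton D z (fun k => U k w) (fun k => V k w) k.
  elim: k => //= k IH; rewrite {1}/J total_jumpE ?IH//; last exact: (ae (inl k)).
  by rewrite -IH; exact: Kc.
have epE k : jump_epoch W J z e k = jump_time D z (fun k => U k w) (fun k => V k w) k.
  elim: k => //= k IH; rewrite IH {1}/W total_waitingE ?chE//; last exact: (ae (inl k)).
  by rewrite -chE; exact: Kc.
have runE : running_index W J z e t = between_jumps D z (fun k => U k w) (fun k => V k w) t.
  by apply/seteqP; split => k; rewrite /running_index /between_jumps /mkset !epE.
rewrite /trajectory /path_of runE; case: pselect => // ne; cbv zeta.
rewrite chE epE /dr total_driftE// subr_ge0.
by have := xgetPex 0%N ne => /andP[].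
Qed.

Lemma process_strong_markov : strong_markov P K (process D U V).
Proof.
apply: (strong_markov_ext (Z := trajectory_process dr W J U V)).
  by move=> z Kz; exact: process_trajectory.
exact: (renewal_strong_markov switching_dynamics HUV observable_generate observable_right_cvg).
Qed.
End law.
End instance.

Theorem proposition3 (R : realType) (d n : nat) (D : switching_data R d n)
    (HD : standing_assumptions D)
    (dO : measure_display) (Omega : measurableType dO) (P : probability Omega R)
    (U V : nat -> Omega -> R) (HUV : independent_uniforms P U V) :
  strong_markov P (state_space D) (process D U V).
Proof. exact: process_strong_markov. Qed.
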